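(* For every integer $m\ge 1$ (and every $q\in\mathbb{C}\setminus\{0,-1,-2,\ldots\}$), $\psi(-m,q)=\psi^{(-m)}(q)$, where $\psi(z,q)$ is the generalized polygamma function and $\psi^{(-m)}(q)$ is the balanced negapolygamma function.
   Context: For $q\in\mathbb{C}\setminus\{0,-1,-2,\ldots\}$, $\zeta(s,q)$ is the Hurwitz zeta function, $\zeta(s,q)=\sum_{n=0}^\infty (n+q)^{-s}$ for $\mathrm{Re}\,s>1$ (principal branch of the powers), continued meromorphically in $s$ to $\mathbb{C}$ (its only singularity is a simple pole at $s=1$ with residue $1$); $\zeta'(s,q)=\frac{\partial}{\partial s}\zeta(s,q)$. $\gamma$ is Euler's constant. The generalized polygamma function is defined by $\psi(z,q):=e^{-\gamma z}\frac{\partial}{\partial z}\left[e^{\gamma z}\frac{\zeta(z+1,q)}{\Gamma(-z)}\right]$ for $z\in\mathbb{C}\setminus\{0,1,2,\ldots\}$, and at $z\in\{0,1,2,\ldots\}$ by the corresponding limiting value. The balanced negapolygamma functions are defined for integers $m\ge1$ by $\psi^{(-m)}(q):=\frac{1}{m!}\left[A_m(q)-H_{m-1}B_m(q)\right]$, where $A_m(q):=m\,\zeta'(1-m,q)$, $B_m(q)$ is the $m$-th Bernoulli polynomial, and $H_r=1+\frac12+\cdots+\frac1r$ with $H_0=0$. *)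

(* Defs.v *)
From Stdlib Require Import Reals Factorial ClassicalEpsilon.
From Coquelicot Require Import Coquelicot.

Open Scope R_scope.

(** ** Complex exponential, logarithm and powers *)

Definition Cexp (z : C) : C :=
  (exp (Re z) * cos (Im z), exp (Re z) * sin (Im z)).

(* Principal argument, with values in (-PI, PI]; only meaningful for z <> 0. *)
Definition Carg (z : C) : R :=
  if Rle_dec 0 (Im z) then acos (Re z / Cmod z) else - acos (Re z / Cmod z).

Definition Clog (z : C) : C := (ln (Cmod z), Carg z).

Definition Cpower (w s : C) : C := Cexp (s * Clog w).

(** ** Euler's constant and harmonic numbers *)

Definition harmonic (r : nat) : R := sum_n_m (fun k => / INR k) 1 r.

Definition euler_gamma : R := Lim_seq (fun n => harmonic n - ln (INR n)).

(** ** Gamma function *)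

Definition C_lim_seq (u : nat -> C) : C :=
  (real (Lim_seq (fun n => Re (u n))), real (Lim_seq (fun n => Im (u n)))).

(* z (z + 1) ... (z + n) *)
Fixpoint rising (z : C) (n : nat) : C :=
  match n with
  | O => z
  | S p => (rising z p * (z + INR n))%C
  end.

(* Euler's (Gauss's) product; only meaningful for z not in {0, -1, -2, ...}. *)
Definition Gamma (z : C) : C :=
  C_lim_seq (fun n => INR (fact n) * Cpower (INR n) z / rising z n)%C.

(** ** Hurwitz zeta function *)

Definition analytic_at (f : C -> C) (s0 : C) : Prop :=
  exists a : nat -> C,
    locally s0 (fun s : C =>
      @is_pseries C_AbsRing C_NormedModule a (s - s0)%C (f s)).

(* Nothing is required of the value at the pole s = 1. *)
Definition is_hurwitz_zeta (q : C) (Z : C -> C) : Prop :=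
  (forall s : C, 1 < Re s ->
     @is_series C_AbsRing C_NormedModule
       (fun n => Cpower (INR n + q) (- s)) (Z s)) /\
  (forall s : C, s <> RtoC 1 -> analytic_at Z s) /\
  (exists h : C -> C, analytic_at h 1 /\
     locally' (RtoC 1) (fun s : C => Z s = (1 / (s - 1) + h s)%C)).

(* For q outside {0, -1, -2, ...} the predicate above determines Z uniquely
   away from s = 1; the value at s = 1 is unspecified. *)
Definition hurwitz_zeta (s q : C) : C :=
  epsilon (inhabits (fun _ : C => RtoC 0)) (is_hurwitz_zeta q) s.

Definition hurwitz_zeta' (s q : C) : C := C_derive (fun t => hurwitz_zeta t q) s.

(** ** Generalized polygamma function *)

(* Coquelicot's total operators C_lim and C_derive return the complex limit
   and the complex derivative whenever these exist (is_C_lim_unique,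
   is_C_derive_unique). *)

Definition polygamma_formula (z q : C) : C :=
  (Cexp (- (euler_gamma * z)) *
   C_derive (fun w => Cexp (euler_gamma * w) *
                      (hurwitz_zeta (w + 1) q / Gamma (- w))) z)%C.

Definition polygamma (z q : C) : C :=
  if excluded_middle_informative (exists n : nat, z = RtoC (INR n))
  then C_lim (fun w => polygamma_formula w q) z
  else polygamma_formula z q.

(** ** Bernoulli polynomials *)

(* [bernoulli_upto n k] is the k-th Bernoulli number for k <= n, by
   sum_(j <= n) 'C(n + 1, j) B_j = 0 for n >= 1 (so B_1 = - 1 / 2). *)
Fixpoint bernoulli_upto (n : nat) : nat -> R :=
  match n with
  | O => fun _ => 1
  | S p => fun k =>
      if Nat.leb k p then bernoulli_upto p k
      else - / INR (n + 1) *
             sum_n (fun j => Binomial.C (n + 1) j * bernoulli_upto p j) p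
  end.

Definition bernoulli (n : nat) : R := bernoulli_upto n n.

Definition bernoulli_poly (m : nat) (q : C) : C :=
  sum_n (fun k => (RtoC (Binomial.C m k * bernoulli k) * q ^ (m - k))%C) m.

(** ** Balanced negapolygamma functions *)

Definition negapolygamma_A (m : nat) (q : C) : C :=
  (INR m * hurwitz_zeta' (1 - INR m) q)%C.

(* psi^(-m)(q), for m >= 1. *)
Definition negapolygamma (m : nat) (q : C) : C :=
  (/ INR (fact m) *
   (negapolygamma_A m q - harmonic (m - 1) * bernoulli_poly m q))%C.

(* Main.v *)
Require Import Defs.
From Stdlib Require Import Reals Factorial ZArith Lra Lia Classical ClassicalEpsilon.
From Coquelicot Require Import Coquelicot.

(** Near w = - m the function w |-> 1 / Gamma (- w) has value 1 / (m - 1)! and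
    derivative (H_(m-1) - gamma) / (m - 1)!.  In the product rule for
    e^(gamma w) zeta (w + 1, q) / Gamma (- w) the derivative of the exponential
    cancels the term in gamma, and what is left is
    (zeta' (1 - m, q) + H_(m-1) zeta (1 - m, q)) / (m - 1)!.  The identity is
    therefore equivalent to the classical value zeta (1 - m, q) = - B_m (q) / m.

    The zeta function is known only through the properties that characterize it,
    so it must be shown that a function with these properties exists, and that
    they determine its value at 1 - m.  Existence is Euler-Maclaurin summation in
    exact form.  With a = 1 - s, let
    b_K (a, y) = sum_(k <= K) binom (a, k) B_k y^(a-k), a truncated Bernoulli
    polynomial of complex degree a.  By the binomial series and the recurrence of
    the Bernoulli numbers, the defect
    b_K (a, y + 1) - b_K (a, y) - a y^(a-1) is y^a times a power series in 1 / y
    that starts at exponent K + 2 (em_expansion, em_coef_zero).  Hence for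
    K >= |a| + 1 the sum of b_K (a, q) and of the defects at y = q + n converges;
    it does not depend on K and is an entire function of a, gen_bernoulli q a.
    For Re a < 0 the truncated polynomials at q + n tend to 0 and telescope
    against the defects, so that the sum is - a zeta (1 - a, q)
    (gen_bernoulli_series); for a = m all defects vanish and the sum is B_m (q)
    (gen_bernoulli_nat).  The continuation is gen_bernoulli q (1 - s) / (s - 1),
    and its residue at 1 is B_0 (q) = 1.

    Analyticity means the existence of local power series.  It is obtained
    without Cauchy theory from the Banach algebra of power series with finite
    weighted coefficient sum (wiener): polynomials and exponentials in a have
    explicit norms there, and dominated infinite sums remain in the algebra
    (wiener_sum).  Uniqueness is the identity theorem along the segment from
    1 - m to 2 + i, which avoids the pole (segment_identity).

    The expansion of 1 / Gamma follows from the Euler product, with each factor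
    1 + x written as exp (x + O(x^2)) (Gamma_near).  All derivatives are obtained
    from first-order expansions with quadratic remainder (first_order). *)

(** * Limits and series of complex numbers *)

(** Naming the module structure of C over itself once spares unification the choice
    between it and the structure of C over R. *)
Definition Cseries (a : nat -> C) (l : C) : Prop :=
  @is_series C_AbsRing C_NormedModule a l.

(** Stated through the real sequence of distances, so that the comparison lemmas for real
    limits apply. *)
Definition Ccv (u : nat -> C) (l : C) : Prop :=
  is_lim_seq (fun n => Cmod (u n - l)) 0.

Definition Csum (a : nat -> C) (n : nat) : C := @sum_n C_AbelianMonoid a n.

Lemma Csum_S a n : Csum a (S n) = (Csum a n + a (S n))%C.
Proof. exact (sum_Sn a n). Qed.

Lemma Csum_0 a : Csum a 0 = a 0%nat.
Proof. exact (sum_O a). Qed.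

Lemma Csum_incr (a : nat -> C) N : Csum a (S N) = (a 0%nat + Csum (fun n => a (S n)) N)%C.
Proof.
induction N as [|N IH].
- now rewrite Csum_S, !Csum_0.
- rewrite Csum_S, IH, (Csum_S (fun n => a (S n))). ring.
Qed.

Lemma Csum_RtoC (a : nat -> R) N : Csum (fun n => RtoC (a n)) N = RtoC (sum_n a N).
Proof.
induction N as [|N IH]; [now rewrite Csum_0, sum_O|].
rewrite Csum_S, sum_Sn, IH. symmetry. apply RtoC_plus.
Qed.

Lemma Cseries_Ccv a l : Cseries a l <-> Ccv (Csum a) l.
Proof.
unfold Cseries, is_series, Ccv.
rewrite <- is_lim_seq_spec; unfold is_lim_seq'.
split.
- intros H eps.
  apply (filterlim_locally_ball_norm (sum_n a) l) with (eps := eps) in H.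
  destruct H as [N HN]; exists N; intros n Hn.
  generalize (HN n Hn). unfold ball_norm. intros H1.
  rewrite Rminus_0_r, Rabs_pos_eq by apply Cmod_ge_0. exact H1.
- intros H. apply (filterlim_locally_ball_norm (sum_n a) l). intros eps.
  destruct (H eps) as [N HN]; exists N; intros n Hn.
  generalize (HN n Hn).
  rewrite Rminus_0_r, Rabs_pos_eq by apply Cmod_ge_0. intros H1; exact H1.
Qed.

Lemma locally_Cmod (s0 : C) (P : C -> Prop) :
  locally s0 P <-> exists r, 0 < r /\ forall s, Cmod (s - s0) < r -> P s.
Proof.
split.
- intros H. generalize (@locally_norm_le_locally C_AbsRing C_NormedModule s0 P H). clear H; intros H.
  destruct H as [e He]. exists e. split. apply cond_pos.
  intros s Hs. apply He. exact Hs.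
- intros [r [Hr H]].
  apply (@locally_le_locally_norm C_AbsRing C_NormedModule s0 P).
  exists (mkposreal r Hr). intros s Hs. apply H. exact Hs.
Qed.

Lemma Ccv_squeeze u l (v : nat -> R) :
  eventually (fun n => Cmod (u n - l) <= v n) -> is_lim_seq v 0 -> Ccv u l.
Proof.
intros H Hv. apply is_lim_seq_le_le_loc with (fun _ => 0) v.
- generalize H; apply filter_imp. intros n Hn; split; [apply Cmod_ge_0 | exact Hn].
- apply is_lim_seq_const.
- exact Hv.
Qed.

Lemma Ccv_ext_loc (u v : nat -> C) l : eventually (fun n => u n = v n) -> Ccv u l -> Ccv v l.
Proof.
intros H; apply is_lim_seq_ext_loc. generalize H; apply filter_imp.
intros n Hn; now rewrite Hn.
Qed.

Lemma Ccv_ext (u v : nat -> C) l : (forall n, u n = v n) -> Ccv u l -> Ccv v l.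
Proof. intros H; apply Ccv_ext_loc; exists 0%nat; auto. Qed.

Lemma Ccv_const c : Ccv (fun _ => c) c.
Proof.
apply is_lim_seq_ext with (fun _ => 0); [|apply is_lim_seq_const].
intros n. replace (c - c)%C with (RtoC 0) by ring. now rewrite Cmod_0.
Qed.

Lemma Ccv_plus (u v : nat -> C) a b :
  Ccv u a -> Ccv v b -> Ccv (fun n => u n + v n)%C (a + b)%C.
Proof.
intros Hu Hv.
apply Ccv_squeeze with (fun n => Cmod (u n - a) + Cmod (v n - b)).
- exists 0%nat; intros n _.
  replace (u n + v n - (a + b))%C with ((u n - a) + (v n - b))%C by ring.
  apply Cmod_triangle.
- replace 0 with (0 + 0) by ring. now apply is_lim_seq_plus'.
Qed.

Lemma Ccv_scal (c : C) (u : nat -> C) (a : C) : Ccv u a -> Ccv (fun n => c * u n)%C (c * a)%C.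
Proof.
intros Hu.
apply is_lim_seq_ext with (fun n => Cmod c * Cmod (u n - a)).
- intros n. rewrite <- Cmod_mult. f_equal. ring.
- replace 0 with (Cmod c * 0) by ring.
  apply (is_lim_seq_scal_l _ _ 0). exact Hu.
Qed.

Lemma Ccv_minus (u v : nat -> C) a b :
  Ccv u a -> Ccv v b -> Ccv (fun n => u n - v n)%C (a - b)%C.
Proof.
intros Hu Hv.
replace (a - b)%C with (a + (-1) * b)%C by ring.
apply Ccv_ext with (fun n => u n + (-1) * v n)%C; [intros; ring|].
now apply Ccv_plus; [|apply Ccv_scal].
Qed.

Lemma Ccv_incr u l : Ccv u l <-> Ccv (fun n => u (S n)) l.
Proof. apply (is_lim_seq_incr_1 (fun n => Cmod (u n - l))). Qed.

Lemma Ccv_bound u l M :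
  Ccv u l -> eventually (fun n => Cmod (u n) <= M) -> Cmod l <= M.
Proof.
intros Hu HM.
assert (H : Rbar_le (Cmod l) (M + 0)).
{ apply is_lim_seq_le_loc with (fun _ => Cmod l) (fun n => M + Cmod (u n - l)).
  - generalize HM; apply filter_imp. intros n Hn.
    replace l with (u n + - (u n - l))%C at 1 by ring.
    eapply Rle_trans; [apply Cmod_triangle|]. rewrite Cmod_opp. lra.
  - apply is_lim_seq_const.
  - apply is_lim_seq_plus'; [apply is_lim_seq_const | exact Hu]. }
simpl in H. lra.
Qed.

Lemma Ccv_unique u a b : Ccv u a -> Ccv u b -> a = b.
Proof.
intros Ha Hb. apply Ceq_minus. apply Cmod_eq_0.
apply Rle_antisym; [|apply Cmod_ge_0].
apply Ccv_bound with (fun n => u n - u n)%C.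
- now apply Ccv_minus.
- exists 0%nat; intros n _. replace (u n - u n)%C with (RtoC 0) by ring.
  rewrite Cmod_0; lra.
Qed.

Lemma Ccv_Cmod u l : Ccv u l -> is_lim_seq (fun n => Cmod (u n)) (Cmod l).
Proof.
intros H.
apply is_lim_seq_le_le with (fun n => Cmod l - Cmod (u n - l)) (fun n => Cmod l + Cmod (u n - l)).
- intros n. split.
  + replace (Cmod l) with (Cmod (u n + - (u n - l))) at 1 by (f_equal; ring).
    generalize (Cmod_triangle (u n) (- (u n - l))). rewrite Cmod_opp. lra.
  + replace (u n) with (l + (u n - l))%C at 1 by ring. apply Cmod_triangle.
- replace (Finite (Cmod l)) with (Finite (Cmod l - 0)) by (f_equal; ring).
  apply is_lim_seq_minus'; [apply is_lim_seq_const | exact H].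
- replace (Finite (Cmod l)) with (Finite (Cmod l + 0)) by (f_equal; ring).
  apply is_lim_seq_plus'; [apply is_lim_seq_const | exact H].
Qed.

Lemma Ccv_Re u l : Ccv u l -> is_lim_seq (fun n => Re (u n)) (Re l).
Proof.
intros Hu. apply is_lim_seq_ext with (fun n => Re l + Re (u n - l)).
- intros n. rewrite <- re_plus. f_equal. ring.
- replace (Finite (Re l)) with (Finite (Re l + 0)) by (f_equal; ring).
  apply is_lim_seq_plus'; [apply is_lim_seq_const|].
  apply is_lim_seq_abs_0.
  apply is_lim_seq_le_le with (fun _ => 0) (fun n => Cmod (u n - l)).
  + intros n; split; [apply Rabs_pos | apply re_le_Cmod].
  + apply is_lim_seq_const.
  + exact Hu.
Qed.

Lemma im_le_Cmod c : Rabs (Im c) <= Cmod c.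
Proof.
eapply Rle_trans; [apply Rmax_r|]. apply (Rmax_Cmod c).
Qed.

Lemma Cmod_le_Re_Im c : Cmod c <= Rabs (Re c) + Rabs (Im c).
Proof.
destruct c as [a b]; simpl.
replace (a, b) with (RtoC a + Ci * RtoC b)%C.
2:{ unfold Cplus, Cmult, Ci, RtoC; simpl. f_equal; ring. }
eapply Rle_trans; [apply Cmod_triangle|].
rewrite Cmod_mult, !Cmod_R.
replace (Cmod Ci) with 1; [lra|].
unfold Cmod, Ci; simpl. rewrite <- sqrt_1 at 1. f_equal. ring.
Qed.

Lemma Ccv_Im u l : Ccv u l -> is_lim_seq (fun n => Im (u n)) (Im l).
Proof.
intros Hu. apply is_lim_seq_ext with (fun n => Im l + Im (u n - l)).
- intros n. rewrite <- im_plus. f_equal. ring.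
- replace (Finite (Im l)) with (Finite (Im l + 0)) by (f_equal; ring).
  apply is_lim_seq_plus'; [apply is_lim_seq_const|].
  apply is_lim_seq_abs_0.
  apply is_lim_seq_le_le with (fun _ => 0) (fun n => Cmod (u n - l)).
  + intros n; split; [apply Rabs_pos | apply im_le_Cmod].
  + apply is_lim_seq_const.
  + exact Hu.
Qed.

Lemma Ccv_pair u l :
  is_lim_seq (fun n => Re (u n)) (Re l) -> is_lim_seq (fun n => Im (u n)) (Im l) ->
  Ccv u l.
Proof.
intros H1 H2.
assert (K : forall (v : nat -> R) (x : R), is_lim_seq v x ->
  is_lim_seq (fun n => Rabs (v n - x)) 0).
{ intros v x Hv. apply (is_lim_seq_abs_0 (fun n => v n - x)).
  replace (Finite 0) with (Finite (x - x)) by (f_equal; ring).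
  apply is_lim_seq_minus'; [exact Hv | apply is_lim_seq_const]. }
apply Ccv_squeeze with (fun n => Rabs (Re (u n) - Re l) + Rabs (Im (u n) - Im l)).
- exists 0%nat; intros n _. eapply Rle_trans; [apply Cmod_le_Re_Im|].
  unfold Cminus. rewrite re_plus, im_plus, re_opp, im_opp. apply Rle_refl.
- replace (Finite 0) with (Finite (0 + 0)) by (f_equal; ring).
  apply is_lim_seq_plus'; now apply K.
Qed.

Lemma Ccv_mult (u v : nat -> C) a b :
  Ccv u a -> Ccv v b -> Ccv (fun n => u n * v n)%C (a * b)%C.
Proof.
intros Hu Hv.
assert (H1 := Ccv_Re _ _ Hu). assert (H2 := Ccv_Im _ _ Hu).
assert (H3 := Ccv_Re _ _ Hv). assert (H4 := Ccv_Im _ _ Hv).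
apply Ccv_pair.
- rewrite re_mult. eapply is_lim_seq_ext; [intros n; symmetry; apply re_mult|].
  apply is_lim_seq_minus'; now apply is_lim_seq_mult'.
- rewrite im_mult. eapply is_lim_seq_ext; [intros n; symmetry; apply im_mult|].
  apply is_lim_seq_plus'; now apply is_lim_seq_mult'.
Qed.

Lemma Ccv_RtoC (u : nat -> R) (a : R) : is_lim_seq u a -> Ccv (fun n => RtoC (u n)) (RtoC a).
Proof. intros H. apply Ccv_pair; simpl; [exact H | apply is_lim_seq_const]. Qed.

Lemma Csum_ext_loc (a b : nat -> C) N :
  (forall n, (n <= N)%nat -> a n = b n) -> Csum a N = Csum b N.
Proof. exact (sum_n_ext_loc a b N). Qed.

Lemma Csum_ext (a b : nat -> C) N : (forall n, a n = b n) -> Csum a N = Csum b N.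
Proof. exact (sum_n_ext a b N). Qed.

Lemma Csum_plus (a b : nat -> C) N : Csum (fun n => a n + b n)%C N = (Csum a N + Csum b N)%C.
Proof. exact (sum_n_plus a b N). Qed.

Lemma Csum_scal (c : C) (a : nat -> C) N : Csum (fun n => c * a n)%C N = (c * Csum a N)%C.
Proof. exact (sum_n_mult_l (K := C_Ring) c a N). Qed.

Lemma Csum_zero (a : nat -> C) N : (forall n, (n <= N)%nat -> a n = 0%C) -> Csum a N = 0%C.
Proof.
induction N as [|N IH]; intros H.
- rewrite Csum_0. auto.
- rewrite Csum_S, IH, H; [ring | lia | intros n Hn; apply H; lia].
Qed.

Lemma Cmod_Csum (a : nat -> C) N : Cmod (Csum a N) <= sum_n (fun n => Cmod (a n)) N.
Proof.
induction N as [|N IH].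
- rewrite Csum_0, sum_O. apply Rle_refl.
- rewrite Csum_S, sum_Sn. eapply Rle_trans; [apply Cmod_triangle|].
  unfold plus; simpl. lra.
Qed.

Lemma Cseries_ext (a b : nat -> C) l : (forall n, a n = b n) -> Cseries a l -> Cseries b l.
Proof. exact (is_series_ext a b l). Qed.

Lemma Cseries_plus (a b : nat -> C) la lb :
  Cseries a la -> Cseries b lb -> Cseries (fun n => a n + b n)%C (la + lb)%C.
Proof. exact (is_series_plus a b la lb). Qed.

Lemma Cseries_scal (c : C) (a : nat -> C) l : Cseries a l -> Cseries (fun n => c * a n)%C (c * l)%C.
Proof. exact (is_series_scal (K := C_AbsRing) c a l). Qed.

Lemma Cseries_unique a l l' : Cseries a l -> Cseries a l' -> l = l'.
Proof. rewrite !Cseries_Ccv. apply Ccv_unique. Qed.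

Lemma Cseries_decr a l :
  Cseries (fun n => a (S n)) l -> Cseries a (a 0%nat + l)%C.
Proof.
intros H. apply (is_series_decr_1 (K := C_AbsRing) (V := C_NormedModule)).
change (Cseries (fun n => a (S n)) ((a 0%nat + l) + - a 0%nat)%C).
now replace ((a 0%nat + l) + - a 0%nat)%C with l by ring.
Qed.

Lemma Cseries_incr a l :
  Cseries a l -> Cseries (fun n => a (S n)) (l - a 0%nat)%C.
Proof.
intros H. apply (is_series_incr_1 (K := C_AbsRing) (V := C_NormedModule)).
change (Cseries a ((l - a 0%nat) + a 0%nat)%C).
now replace ((l - a 0%nat) + a 0%nat)%C with l by ring.
Qed.

Lemma Cseries_finite (a : nat -> C) N :
  (forall n, (N < n)%nat -> a n = 0%C) -> Cseries a (Csum a N).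
Proof.
intros H. apply Cseries_Ccv. apply Ccv_ext_loc with (fun _ => Csum a N).
2: apply Ccv_const.
exists N. intros n Hn. induction Hn as [|n Hn IH]; [reflexivity|].
rewrite Csum_S, <- IH, H by lia. ring.
Qed.

Lemma Cseries_zero (a : nat -> C) : (forall n, a n = 0%C) -> Cseries a 0%C.
Proof.
intros H. rewrite <- (Csum_zero a 0) by auto. apply Cseries_finite; auto.
Qed.

(** The partial sums are u 0 - u (n + 1). *)
Lemma Cseries_telescope (u : nat -> C) l :
  Ccv u l -> Cseries (fun n => u n - u (S n))%C (u 0%nat - l)%C.
Proof.
intros Hu. apply Cseries_Ccv.
apply Ccv_ext with (fun n => u 0%nat - u (S n))%C.
- intros n; induction n as [|n IH].
  + now rewrite Csum_0.
  + rewrite Csum_S, <- IH. ring.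
- apply Ccv_minus; [apply Ccv_const | now apply (Ccv_incr u)].
Qed.

(** * Dominated convergence of series *)

Definition bounded_sums (M : nat -> R) (B : R) : Prop :=
  forall N, sum_n M N <= B.

Lemma bounded_sums_series M B :
  (forall n, 0 <= M n) -> bounded_sums M B -> exists S, is_series M S /\ S <= B.
Proof.
intros HM HB.
destruct (ex_finite_lim_seq_incr (sum_n M) B) as [S HS].
- intros n. rewrite sum_Sn. unfold plus; simpl. generalize (HM (S n)); lra.
- exact HB.
- exists S. split; [exact HS|].
  apply (is_lim_seq_le (sum_n M) (fun _ => B) S B); auto.
  apply is_lim_seq_const.
Qed.

Lemma is_series_bounded_sums M S :
  (forall n, 0 <= M n) -> is_series M S -> bounded_sums M S.
Proof.
intros HM HS N.
apply (is_lim_seq_incr_compare (sum_n M) S HS).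
intros n. rewrite sum_Sn. unfold plus; simpl. generalize (HM (Datatypes.S n)); lra.
Qed.

(** Weierstrass M-test; the limit inherits the bound of the majorant. *)
Lemma dominated_series (a : nat -> C) (M : nat -> R) B :
  (forall n, Cmod (a n) <= M n) -> bounded_sums M B ->
  exists l, Cseries a l /\ Cmod l <= B.
Proof.
intros Ha HB.
assert (HM : forall n, 0 <= M n).
{ intros n; eapply Rle_trans; [apply Cmod_ge_0 | apply Ha]. }
destruct (bounded_sums_series M B HM HB) as [S [HS _]].
destruct (ex_series_le (V := C_CompleteNormedModule) a M) as [l Hl].
- exact Ha.
- now exists S.
- assert (Hl' : Cseries a l) by exact Hl.
  exists l. split; [exact Hl'|].
  apply Cseries_Ccv in Hl'. apply Ccv_bound with (1 := Hl').
  exists 0%nat; intros n _. eapply Rle_trans; [apply Cmod_Csum|].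
  eapply Rle_trans; [|apply (HB n)]. now apply sum_n_m_le.
Qed.

Lemma dominated_tail (a : nat -> C) (M : nat -> R) l S N :
  (forall n, Cmod (a n) <= M n) -> Cseries a l -> is_series M S ->
  Cmod (l - Csum a N) <= S - sum_n M N.
Proof.
intros Ha Hl HS.
assert (HM : forall n, 0 <= M n).
{ intros n; eapply Rle_trans; [apply Cmod_ge_0 | apply Ha]. }
apply Cseries_Ccv in Hl.
apply Ccv_bound with (fun n => Csum a n - Csum a N)%C.
- apply Ccv_minus; [exact Hl | apply Ccv_const].
- exists N. intros n Hn.
  apply Rle_trans with (sum_n M n - sum_n M N).
  + induction Hn as [|n Hn IH].
    * replace (Csum a N - Csum a N)%C with (RtoC 0) by ring.
      rewrite Cmod_0. lra.
    * rewrite Csum_S, sum_Sn. unfold plus; simpl.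
      replace (Csum a n + a (Datatypes.S n) - Csum a N)%C
        with ((Csum a n - Csum a N) + a (Datatypes.S n))%C by ring.
      eapply Rle_trans; [apply Cmod_triangle|].
      generalize (Ha (Datatypes.S n)); lra.
  + generalize (is_series_bounded_sums M S HM HS n); lra.
Qed.

Lemma Ccv_Csum (u : nat -> nat -> C) N :
  (forall n, (n <= N)%nat -> Ccv (u n) 0%C) ->
  Ccv (fun K => Csum (fun n => u n K) N) 0%C.
Proof.
induction N as [|N IH]; intros H.
- apply Ccv_ext with (u 0%nat); [intros; now rewrite Csum_0 | auto].
- apply Ccv_ext with (fun K => Csum (fun n => u n K) N + u (S N) K)%C.
  + intros K; now rewrite Csum_S.
  + replace (RtoC 0) with (0 + 0)%C by ring. apply Ccv_plus; auto.
Qed.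

(** Beyond an index that depends only on M, the terms contribute at most eps / 2 for every
    K; the finitely many others tend to 0. *)
Lemma tannery (u : nat -> nat -> C) (U : nat -> C) M B :
  (forall n K, Cmod (u n K) <= M n) -> bounded_sums M B ->
  (forall n, Ccv (u n) 0%C) ->
  (forall K, Cseries (fun n => u n K) (U K)) -> Ccv U 0%C.
Proof.
intros Hu HB H0 HU.
assert (HM : forall n, 0 <= M n).
{ intros n; eapply Rle_trans; [apply Cmod_ge_0 | apply (Hu n 0%nat)]. }
destruct (bounded_sums_series M B HM HB) as [S [HS _]].
unfold Ccv. rewrite <- is_lim_seq_spec. intros eps.
assert (He : 0 < eps / 2) by (generalize (cond_pos eps); lra).
assert (HS' : is_lim_seq (sum_n M) S) by exact HS.
apply is_lim_seq_spec in HS'.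
(* N cuts off the tail of the majorant; K0 then controls the first N + 1 terms. *)
destruct (HS' (mkposreal _ He)) as [N HN].
generalize (Ccv_Csum u N (fun n _ => H0 n)). intros HF.
apply is_lim_seq_spec in HF.
destruct (HF (mkposreal _ He)) as [K0 HK].
exists K0. intros K HKK.
specialize (HK K HKK). specialize (HN N (le_n N)). simpl in HK, HN.
rewrite Rminus_0_r, Rabs_pos_eq in HK by apply Cmod_ge_0.
rewrite Rminus_0_r, Rabs_pos_eq by apply Cmod_ge_0.
generalize (dominated_tail _ M (U K) S N (fun n => Hu n K) (HU K) HS).
intros HT.
replace (U K - 0)%C with
  ((U K - Csum (fun n => u n K) N) + (Csum (fun n => u n K) N - 0))%C by ring.
eapply Rle_lt_trans; [apply Cmod_triangle|].
apply Rabs_def2 in HN. lra.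
Qed.

Lemma sum_n_nonneg (M : nat -> R) :
  (forall n, 0 <= M n) -> forall n, 0 <= M n /\ 0 <= sum_n M n.
Proof.
intros HM n. split; [apply HM|]. induction n as [|n IH]; [rewrite sum_O; auto|].
rewrite sum_Sn. unfold plus; simpl. generalize (HM (S n)); lra.
Qed.

Lemma bounded_sums_term M B n : (forall n, 0 <= M n) -> bounded_sums M B -> M n <= B.
Proof.
intros HM HB. eapply Rle_trans; [|apply (HB n)].
destruct n as [|n]; [rewrite sum_O; apply Rle_refl|].
rewrite sum_Sn. unfold plus; simpl.
assert (0 <= sum_n M n); [|lra].
clear -HM. induction n as [|n IH]; [rewrite sum_O; auto|].
rewrite sum_Sn. unfold plus; simpl. generalize (HM (S n)); lra.
Qed.

Lemma bounded_sums_le M M' B :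
  (forall n, M n <= M' n) -> bounded_sums M' B -> bounded_sums M B.
Proof.
intros H HB N. eapply Rle_trans; [|apply (HB N)]. now apply sum_n_m_le.
Qed.

Lemma bounded_sums_scal c M B :
  0 <= c -> bounded_sums M B -> bounded_sums (fun n => c * M n) (c * B).
Proof.
intros Hc HB N.
change (sum_n (fun n => mult c (M n)) N <= c * B).
rewrite (sum_n_mult_l (K := R_Ring)). now apply Rmult_le_compat_l.
Qed.

Lemma bounded_sums_0 M B : bounded_sums M B -> M 0%nat <= B.
Proof. intros H. generalize (H 0%nat). now rewrite sum_O. Qed.

Lemma sum_n_incr (M : nat -> R) N : sum_n M (S N) = M 0%nat + sum_n (fun n => M (S n)) N.
Proof.
induction N as [|N IH].
- now rewrite sum_Sn, !sum_O.
- rewrite sum_Sn, IH, (sum_Sn _ N). unfold plus; simpl. ring.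
Qed.

Lemma bounded_sums_decr M B :
  bounded_sums (fun n => M (S n)) B -> 0 <= B -> bounded_sums M (M 0%nat + B).
Proof.
intros HB HB0 [|N]; [rewrite sum_O; lra|].
rewrite sum_n_incr. generalize (HB N); lra.
Qed.

Lemma bounded_sums_incr M B :
  0 <= M 0%nat -> bounded_sums M B -> bounded_sums (fun n => M (S n)) B.
Proof.
intros H0 HB N. generalize (HB (S N)). rewrite sum_n_incr. lra.
Qed.

Lemma Cseries_Csum (a : nat -> nat -> C) (c : nat -> C) K :
  (forall k, Cseries (fun n => a n k) (c k)) ->
  Cseries (fun n => Csum (a n) K) (Csum c K).
Proof.
intros H. induction K as [|K IH].
- rewrite Csum_0. apply Cseries_ext with (2 := H 0%nat).
  intros n; now rewrite Csum_0.
- rewrite Csum_S. apply Cseries_ext with (2 := Cseries_plus _ _ _ _ IH (H (S K))).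
  intros n; now rewrite Csum_S.
Qed.

(** Apply Tannery's theorem to the differences between the K-th partial sum of row n and
    its limit: these tend to 0 for each n and are at most 2 M n. *)
Lemma Cseries_swap (a : nat -> nat -> C) (S c : nat -> C) T M B :
  (forall n, Cseries (a n) (S n)) ->
  (forall n, bounded_sums (fun k => Cmod (a n k)) (M n)) ->
  bounded_sums M B ->
  (forall k, Cseries (fun n => a n k) (c k)) ->
  Cseries S T -> Cseries c T.
Proof.
intros HS Ha HM Hc HT.
assert (HK : forall n K, Cmod (Csum (a n) K) <= M n).
{ intros n K. eapply Rle_trans; [apply Cmod_Csum | apply Ha]. }
assert (HSn : forall n, Cmod (S n) <= M n).
{ intros n. generalize (HS n). rewrite Cseries_Ccv. intros H.
  apply Ccv_bound with (1 := H). exists 0%nat; auto. }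
apply Cseries_Ccv.
apply Ccv_ext with (fun K => (Csum c K - T) + T)%C; [intros; ring|].
cut (Ccv (fun K => (Csum c K - T) + T)%C (0 + T)%C); [now rewrite Cplus_0_l|].
apply Ccv_plus; [|apply Ccv_const].
apply tannery with (u := fun n K => (Csum (a n) K - S n)%C) (M := fun n => 2 * M n)
  (B := 2 * B).
- intros n K. unfold Cminus. eapply Rle_trans; [apply Cmod_triangle|].
  rewrite Cmod_opp. generalize (HK n K) (HSn n); lra.
- apply bounded_sums_scal; [lra | exact HM].
- intros n. replace (RtoC 0) with (S n - S n)%C by ring.
  apply Ccv_minus; [|apply Ccv_const]. now apply Cseries_Ccv.
- intros K. apply Cseries_ext with (fun n => Csum (a n) K + (-1) * S n)%C.
  + intros n; ring.
  + replace (Csum c K - T)%C with (Csum c K + (-1) * T)%C by ring.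
    apply Cseries_plus; [now apply Cseries_Csum | now apply Cseries_scal].
Qed.

(** The bound holds for the partial sums of the columns, by exchanging two finite sums, and
    passes to the limit. *)
Lemma sum_n_Cmod_column (a : nat -> nat -> C) (c : nat -> C) (w : nat -> R) M B K :
  (forall k, 0 <= w k) ->
  (forall n, bounded_sums (fun k => Cmod (a n k) * w k) (M n)) ->
  bounded_sums M B ->
  (forall k, Cseries (fun n => a n k) (c k)) ->
  sum_n (fun k => Cmod (c k) * w k) K <= B.
Proof.
intros Hw Ha HM Hc.
assert (H : forall N, sum_n (fun k => Cmod (Csum (fun n => a n k) N) * w k) K <= B).
{ intros N. eapply Rle_trans; [|apply (HM N)].
  apply Rle_trans with (sum_n (fun k => sum_n (fun n => Cmod (a n k) * w k) N) K).
  - apply sum_n_m_le. intros k.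
    eapply Rle_trans; [apply Rmult_le_compat_r; [apply Hw | apply Cmod_Csum]|].
    apply Req_le. symmetry. apply (sum_n_mult_r (K := R_Ring) (w k)).
  - rewrite sum_n_switch. apply sum_n_m_le. intros n. apply Ha. }
assert (HL : is_lim_seq (fun N => sum_n (fun k => Cmod (Csum (fun n => a n k) N) * w k) K)
   (sum_n (fun k => Cmod (c k) * w k) K)).
{ clear H. induction K as [|K IH].
  - rewrite sum_O. apply is_lim_seq_ext with
      (fun N => Cmod (Csum (fun n => a n 0%nat) N) * w 0%nat).
    { intros; now rewrite sum_O. }
    apply (is_lim_seq_scal_r _ _ (Cmod (c 0%nat))).
    apply Ccv_Cmod. now apply Cseries_Ccv.
  - rewrite sum_Sn.
    eapply is_lim_seq_ext; [intros N; symmetry; apply sum_Sn|].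
    apply is_lim_seq_plus'; [exact IH|].
    apply (is_lim_seq_scal_r _ _ (Cmod (c (S K)))).
    apply Ccv_Cmod. now apply Cseries_Ccv. }
apply (is_lim_seq_le _ (fun _ => B) (sum_n (fun k => Cmod (c k) * w k) K) B H HL).
apply is_lim_seq_const.
Qed.

(** * Power series with absolutely summable weighted coefficients *)

(** The power series about 0 with weighted coefficient norm at most M form a Banach algebra
    whose estimates involve only coefficients.  A series of such functions converges in norm,
    hence to a function with a power series; for a bound on the functions alone this would
    need Cauchy estimates. *)
Definition wiener_coef (rho M : R) (a : nat -> C) (f : C -> C) : Prop :=
  bounded_sums (fun k => Cmod (a k) * rho ^ k) M /\
  forall h, Cmod h <= rho -> Cseries (fun k => a k * h ^ k)%C (f h).

Definition wiener (rho M : R) (f : C -> C) : Prop :=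
  exists a, wiener_coef rho M a f.

Lemma wiener_le rho M M' f : M <= M' -> wiener rho M f -> wiener rho M' f.
Proof.
intros HM [a [Ha Hf]]. exists a. split; [|exact Hf].
intros N. eapply Rle_trans; [apply Ha | exact HM].
Qed.

Lemma wiener_ext rho M f g :
  (forall h, Cmod h <= rho -> f h = g h) -> wiener rho M f -> wiener rho M g.
Proof.
intros Hfg [a [Ha Hf]]. exists a. split; [exact Ha|].
intros h Hh. rewrite <- Hfg by exact Hh. auto.
Qed.

Lemma wiener_pos rho M f : 0 <= rho -> wiener rho M f -> 0 <= M.
Proof.
intros Hr [a [Ha _]]. generalize (bounded_sums_0 _ _ Ha). simpl.
generalize (Cmod_ge_0 (a 0%nat)). lra.
Qed.

Lemma wiener_bound rho M f h : wiener rho M f -> Cmod h <= rho -> Cmod (f h) <= M.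
Proof.
intros [a [Ha Hf]] Hh.
destruct (dominated_series (fun k => a k * h ^ k)%C (fun k => Cmod (a k) * rho ^ k) M) as [l [Hl Hb]]; [|exact Ha|].
- intros k. rewrite Cmod_mult, Cmod_pow.
  apply Rmult_le_compat_l; [apply Cmod_ge_0|].
  apply pow_incr. split; [apply Cmod_ge_0 | exact Hh].
- now rewrite (Cseries_unique _ _ _ (Hf h Hh) Hl).
Qed.

Lemma wiener_shrink rho rho' M f :
  0 <= rho' <= rho -> wiener rho M f -> wiener rho' M f.
Proof.
intros Hr [a [Ha Hf]]. exists a. split.
- apply bounded_sums_le with (2 := Ha). intros k.
  apply Rmult_le_compat_l; [apply Cmod_ge_0|]. now apply pow_incr.
- intros h Hh. apply Hf. lra.
Qed.

Lemma wiener_const rho c : wiener rho (Cmod c) (fun _ => c).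
Proof.
exists (fun k => match k with O => c | _ => RtoC 0 end). split.
- intros N. rewrite <- (Rplus_0_r (Cmod c)).
  replace (Cmod c) with (Cmod c * rho ^ 0) by (simpl; ring).
  revert N. apply (bounded_sums_decr (fun k => Cmod (match k with O => c | _ => RtoC 0 end) * rho ^ k)); [|lra].
  intros N. apply Req_le. clear. induction N as [|N IH].
  + rewrite sum_O, Cmod_0. ring.
  + rewrite sum_Sn, IH, Cmod_0. unfold plus; simpl. ring.
- intros h _.
  replace (Cseries _ c) with (Cseries (fun k => match k with O => c | _ => RtoC 0 end * h ^ k)%C
    (Csum (fun k => match k with O => c | _ => RtoC 0 end * h ^ k)%C 0)).
  + apply Cseries_finite. intros [|n] Hn; [lia | ring].
  + f_equal. rewrite Csum_0. simpl. ring.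
Qed.

Lemma wiener_plus rho M1 M2 f g :
  0 <= rho -> wiener rho M1 f -> wiener rho M2 g ->
  wiener rho (M1 + M2) (fun h => f h + g h)%C.
Proof.
intros Hr [a [Ha Hf]] [b [Hb Hg]]. exists (fun k => a k + b k)%C. split.
- intros N.
  apply Rle_trans with (sum_n (fun k => plus (Cmod (a k) * rho ^ k) (Cmod (b k) * rho ^ k)) N).
  + apply sum_n_m_le. intros k. unfold plus; simpl.
    rewrite <- Rmult_plus_distr_r. apply Rmult_le_compat_r; [now apply pow_le|].
    apply Cmod_triangle.
  + rewrite sum_n_plus. apply Rplus_le_compat; [apply Ha | apply Hb].
- intros h Hh.
  apply Cseries_ext with (2 := Cseries_plus _ _ _ _ (Hf h Hh) (Hg h Hh)).
  intros k; ring.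
Qed.

Lemma wiener_scal rho M c f :
  wiener rho M f -> wiener rho (Cmod c * M) (fun h => c * f h)%C.
Proof.
intros [a [Ha Hf]]. exists (fun k => c * a k)%C. split.
- apply bounded_sums_le with (fun k => Cmod c * (Cmod (a k) * rho ^ k)).
  + intros k. rewrite Cmod_mult. apply Req_le. ring.
  + apply bounded_sums_scal; [apply Cmod_ge_0 | exact Ha].
- intros h Hh. apply Cseries_ext with (2 := Cseries_scal c _ _ (Hf h Hh)).
  intros k; ring.
Qed.

Lemma wiener_mulX rho M f :
  0 <= rho -> wiener rho M f -> wiener rho (rho * M) (fun h => h * f h)%C.
Proof.
intros Hr HW. generalize (wiener_pos rho M f Hr HW). intros HM.
destruct HW as [a [Ha Hf]].
exists (fun k => match k with O => RtoC 0 | S k => a k end). split.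
- replace (rho * M) with (Cmod 0 * rho ^ 0 + rho * M) by (rewrite Cmod_0; ring).
  apply (bounded_sums_decr (fun k => Cmod (match k with O => RtoC 0 | S k => a k end) * rho ^ k)).
  + apply bounded_sums_le with (fun k => rho * (Cmod (a k) * rho ^ k)).
    * intros k. apply Req_le. simpl. ring.
    * now apply bounded_sums_scal.
  + now apply Rmult_le_pos.
- intros h Hh.
  replace (h * f h)%C with (0 * h ^ 0 + h * f h)%C by (simpl; ring).
  apply (Cseries_decr (fun k => (match k with O => RtoC 0 | S k => a k end) * h ^ k)%C).
  apply Cseries_ext with (2 := Cseries_scal h _ _ (Hf h Hh)).
  intros k; simpl; ring.
Qed.

(** The coefficients of F are the column sums of the array of coefficients of the f n. *)
Lemma wiener_sum rho (M : nat -> R) B (f : nat -> C -> C) (F : C -> C) :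
  0 < rho -> (forall n, wiener rho (M n) (f n)) -> bounded_sums M B ->
  (forall h, Cmod h <= rho -> Cseries (fun n => f n h) (F h)) ->
  wiener rho B F.
Proof.
intros Hr HW HB HF.
set (a := fun n => proj1_sig (constructive_indefinite_description _ (HW n))).
assert (Ha : forall n, wiener_coef rho (M n) (a n) (f n)).
{ intros n. unfold a. apply proj2_sig. }
clearbody a. clear HW.
assert (Hp : forall k, 0 < rho ^ k) by (intros; now apply pow_lt).
assert (Hcol : forall k, exists c, Cseries (fun n => a n k) c).
{ intros k.
  destruct (dominated_series (fun n => a n k) (fun n => / rho ^ k * M n) (/ rho ^ k * B))
    as [c [Hc _]].
  - intros n. apply Rmult_le_reg_l with (rho ^ k); [apply Hp|].
    rewrite <- Rmult_assoc, Rinv_r, Rmult_1_l by (apply Rgt_not_eq; apply Hp).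
    rewrite Rmult_comm.
    apply (bounded_sums_term (fun k => Cmod (a n k) * rho ^ k)).
    + intros j. apply Rmult_le_pos; [apply Cmod_ge_0 | apply Rlt_le, Hp].
    + apply Ha.
  - apply bounded_sums_scal; [|exact HB].
    apply Rlt_le, Rinv_0_lt_compat, Hp.
  - now exists c. }
set (c := fun k => proj1_sig (constructive_indefinite_description _ (Hcol k))).
assert (Hc : forall k, Cseries (fun n => a n k) (c k)).
{ intros n. unfold c. apply proj2_sig. }
clearbody c. clear Hcol.
exists c. split.
- intros K. apply sum_n_Cmod_column with (a := a) (M := M); auto.
  + intros k; apply Rlt_le, Hp.
  + intros n; apply Ha.
- intros h Hh.
  apply Cseries_swap with (a := fun n k => (a n k * h ^ k)%C) (S := fun n => f n h)
    (M := M) (B := B); auto.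
  + intros n. now apply Ha.
  + intros n. apply bounded_sums_le with (fun k => Cmod (a n k) * rho ^ k).
    * intros k. rewrite Cmod_mult, Cmod_pow.
      apply Rmult_le_compat_l; [apply Cmod_ge_0|].
      apply pow_incr. split; [apply Cmod_ge_0 | exact Hh].
    * apply Ha.
  + intros k. rewrite Cmult_comm.
    apply Cseries_ext with (2 := Cseries_scal (h ^ k)%C _ _ (Hc k)).
    intros n; ring.
Qed.

Lemma wiener_mulXn rho M f k :
  0 <= rho -> wiener rho M f -> wiener rho (rho ^ k * M) (fun h => h ^ k * f h)%C.
Proof.
intros Hr HW. induction k as [|k IH].
- simpl. rewrite Rmult_1_l. apply wiener_ext with (2 := HW). intros; ring.
- apply wiener_ext with (fun h => h * (h ^ k * f h))%C.
  + intros h _. simpl. ring.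
  + simpl. rewrite Rmult_assoc. now apply wiener_mulX.
Qed.

(** The product is the sum of the functions a_k h^k g (h), so the estimate is an instance of
    the one for infinite sums. *)
Lemma wiener_mult rho M1 M2 f g :
  0 < rho -> wiener rho M1 f -> wiener rho M2 g ->
  wiener rho (M1 * M2) (fun h => f h * g h)%C.
Proof.
intros Hr [a [Ha Hf]] Hg.
assert (HM2 := wiener_pos _ _ _ (Rlt_le _ _ Hr) Hg).
apply wiener_sum with (M := fun k => M2 * (Cmod (a k) * rho ^ k))
  (f := fun k h => (a k * (h ^ k * g h))%C); auto.
- intros k. apply wiener_le with (Cmod (a k) * (rho ^ k * M2)).
  + apply Req_le; ring.
  + apply wiener_scal. apply wiener_mulXn; [lra | exact Hg].
- rewrite Rmult_comm. now apply bounded_sums_scal.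
- intros h Hh. rewrite Cmult_comm.
  apply Cseries_ext with (2 := Cseries_scal (g h) _ _ (Hf h Hh)). intros k; ring.
Qed.

Lemma wiener_affine rho c d :
  0 <= rho -> wiener rho (Cmod c + Cmod d * rho) (fun h => c + d * h)%C.
Proof.
intros Hr. apply wiener_plus; [exact Hr | apply wiener_const|].
apply wiener_le with (rho * Cmod d); [apply Req_le; ring|].
apply wiener_ext with (fun h => h * d)%C; [intros; ring|].
apply wiener_mulX; [exact Hr | apply wiener_const].
Qed.

(** Division of f - f (0) by h.  It gives access to the Taylor coefficients one at a time,
    and removes a simple pole. *)
Lemma wiener_coef_shift rho M a f :
  0 < rho -> wiener_coef rho M a f ->
  exists g, wiener_coef rho (M / rho) (fun k => a (S k)) g /\
    forall h, Cmod h <= rho -> f h = (a 0%nat + h * g h)%C.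
Proof.
intros Hr [Ha Hf].
assert (Hb : bounded_sums (fun k => Cmod (a (S k)) * rho ^ k) (M / rho)).
{ apply bounded_sums_le with (fun k => / rho * (Cmod (a (S k)) * rho ^ (S k))).
  - intros k. apply Req_le. simpl. field. lra.
  - unfold Rdiv. rewrite Rmult_comm. apply bounded_sums_scal.
    + apply Rlt_le, Rinv_0_lt_compat, Hr.
    + apply (bounded_sums_incr (fun k => Cmod (a k) * rho ^ k)); [|exact Ha].
      simpl. generalize (Cmod_ge_0 (a 0%nat)); lra. }
assert (Hg : forall h, exists l, Cmod h <= rho -> Cseries (fun k => a (S k) * h ^ k)%C l).
{ intros h. destruct (Rle_dec (Cmod h) rho) as [Hh|Hh].
  - destruct (dominated_series (fun k => a (S k) * h ^ k)%C (fun k => Cmod (a (S k)) * rho ^ k) (M / rho)) as [l [Hl _]]; [|exact Hb|].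
    + intros k. rewrite Cmod_mult, Cmod_pow.
      apply Rmult_le_compat_l; [apply Cmod_ge_0|].
      apply pow_incr. split; [apply Cmod_ge_0 | exact Hh].
    + now exists l.
  - exists 0%C. intros; contradiction. }
exists (fun h => proj1_sig (constructive_indefinite_description _ (Hg h))).
split; [split; [exact Hb|]|]; intros h Hh;
  destruct (constructive_indefinite_description _ (Hg h)) as [l Hl]; simpl; auto.
apply Cseries_unique with (1 := Hf h Hh).
replace (a 0%nat) with (a 0%nat * h ^ 0)%C by (simpl; ring).
apply (Cseries_decr (fun k => a k * h ^ k)%C).
apply Cseries_ext with (2 := Cseries_scal h _ _ (Hl Hh)).
intros k; simpl; ring.
Qed.

(** * Analytic functions and the identity theorem *)

Lemma C_pow_n (z : C) k : @pow_n C_Ring z k = (z ^ k)%C.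
Proof.
induction k as [|k IH]; [reflexivity|].
rewrite Cpow_S, <- IH. reflexivity.
Qed.

Lemma is_pseries_Cseries (a : nat -> C) (h l : C) :
  @is_pseries C_AbsRing C_NormedModule a h l <-> Cseries (fun k => a k * h ^ k)%C l.
Proof.
assert (E : forall k, @scal C_Ring C_ModuleSpace (@pow_n C_Ring h k) (a k) = (a k * h ^ k)%C).
{ intros k. rewrite C_pow_n. apply Cmult_comm. }
split; intros H; revert H; apply is_series_ext; intros k; [|symmetry]; apply E.
Qed.

Lemma wiener_analytic (f : C -> C) s0 rho M :
  0 < rho -> wiener rho M (fun h => f (s0 + h)%C) -> analytic_at f s0.
Proof.
intros Hr [a [_ Hf]]. exists a. apply locally_Cmod. exists rho. split; [exact Hr|].
intros s Hs. apply is_pseries_Cseries.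
replace (f s) with (f (s0 + (s - s0))%C) by (f_equal; ring).
apply Hf. lra.
Qed.

Lemma bounded_sums_geom A q :
  0 <= A -> 0 <= q < 1 -> bounded_sums (fun k => A * q ^ k) (A * / (1 - q)).
Proof.
intros HA Hq. apply bounded_sums_scal; [exact HA|].
apply is_series_bounded_sums.
- intros n; now apply pow_le.
- apply is_series_geom. rewrite Rabs_pos_eq; lra.
Qed.

(** Convergence at the single point r / 2 makes the weighted coefficients bounded there, so
    that they are dominated by a geometric series on the disc of radius r / 4. *)
Lemma analytic_wiener (f : C -> C) s0 :
  analytic_at f s0 -> exists rho M, 0 < rho /\ wiener rho M (fun h => f (s0 + h)%C).
Proof.
intros [a Ha]. apply locally_Cmod in Ha. destruct Ha as [r [Hr Ha]].
assert (Hser : forall h, Cmod h < r -> Cseries (fun k => a k * h ^ k)%C (f (s0 + h)%C)).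
{ intros h Hh. apply is_pseries_Cseries.
  replace h with (s0 + h - s0)%C at 1 by ring. apply Ha.
  now replace (s0 + h - s0)%C with h by ring. }
assert (HA : exists A, forall k, Cmod (a k) * (r / 2) ^ k <= A).
{ assert (H2 : Cmod (RtoC (r / 2)) = r / 2).
  { rewrite Cmod_R. apply Rabs_pos_eq; lra. }
  assert (H := Hser (RtoC (r / 2))). rewrite H2 in H. specialize (H ltac:(lra)).
  apply Cseries_Ccv in H.
  assert (H0 := Ccv_minus _ _ _ _ (proj1 (Ccv_incr _ _) H) H).
  assert (H1 : Ccv (fun k => a (S k) * RtoC (r / 2) ^ (S k))%C 0%C).
  { match type of H0 with Ccv _ ?l => replace l with (RtoC 0) in H0 by ring end.
    apply Ccv_ext with (2 := H0). intros n. rewrite Csum_S. ring. }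
  destruct (filterlim_bounded (V := R_NormedModule)
    (fun k => Cmod (a (S k) * RtoC (r / 2) ^ (S k)))) as [A HA].
  { exists (Cmod 0). apply (Ccv_Cmod _ _ H1). }
  exists (Rmax (Cmod (a 0%nat)) A). intros [|k].
  - simpl. rewrite Rmult_1_r. apply Rmax_l.
  - eapply Rle_trans; [|apply Rmax_r]. eapply Rle_trans; [|apply (HA k)].
    change norm with Rabs. rewrite Rabs_pos_eq by apply Cmod_ge_0.
    rewrite Cmod_mult, Cmod_pow, H2. lra. }
destruct HA as [A HA].
assert (HA0 : 0 <= A).
{ eapply Rle_trans; [|apply (HA 0%nat)]. simpl. generalize (Cmod_ge_0 (a 0%nat)); lra. }
exists (r / 4), (A * / (1 - / 2)). split; [lra|]. exists a. split.
- apply bounded_sums_le with (fun k => A * (/ 2) ^ k).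
  + intros k. replace (r / 4) with (r / 2 * / 2) by field.
    rewrite Rpow_mult_distr, <- Rmult_assoc.
    apply Rmult_le_compat_r; [apply pow_le; lra | apply HA].
  + apply bounded_sums_geom; lra.
- intros h Hh. apply Hser. lra.
Qed.

Lemma Cmod_le_linear_0 (z : C) K d :
  0 < d -> (forall t, 0 < t < d -> Cmod z <= K * t) -> z = 0%C.
Proof.
intros Hd H. apply Cmod_eq_0. apply Rle_antisym; [|apply Cmod_ge_0].
apply le_epsilon. intros e He. rewrite Rplus_0_l.
(* K may be 0 or negative, so that e / K is not a usable step. *)
set (K' := Rmax K 1).
assert (HK : 0 < K') by (unfold K'; generalize (Rmax_r K 1); lra).
assert (He' : 0 < e / K') by (apply Rdiv_lt_0_compat; lra).
assert (Ht : 0 < Rmin (d / 2) (e / K')) by (apply Rmin_pos; lra).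
eapply Rle_trans; [apply (H (Rmin (d / 2) (e / K')))|].
- split; [exact Ht|]. generalize (Rmin_l (d / 2) (e / K')); lra.
- apply Rle_trans with (K' * (e / K')).
  + apply Rle_trans with (K' * Rmin (d / 2) (e / K')).
    * apply Rmult_le_compat_r; [lra | apply Rmax_l].
    * apply Rmult_le_compat_l; [lra | apply Rmin_r].
  + apply Req_le. field. lra.
Qed.

(** Zeros of f that accumulate at 0 force f (0) = 0 by continuity.  The radius d' is returned
    because the quotient of f by h is considered on the same points of the ray. *)
Lemma wiener_coef_zero_head (v : C) rho M a f d :
  v <> 0%C -> 0 < rho -> 0 < d -> wiener_coef rho M a f ->
  (forall t, 0 < t < d -> f (RtoC t * v)%C = 0%C) ->
  a 0%nat = 0%C /\
  exists d', 0 < d' /\ forall t, 0 < t < d' -> Cmod (RtoC t * v) <= rho /\ 0 < t < d.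
Proof.
intros Hv Hr Hd HW Hf. assert (Hv' := proj1 (Cmod_gt_0 v) Hv).
destruct (wiener_coef_shift rho M a f Hr HW) as [g [Hg Hfg]].
set (d' := Rmin d (rho / Cmod v)).
assert (Hd' : 0 < d') by (apply Rmin_pos; [lra | now apply Rdiv_lt_0_compat]).
assert (Hsmall : forall t, 0 < t < d' -> Cmod (RtoC t * v) <= rho /\ 0 < t < d).
{ intros t Ht. split.
  - rewrite Cmod_mult, Cmod_R, Rabs_pos_eq by lra.
    apply Rle_trans with (rho / Cmod v * Cmod v).
    + apply Rmult_le_compat_r; [lra|].
      generalize (Rmin_r d (rho / Cmod v)); unfold d' in Ht; lra.
    + apply Req_le; field; lra.
  - generalize (Rmin_l d (rho / Cmod v)); unfold d' in Ht; lra. }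
split; [|now exists d'].
apply Cmod_le_linear_0 with (M / rho * Cmod v) d'; [exact Hd'|].
intros t Ht. destruct (Hsmall t Ht) as [H1 H2].
assert (H3 := Hfg _ H1). rewrite Hf in H3 by exact H2.
replace (a 0%nat) with (- (RtoC t * v * g (RtoC t * v)%C))%C.
2:{ rewrite <- (Cplus_0_l (- _)), H3. ring. }
rewrite Cmod_opp, 2!Cmod_mult, Cmod_R, Rabs_pos_eq by lra.
replace (M / rho * Cmod v * t) with (t * Cmod v * (M / rho)) by ring.
apply Rmult_le_compat_l; [apply Rmult_le_pos; lra|].
apply wiener_bound with rho; [now exists (fun k => a (S k)) | exact H1].
Qed.

(** Once the constant coefficient is known to vanish, f (h) / h vanishes at the same points,
    and its coefficients are those of f shifted by one. *)
Lemma wiener_coef_zero (v : C) k : v <> 0%C -> forall rho M a f d,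
  0 < rho -> 0 < d -> wiener_coef rho M a f ->
  (forall t, 0 < t < d -> f (RtoC t * v)%C = 0%C) -> a k = 0%C.
Proof.
intros Hv. assert (Hv' := proj1 (Cmod_gt_0 v) Hv).
induction k as [|k IH]; intros rho M a f d Hr Hd HW Hf;
  destruct (wiener_coef_shift rho M a f Hr HW) as [g [Hg Hfg]];
  destruct (wiener_coef_zero_head v rho M a f d Hv Hr Hd HW Hf) as [H0 [d' [Hd' Hsmall]]];
  [exact H0|].
apply (IH rho (M / rho) (fun k => a (S k)) g d' Hr Hd' Hg).
intros t Ht. destruct (Hsmall t Ht) as [H1 H2].
assert (H3 := Hfg _ H1). rewrite Hf, H0, Cplus_0_l in H3 by exact H2.
apply NNPP. intros Hn. symmetry in H3. revert H3.
apply Cmult_neq_0; [|exact Hn].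
apply Cmod_gt_0. rewrite Cmod_mult, Cmod_R, Rabs_pos_eq by lra.
apply Rmult_lt_0_compat; lra.
Qed.

Lemma wiener_zero rho M f (v : C) d :
  0 < rho -> 0 < d -> v <> 0%C -> wiener rho M f ->
  (forall t, 0 < t < d -> f (RtoC t * v)%C = 0%C) ->
  forall h, Cmod h <= rho -> f h = 0%C.
Proof.
intros Hr Hd Hv [a Ha] Hf h Hh.
apply Cseries_unique with (1 := proj2 Ha h Hh).
apply Cseries_zero. intros k.
rewrite (wiener_coef_zero v k Hv rho M a f d); auto. ring.
Qed.

(** If D (p) were not 0, let b be the supremum of the parameters where D does not vanish.
    As D vanishes just beyond b, it vanishes in a disc around the point of parameter b, and b
    could be decreased. *)
Lemma segment_identity (D : C -> C) (p v : C) (t0 : R) :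
  v <> 0%C -> t0 < 1 ->
  (forall t, 0 <= t <= 1 -> exists rho M, 0 < rho /\
     wiener rho M (fun h => D (p + RtoC t * v + h)%C)) ->
  (forall t, t0 < t <= 1 -> D (p + RtoC t * v)%C = 0%C) ->
  D p = 0%C.
Proof.
intros Hv Ht0 HW H0. apply NNPP. intros Hp.
set (E := fun t => 0 <= t <= 1 /\ D (p + RtoC t * v)%C <> 0%C).
destruct (completeness E) as [b [Hub Hlub]].
{ exists 1. intros t [Ht _]. lra. }
{ exists 0. split; [lra|]. now replace (p + RtoC 0 * v)%C with p by ring. }
assert (Hb0 : 0 <= b).
{ apply Hub. split; [lra|]. now replace (p + RtoC 0 * v)%C with p by ring. }
assert (Hbt : b <= Rmax t0 0).
{ apply Hlub. intros t [Ht Hn].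
  destruct (Rle_dec t t0) as [H|H].
  - eapply Rle_trans; [exact H | apply Rmax_l].
  - exfalso. apply Hn. apply H0. lra. }
assert (Hb1 : b < 1).
{ apply Rle_lt_trans with (1 := Hbt). apply Rmax_lub_lt; lra. }
assert (Hz : forall t, b < t <= 1 -> D (p + RtoC t * v)%C = 0%C).
{ intros t Ht. apply NNPP. intros Hn.
  assert (t <= b) by (apply Hub; split; [lra | exact Hn]). lra. }
destruct (HW b) as [rho [M [Hr Hw]]]; [lra|].
assert (Hloc : forall h, Cmod h <= rho -> D (p + RtoC b * v + h)%C = 0%C).
{ apply wiener_zero with (v := v) (d := 1 - b) (3 := Hv) (4 := Hw); auto; [lra|].
  intros t Ht.
  replace (p + RtoC b * v + RtoC t * v)%C with (p + RtoC (b + t) * v)%C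
    by (rewrite RtoC_plus; ring).
  apply Hz. lra. }
assert (Hv' := proj1 (Cmod_gt_0 v) Hv).
assert (He : 0 < rho / Cmod v) by now apply Rdiv_lt_0_compat.
(* Every parameter within rho / |v| below b is a zero, so b is not the least upper bound. *)
assert (b <= b - rho / Cmod v); [|lra].
apply Hlub. intros t [Ht Hn].
apply Rnot_lt_le. intros Hlt. apply Hn.
assert (Htb : t <= b) by (apply Hub; now split).
replace (p + RtoC t * v)%C with (p + RtoC b * v + RtoC (t - b) * v)%C
  by (rewrite RtoC_minus; ring).
apply Hloc. rewrite Cmod_mult, Cmod_R, Rabs_left1 by lra.
apply Rle_trans with (rho / Cmod v * Cmod v).
- apply Rmult_le_compat_r; lra.
- apply Req_le. field. lra.
Qed.

(** * First-order expansions *)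

(** A quantitative form of complex differentiability, which holds for analytic functions and
    for which products and changes of variable are plain estimates. *)
Definition first_order (f : C -> C) (z l : C) : Prop :=
  exists M r, 0 < r /\ 0 <= M /\
    forall h, Cmod h < r -> Cmod (f (z + h) - f z - l * h)%C <= M * Cmod h ^ 2.

Lemma wiener_first_order f (z : C) rho M :
  0 < rho -> wiener rho M (fun h => f (z + h)%C) -> exists l, first_order f z l.
Proof.
intros Hr [a Ha].
destruct (wiener_coef_shift rho M a _ Hr Ha) as [g [Hg Hfg]].
destruct (wiener_coef_shift rho _ _ g Hr Hg) as [g2 [Hg2 Hgg]].
exists (a 1%nat), (M / rho / rho), rho. split; [exact Hr|].
assert (HM : 0 <= M / rho / rho).
{ apply wiener_pos with rho g2; [lra | now exists (fun k => a (S (S k)))]. }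
split; [exact HM|].
intros h Hh.
assert (H0 := Hfg 0%C). rewrite Cmod_0 in H0. specialize (H0 ltac:(lra)).
rewrite Cplus_0_r in H0. rewrite H0, Hfg, Hgg by lra.
replace (a 0%nat + h * (a 1%nat + h * g2 h) - (a 0%nat + 0 * g 0%C) - a 1%nat * h)%C
  with (g2 h * h ^ 2)%C by ring.
rewrite Cmod_mult, Cmod_pow. apply Rmult_le_compat_r; [apply pow_le, Cmod_ge_0|].
apply wiener_bound with rho; [now exists (fun k => a (S (S k))) | lra].
Qed.

Lemma first_order_mult f g z l m :
  first_order f z l -> first_order g z m ->
  first_order (fun w => f w * g w)%C z (l * g z + f z * m)%C.
Proof.
intros [M [r [Hr [HM H]]]] [M' [r' [Hr' [HM' H']]]].
set (r0 := Rmin 1 (Rmin r r')).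
exists (M * (Cmod (g z) + Cmod m + M') + Cmod (f z) * M' + Cmod l * (Cmod m + M')), r0.
assert (Hr0 : r0 <= 1 /\ r0 <= r /\ r0 <= r').
{ unfold r0. generalize (Rmin_l 1 (Rmin r r')) (Rmin_r 1 (Rmin r r'))
   (Rmin_l r r') (Rmin_r r r'); lra. }
assert (Hl := Cmod_ge_0 l). assert (Hm := Cmod_ge_0 m).
assert (Hfz := Cmod_ge_0 (f z)). assert (Hgz := Cmod_ge_0 (g z)).
split; [|split].
- unfold r0. repeat apply Rmin_pos; lra.
- assert (0 <= M * (Cmod (g z) + Cmod m + M')) by (apply Rmult_le_pos; lra).
  assert (0 <= Cmod (f z) * M') by (apply Rmult_le_pos; lra).
  assert (0 <= Cmod l * (Cmod m + M')) by (apply Rmult_le_pos; lra). lra.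
- intros h Hh. specialize (H h ltac:(lra)). specialize (H' h ltac:(lra)).
  set (ef := (f (z + h) - f z - l * h)%C) in *.
  set (eg := (g (z + h) - g z - m * h)%C) in *.
  replace (f (z + h) * g (z + h) - f z * g z - (l * g z + f z * m) * h)%C
    with (ef * (g z + (m * h + eg)) + f z * eg + l * h * (m * h + eg))%C
    by (unfold ef, eg; ring).
  assert (Hc := Cmod_ge_0 h). set (c := Cmod h) in *.
  assert (Hc2 : c ^ 2 <= c) by nra.
  assert (Hmc : Cmod m * c <= Cmod m) by nra.
  assert (HMc : M' * c ^ 2 <= M') by nra.
  assert (HMc1 : M' * c ^ 2 <= M' * c) by nra.
  assert (HB : Cmod (m * h + eg) <= (Cmod m + M') * c).
  { eapply Rle_trans; [apply Cmod_triangle|]. rewrite Cmod_mult. fold c. lra. }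
  assert (HB1 : (Cmod m + M') * c <= Cmod m + M') by nra.
  eapply Rle_trans; [apply Cmod_triangle|].
  eapply Rle_trans; [apply Rplus_le_compat_r, Cmod_triangle|].
  rewrite !Cmod_mult. fold c.
  assert (HA : Cmod ef * Cmod (g z + (m * h + eg))
     <= (M * c ^ 2) * (Cmod (g z) + Cmod m + M')).
  { apply Rmult_le_compat; try apply Cmod_ge_0; [exact H|].
    eapply Rle_trans; [apply Cmod_triangle|]. lra. }
  assert (HC : Cmod (f z) * Cmod eg <= Cmod (f z) * (M' * c ^ 2)).
  { now apply Rmult_le_compat_l. }
  assert (HD : Cmod l * c * Cmod (m * h + eg) <= Cmod l * c * ((Cmod m + M') * c)).
  { apply Rmult_le_compat_l; [now apply Rmult_le_pos | exact HB]. }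
  eapply Rle_trans; [apply Rplus_le_compat; [apply Rplus_le_compat|]; eassumption|].
  apply Req_le. ring.
Qed.

(** C_derive is the limit of the difference quotients along the horizontal direction, taken
    separately on real and imaginary parts; here these quotients differ from l by O(|x|). *)
Lemma first_order_C_derive f z l : first_order f z l -> C_derive f z = l.
Proof.
intros [M [r [Hr [HM H]]]].
assert (Hq : forall x, x <> fst z -> Rabs (x - fst z) < r ->
  Cmod ((f (x, snd z) - f z) / ((x, snd z) - z) - l)%C <= M * Rabs (x - fst z)).
{ intros x Hx Hxr. set (t := x - fst z).
  assert (Ht : t <> 0) by (unfold t; lra).
  assert (Ht' : RtoC t <> 0%C) by (intros E; apply Ht; now apply RtoC_inj).
  assert (Ez : (x, snd z) = (z + RtoC t)%C).
  { destruct z as [u v]. unfold t, Cplus, RtoC; simpl. f_equal; ring. }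
  rewrite Ez. specialize (H (RtoC t)). rewrite Cmod_R in H. specialize (H Hxr).
  replace ((f (z + RtoC t) - f z) / (z + RtoC t - z) - l)%C
    with ((f (z + RtoC t) - f z - l * RtoC t) / RtoC t)%C.
  2:{ replace (z + RtoC t - z)%C with (RtoC t) by ring. now field. }
  rewrite Cmod_div, Cmod_R by exact Ht'.
  assert (Hp : 0 < Rabs t) by now apply Rabs_pos_lt.
  apply Rmult_le_reg_r with (Rabs t); [exact Hp|].
  unfold Rdiv. rewrite Rmult_assoc, Rinv_l, Rmult_1_r by lra.
  eapply Rle_trans; [exact H|]. apply Req_le. ring. }
assert (Hlim : forall (g : C -> R), (forall c, Rabs (g c) <= Cmod c) ->
   (forall a b, g (a - b)%C = g a - g b) ->
   Lim (fun x => g ((f (x, snd z) - f z) / ((x, snd z) - z))%C) (fst z) = g l).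
{ intros g Hg Hgm. apply is_lim_unique. apply is_lim_spec. intros eps.
  set (d := Rmin r (eps / (M + 1))).
  assert (Hd : 0 < d).
  { apply Rmin_pos; [exact Hr|]. apply Rdiv_lt_0_compat; [apply cond_pos | lra]. }
  exists (mkposreal d Hd). intros x Hx Hne.
  change (Rabs (x - fst z) < d) in Hx.
  assert (H1 := Rmin_l r (eps / (M + 1))). assert (H2 := Rmin_r r (eps / (M + 1))).
  fold d in H1, H2.
  rewrite <- Hgm. eapply Rle_lt_trans; [apply Hg|].
  eapply Rle_lt_trans; [apply Hq; [exact Hne | lra]|].
  apply Rle_lt_trans with ((M) * (eps / (M + 1))).
  - apply Rmult_le_compat_l; lra.
  - assert (He := cond_pos eps). apply Rmult_lt_reg_r with (M + 1); [lra|].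
    replace (M * (eps / (M + 1)) * (M + 1)) with (M * eps) by (field; lra). lra. }
unfold C_derive, C_lim.
change fst with Re in *. change snd with Im in *.
destruct l as [l1 l2]. f_equal.
- rewrite (Hlim Re re_le_Cmod); [reflexivity|]. intros [a1 a2] [b1 b2]. simpl. ring.
- rewrite (Hlim Im im_le_Cmod); [reflexivity|]. intros [a1 a2] [b1 b2]. simpl. ring.
Qed.

(** * The exponential series and linear differential equations along a segment *)

Lemma Cexp_plus a b : Cexp (a + b) = (Cexp a * Cexp b)%C.
Proof.
unfold Cexp, Cmult. destruct a as [a1 a2], b as [b1 b2]; simpl.
rewrite exp_plus, cos_plus, sin_plus. f_equal; ring.
Qed.

Lemma Cexp_0 : Cexp 0 = 1%C.
Proof. unfold Cexp; simpl. now rewrite exp_0, cos_0, sin_0, Rmult_1_l, Rmult_0_r. Qed.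

Lemma Cexp_opp_l a : (Cexp (- a) * Cexp a)%C = 1%C.
Proof. rewrite <- Cexp_plus, <- Cexp_0. f_equal. ring. Qed.

Lemma Cexp_neq_0 a : Cexp a <> 0%C.
Proof.
intros H. generalize (Cexp_opp_l a). rewrite H, Cmult_0_r.
intros E. apply C1_nz. now symmetry.
Qed.

Lemma Cexp_minus a b : Cexp (a - b) = (Cexp a / Cexp b)%C.
Proof.
replace (Cexp a) with (Cexp (a - b) * Cexp b)%C.
- field. apply Cexp_neq_0.
- rewrite <- Cexp_plus. f_equal. ring.
Qed.

Lemma Cmod_Cexp a : Cmod (Cexp a) = exp (Re a).
Proof.
destruct a as [x y]. unfold Cmod, Cexp; simpl.
replace (exp x * cos y * (exp x * cos y * 1) + exp x * sin y * (exp x * sin y * 1))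
  with (exp x * exp x * (Rsqr (sin y) + Rsqr (cos y))) by (unfold Rsqr; ring).
rewrite sin2_cos2, Rmult_1_r. apply sqrt_square, Rlt_le, exp_pos.
Qed.

Definition path_deriv (f : R -> C) (t : R) (l : C) : Prop :=
  is_derive (fun u => Re (f u)) t (Re l) /\ is_derive (fun u => Im (f u)) t (Im l).

Lemma is_derive_mult_R (a b : R -> R) t a' b' :
  is_derive a t a' -> is_derive b t b' ->
  is_derive (fun u => a u * b u) t (a' * b t + a t * b').
Proof. intros Ha Hb. apply (is_derive_mult a b t a' b' Ha Hb). apply Rmult_comm. Qed.

Lemma path_deriv_mult f g t l m :
  path_deriv f t l -> path_deriv g t m ->
  path_deriv (fun u => f u * g u)%C t (l * g t + f t * m)%C.
Proof.
intros [H1 H2] [H3 H4]. split.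
- apply is_derive_ext with (fun u => Re (f u) * Re (g u) - Im (f u) * Im (g u)).
  { intros u; now rewrite re_mult. }
  generalize (is_derive_minus _ _ _ _ _ (is_derive_mult_R _ _ _ _ _ H1 H3)
    (is_derive_mult_R _ _ _ _ _ H2 H4)).
  unfold minus, plus, opp; simpl.
  match goal with |- is_derive _ _ ?l -> is_derive _ _ ?l' => replace l' with l; [easy|] end.
  unfold Re, Im; simpl; ring.
- apply is_derive_ext with (fun u => Re (f u) * Im (g u) + Im (f u) * Re (g u)).
  { intros u; now rewrite im_mult. }
  generalize (is_derive_plus _ _ _ _ _ (is_derive_mult_R _ _ _ _ _ H1 H4)
    (is_derive_mult_R _ _ _ _ _ H2 H3)).
  unfold plus; simpl.
  match goal with |- is_derive _ _ ?l -> is_derive _ _ ?l' => replace l' with l; [easy|] end.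
  unfold Re, Im; simpl; ring.
Qed.

Lemma path_deriv_exp f t l :
  path_deriv f t l -> path_deriv (fun u => Cexp (f u)) t (l * Cexp (f t))%C.
Proof.
intros [H1 H2].
assert (E := is_derive_comp exp _ t _ _ (is_derive_exp (Re (f t))) H1).
split.
- assert (K := is_derive_comp cos _ t _ _ (is_derive_cos (Im (f t))) H2).
  generalize (is_derive_mult_R _ _ _ _ _ E K). unfold scal; simpl; unfold mult; simpl.
  match goal with |- is_derive _ _ ?l -> is_derive _ _ ?l' => replace l' with l; [easy|] end.
  unfold Re, Im; simpl; ring.
- assert (K := is_derive_comp sin _ t _ _ (is_derive_sin (Im (f t))) H2).
  generalize (is_derive_mult_R _ _ _ _ _ E K). unfold scal; simpl; unfold mult; simpl.
  match goal with |- is_derive _ _ ?l -> is_derive _ _ ?l' => replace l' with l; [easy|] end.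
  unfold Re, Im; simpl; ring.
Qed.

Lemma path_deriv_scal c f t l :
  path_deriv f t l -> path_deriv (fun u => c * f u)%C t (c * l)%C.
Proof.
intros Hf.
assert (Hc : path_deriv (fun _ => c) t 0%C) by (split; apply @is_derive_const).
generalize (path_deriv_mult _ _ _ _ _ Hc Hf).
now replace (0 * f t + c * l)%C with (c * l)%C by ring.
Qed.

Lemma path_deriv_const f :
  (forall t, 0 <= t <= 1 -> path_deriv f t 0%C) -> f 1 = f 0.
Proof.
intros H.
assert (K : forall g : R -> R, (forall t, 0 <= t <= 1 -> is_derive g t 0) -> g 1 = g 0).
{ intros g Hg. destruct (MVT_gen g 0 1 (fun _ => 0)) as [c [_ Hc]].
  - rewrite Rmin_left, Rmax_right by lra. intros x Hx. apply Hg. lra.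
  - rewrite Rmin_left, Rmax_right by lra. intros x Hx.
    apply continuity_pt_filterlim. apply @ex_derive_continuous.
    exists 0. apply Hg. lra.
  - lra. }
assert (H1 := K (fun u => Re (f u)) (fun t Ht => proj1 (H t Ht))).
assert (H2 := K (fun u => Im (f u)) (fun t Ht => proj2 (H t Ht))).
simpl in H1, H2. destruct (f 1) as [a b], (f 0) as [a' b']. simpl in *. congruence.
Qed.

(** The function f exp (- m) is constant. *)
Lemma path_linear_ode f m dm :
  (forall t, 0 <= t <= 1 -> path_deriv m t (dm t)) ->
  (forall t, 0 <= t <= 1 -> path_deriv f t (dm t * f t)%C) ->
  f 1 = (f 0 * Cexp (m 1 - m 0))%C.
Proof.
intros Hm Hf.
assert (H : (f 1 * Cexp (-1 * m 1))%C = (f 0 * Cexp (-1 * m 0))%C).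
{ apply (path_deriv_const (fun t => f t * Cexp (-1 * m t))%C). intros t Ht.
  generalize (path_deriv_mult _ _ _ _ _ (Hf t Ht)
    (path_deriv_exp _ _ _ (path_deriv_scal (-1) _ _ _ (Hm t Ht)))).
  match goal with |- path_deriv _ _ ?l -> _ => now replace l with (RtoC 0) by ring end. }
replace (m 1 - m 0)%C with (m 1 + -1 * m 0)%C by ring.
rewrite Cexp_plus.
replace (f 0 * (Cexp (m 1) * Cexp (-1 * m 0)))%C
  with (f 0 * Cexp (-1 * m 0) * Cexp (m 1))%C by ring.
rewrite <- H.
replace (-1 * m 1)%C with (- m 1)%C by ring.
rewrite <- Cmult_assoc, Cexp_opp_l. ring.
Qed.

Definition CSeries (a : nat -> C) : C :=
  (Series (fun n => Re (a n)), Series (fun n => Im (a n))).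

Lemma Re_Csum (a : nat -> C) N : Re (Csum a N) = sum_n (fun n => Re (a n)) N.
Proof.
induction N as [|N IH]; [now rewrite Csum_0, sum_O|].
now rewrite Csum_S, sum_Sn, re_plus, IH.
Qed.

Lemma Im_Csum (a : nat -> C) N : Im (Csum a N) = sum_n (fun n => Im (a n)) N.
Proof.
induction N as [|N IH]; [now rewrite Csum_0, sum_O|].
now rewrite Csum_S, sum_Sn, im_plus, IH.
Qed.

Lemma Cseries_correct (a : nat -> C) l : Cseries a l -> CSeries a = l.
Proof.
rewrite Cseries_Ccv. intros H. unfold CSeries.
destruct l as [x y]. f_equal; apply is_series_unique.
- apply is_lim_seq_ext with (2 := Ccv_Re _ _ H). apply Re_Csum.
- apply is_lim_seq_ext with (2 := Ccv_Im _ _ H). apply Im_Csum.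
Qed.

Lemma Cseries_ex (a : nat -> C) l : Cseries a l -> Cseries a (CSeries a).
Proof. intros H. now rewrite (Cseries_correct a l H). Qed.

(** Real and imaginary parts are real power series in the real parameter, which can be
    differentiated term by term.  Boundedness of the coefficients at a radius r > 1 covers the
    endpoint t = 1. *)
Lemma power_path_deriv (c : nat -> C) A r :
  1 < r -> (forall j, Cmod (c j) * r ^ j <= A) ->
  forall t, 0 <= t <= 1 ->
  exists D, Cseries (fun j => c j * RtoC t ^ j)%C (CSeries (fun j => c j * RtoC t ^ j)%C) /\
    Cseries (fun j => RtoC (INR (S j)) * c (S j) * RtoC t ^ j)%C D /\
    path_deriv (fun u => CSeries (fun j => c j * RtoC u ^ j)%C) t D.
Proof.
intros Hr HA t Ht.
assert (HA0 : 0 <= A).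
{ eapply Rle_trans; [|apply (HA 0%nat)]. simpl. generalize (Cmod_ge_0 (c 0%nat)); lra. }
set (p := fun j => Re (c j)). set (q := fun j => Im (c j)).
assert (Hrad : forall g : C -> R, (forall z, Rabs (g z) <= Cmod z) ->
   Rbar_lt (Rabs t) (CV_radius (fun j => g (c j)))).
{ intros g Hg. apply Rbar_lt_le_trans with r.
  - simpl. rewrite Rabs_pos_eq; lra.
  - apply (CV_radius_bounded (fun j => g (c j))). exists A. intros j.
    rewrite Rabs_mult, (Rabs_pos_eq (r ^ j)) by (apply pow_le; lra).
    eapply Rle_trans; [|apply (HA j)]. apply Rmult_le_compat_r; [apply pow_le; lra | apply Hg]. }
assert (Hp := Hrad Re re_le_Cmod). assert (Hq := Hrad Im im_le_Cmod).
fold p in Hp. fold q in Hq.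
assert (Erow : forall u (z : C) j, Re (z * RtoC u ^ j)%C = Re z * u ^ j /\
    Im (z * RtoC u ^ j)%C = Im z * u ^ j).
{ intros u z j. now rewrite <- RtoC_pow, re_scal_r, im_scal_r. }
assert (EF : forall u, CSeries (fun j => c j * RtoC u ^ j)%C = (PSeries p u, PSeries q u)).
{ intros u. unfold CSeries, PSeries. f_equal; apply Series_ext; intros j; apply Erow. }
assert (Hconv : exists l, Cseries (fun j => c j * RtoC t ^ j)%C l).
{ destruct (dominated_series (fun j => c j * RtoC t ^ j)%C (fun j => A * (/ r) ^ j)
     (A * / (1 - / r))) as [l [Hl _]].
  - intros j. rewrite Cmod_mult, Cmod_pow, Cmod_R, Rabs_pos_eq by lra.
    apply Rmult_le_reg_r with (r ^ j); [apply pow_lt; lra|].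
    rewrite Rmult_assoc, <- Rpow_mult_distr, Rmult_assoc, <- Rpow_mult_distr.
    rewrite Rinv_l, pow1, Rmult_1_r by lra.
    eapply Rle_trans; [|apply (HA j)]. apply Rmult_le_compat_l; [apply Cmod_ge_0|].
    apply pow_incr. split; [apply Rmult_le_pos; lra|].
    rewrite <- (Rmult_1_l r) at 2. apply Rmult_le_compat_r; lra.
  - apply bounded_sums_geom; [exact HA0|]. split.
    + apply Rlt_le, Rinv_0_lt_compat; lra.
    + rewrite <- Rinv_1. apply Rinv_lt_contravar; lra.
  - now exists l. }
exists (PSeries (PS_derive p) t, PSeries (PS_derive q) t). split; [|split].
- destruct Hconv as [l Hl]. now apply Cseries_ex with l.
- apply Cseries_Ccv. apply Ccv_pair.
  + apply is_lim_seq_ext with (sum_n (fun j => PS_derive p j * t ^ j)).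
    * intros n. rewrite Re_Csum. apply sum_n_ext. intros j.
      rewrite (proj1 (Erow _ _ _)), re_scal_l. reflexivity.
    * apply (is_pseries_R (PS_derive p) t). apply PSeries_correct.
      now apply ex_pseries_derive.
  + apply is_lim_seq_ext with (sum_n (fun j => PS_derive q j * t ^ j)).
    * intros n. rewrite Im_Csum. apply sum_n_ext. intros j.
      rewrite (proj2 (Erow _ _ _)), im_scal_l. reflexivity.
    * apply (is_pseries_R (PS_derive q) t). apply PSeries_correct.
      now apply ex_pseries_derive.
- split.
  + apply is_derive_ext with (PSeries p); [intros u; now rewrite EF|].
    now apply is_derive_PSeries.
  + apply is_derive_ext with (PSeries q); [intros u; now rewrite EF|].
    now apply is_derive_PSeries.
Qed.

Lemma ratio_bounded (u : nat -> R) N :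
  (forall j, 0 <= u j) -> (forall j, (N <= j)%nat -> u (S j) <= u j) ->
  exists A, forall j, u j <= A.
Proof.
intros Hu HN.
exists (sum_n u N). intros j.
destruct (Nat.le_gt_cases j N) as [Hj|Hj].
- clear HN. induction Hj as [|N Hj IH].
  + destruct j as [|j]; [rewrite sum_O; apply Rle_refl|].
    rewrite sum_Sn. unfold plus; simpl. generalize (proj2 (sum_n_nonneg u Hu j)); lra.
  + rewrite sum_Sn. unfold plus; simpl. generalize (Hu (S N)); lra.
- apply Rle_trans with (u N).
  + assert (Hj' : (N <= j)%nat) by lia. clear Hj. induction Hj' as [|j Hj IH]; [lra|].
    eapply Rle_trans; [now apply HN | exact IH].
  + destruct N as [|N]; [rewrite sum_O; apply Rle_refl|].
    rewrite sum_Sn. unfold plus; simpl. generalize (proj2 (sum_n_nonneg u Hu N)); lra.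
Qed.

Lemma INR_S_neq j : RtoC (INR (S j)) <> 0%C.
Proof. intros H. apply RtoC_inj in H. now apply (not_0_INR (S j)). Qed.

Definition exp_coef (z : C) (j : nat) : C := (z ^ j / RtoC (INR (fact j)))%C.

Lemma INR_fact_neq j : RtoC (INR (fact j)) <> 0%C.
Proof. intros H. apply RtoC_inj in H. now apply (INR_fact_neq_0 j). Qed.

Lemma exp_coef_S z j :
  (RtoC (INR (S j)) * exp_coef z (S j))%C = (z * exp_coef z j)%C.
Proof.
unfold exp_coef. rewrite fact_simpl, mult_INR, RtoC_mult, Cpow_S.
field. split; [apply INR_fact_neq | apply INR_S_neq].
Qed.

Lemma Cmod_exp_coef z j : Cmod (exp_coef z j) = Cmod z ^ j / INR (fact j).
Proof.
unfold exp_coef. rewrite Cmod_div, Cmod_pow, Cmod_R by apply INR_fact_neq.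
rewrite Rabs_pos_eq; [reflexivity | apply pos_INR].
Qed.

(** As a function of t, the sum of z^j t^j / j! solves f' = z f. *)
Lemma Cexp_series z : Cseries (fun j => z ^ j / RtoC (INR (fact j)))%C (Cexp z).
Proof.
assert (Hz := Cmod_ge_0 z).
destruct (ratio_bounded (fun j => Cmod (exp_coef z j) * 2 ^ j)
   (Z.to_nat (up (2 * Cmod z)))) as [A HA].
{ intros j. apply Rmult_le_pos; [apply Cmod_ge_0 | apply pow_le; lra]. }
{ intros j Hj.
  assert (Hj' : 2 * Cmod z <= INR j).
  { apply le_INR in Hj. rewrite INR_IZR_INZ, Z2Nat.id in Hj.
    - generalize (archimed (2 * Cmod z)); lra.
    - apply le_IZR. generalize (archimed (2 * Cmod z)); lra. }
  rewrite !Cmod_exp_coef, fact_simpl, mult_INR, S_INR. simpl.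
  assert (0 < INR (fact j)) by apply INR_fact_lt_0.
  assert (0 <= INR j) by apply pos_INR.
  assert (0 <= Cmod z ^ j) by now apply pow_le.
  assert (0 <= 2 ^ j) by (apply pow_le; lra).
  replace (Cmod z * Cmod z ^ j / ((INR j + 1) * INR (fact j)) * (2 * 2 ^ j))
    with (Cmod z ^ j / INR (fact j) * 2 ^ j * (2 * Cmod z / (INR j + 1))) by (field; lra).
  rewrite <- (Rmult_1_r (Cmod z ^ j / INR (fact j) * 2 ^ j)) at 2.
  apply Rmult_le_compat_l.
  - apply Rmult_le_pos; [|lra]. apply Rmult_le_pos; [lra|].
    now apply Rlt_le, Rinv_0_lt_compat.
  - apply Rmult_le_reg_r with (INR j + 1); [lra|].
    replace (2 * Cmod z / (INR j + 1) * (INR j + 1)) with (2 * Cmod z) by (field; lra). lra. }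
set (F := fun u : R => CSeries (fun j => exp_coef z j * RtoC u ^ j)%C).
assert (HF := power_path_deriv (exp_coef z) A 2 ltac:(lra) HA).
assert (H1 : F 1 = (F 0 * Cexp (RtoC 1 * z - RtoC 0 * z))%C).
{ apply (path_linear_ode F (fun t => RtoC t * z)%C (fun _ => z)).
  - intros t _. split; simpl.
    + auto_derive; [exact I | unfold Re; ring].
    + auto_derive; [exact I | unfold Im; ring].
  - intros t Ht. destruct (HF t Ht) as [D [Hs [HD Hd]]].
    replace (z * F t)%C with D; [exact Hd|].
    apply Cseries_unique with (1 := HD).
    apply Cseries_ext with (2 := Cseries_scal z _ _ Hs).
    intros j. rewrite exp_coef_S. ring. }
destruct (HF 1 ltac:(lra)) as [_ [Hs _]].
assert (E0 : F 0 = 1%C).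
{ apply Cseries_correct.
  replace (RtoC 1) with (exp_coef z 0 * RtoC 0 ^ 0 + 0)%C.
  - apply (Cseries_decr (fun j => exp_coef z j * RtoC 0 ^ j)%C).
    apply Cseries_zero. intros n. simpl. ring.
  - unfold exp_coef. simpl. field. }
fold (F 1) in Hs. rewrite H1, E0 in Hs.
replace (1 * Cexp (RtoC 1 * z - RtoC 0 * z))%C with (Cexp z) in Hs.
- apply Cseries_ext with (2 := Hs). intros j. rewrite Cpow_1_l. unfold exp_coef. ring.
- rewrite Cmult_1_l. f_equal. ring.
Qed.

Lemma wiener_coef_exp rho c :
  0 <= rho -> wiener_coef rho (exp (Cmod c * rho)) (exp_coef c) (fun h => Cexp (c * h)).
Proof.
intros Hr. split.
- apply bounded_sums_le with (fun k => (Cmod c * rho) ^ k * / INR (fact k)).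
  + intros k. rewrite Cmod_exp_coef, Rpow_mult_distr. apply Req_le. unfold Rdiv. ring.
  + assert (Hc : 0 <= Cmod c * rho) by (apply Rmult_le_pos; [apply Cmod_ge_0 | exact Hr]).
    apply is_series_bounded_sums.
    * intros n. apply Rmult_le_pos; [now apply pow_le|].
      apply Rlt_le, Rinv_0_lt_compat, INR_fact_lt_0.
    * apply is_series_ext with (fun n => / INR (fact n) * (Cmod c * rho) ^ n).
      { intros n; apply Rmult_comm. }
      apply (is_pseries_R (fun n => / INR (fact n))). apply is_exp_Reals.
- intros h _. apply Cseries_ext with (2 := Cexp_series (c * h)%C).
  intros j. unfold exp_coef. rewrite Cpow_mult_l. field. apply INR_fact_neq.
Qed.

Lemma wiener_exp rho c :
  0 <= rho -> wiener rho (exp (Cmod c * rho)) (fun h => Cexp (c * h)).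
Proof. intros Hr. exists (exp_coef c). now apply wiener_coef_exp. Qed.

(** * The binomial series *)

(** The generalized binomial coefficient, for an arbitrary complex upper index. *)
Fixpoint cbin (a : C) (j : nat) : C :=
  match j with
  | O => 1
  | S p => (cbin a p * (a - RtoC (INR p)) / RtoC (INR (S p)))%C
  end.

(** The coefficient of x^j in (1 - x)^(-A), which bounds that of (1 + x)^a when |a| <= A. *)
Fixpoint rbin (A : R) (j : nat) : R :=
  match j with
  | O => 1
  | S p => rbin A p * (A + INR p) / INR (S p)
  end.

Lemma cbin_S a j :
  (RtoC (INR (S j)) * cbin a (S j))%C = ((a - RtoC (INR j)) * cbin a j)%C.
Proof. cbn [cbin]. field. apply INR_S_neq. Qed.

Lemma INR_S_pos j : 0 < INR (S j).
Proof. apply lt_0_INR. lia. Qed.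

Lemma rbin_pos A j : 0 <= A -> 0 <= rbin A j.
Proof.
intros HA. induction j as [|j IH]; cbn [rbin]; [lra|].
apply Rmult_le_pos; [|apply Rlt_le, Rinv_0_lt_compat, INR_S_pos].
apply Rmult_le_pos; [exact IH | generalize (pos_INR j); lra].
Qed.

(** The quotient of consecutive terms tends to r < 1. *)
Lemma rbin_bounded A r : 0 <= A -> 0 <= r < 1 -> exists K, forall j, rbin A j * r ^ j <= K.
Proof.
intros HA Hr.
apply (ratio_bounded (fun j => rbin A j * r ^ j) (Z.to_nat (up (A / (1 - r))))).
- intros j. apply Rmult_le_pos; [now apply rbin_pos | apply pow_le; lra].
- intros j Hj.
  assert (H0 : 0 <= A / (1 - r)).
  { apply Rmult_le_pos; [lra|]. apply Rlt_le, Rinv_0_lt_compat; lra. }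
  assert (Hj' : A / (1 - r) <= INR j).
  { apply le_INR in Hj. rewrite INR_IZR_INZ, Z2Nat.id in Hj.
    - generalize (archimed (A / (1 - r))); lra.
    - apply le_IZR. generalize (archimed (A / (1 - r))); lra. }
  assert (Hj2 : A <= INR j * (1 - r)).
  { apply Rmult_le_compat_r with (r := 1 - r) in Hj'; [|lra].
    unfold Rdiv in Hj'. rewrite Rmult_assoc, Rinv_l in Hj' by lra. lra. }
  cbn [rbin pow].
  assert (Hp := INR_S_pos j).
  replace (rbin A j * (A + INR j) / INR (S j) * (r * r ^ j))
    with (rbin A j * r ^ j * ((A + INR j) * r / INR (S j))) by (field; lra).
  rewrite <- (Rmult_1_r (rbin A j * r ^ j)) at 2.
  apply Rmult_le_compat_l.
  + apply Rmult_le_pos; [now apply rbin_pos | apply pow_le; lra].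
  + apply Rmult_le_reg_r with (INR (S j)); [lra|].
    unfold Rdiv. rewrite Rmult_assoc, Rinv_l by lra. rewrite S_INR in *. nra.
Qed.

Lemma rbin_half_bounded A : 0 <= A ->
  exists K, bounded_sums (fun j => rbin A j * (/ 2) ^ j) K.
Proof.
(* Any ratio strictly between 1 / 2 and 1 leaves a convergent geometric factor. *)
intros HA. destruct (rbin_bounded A (3 / 4) HA) as [K HK]; [lra|].
assert (HK0 : 0 <= K).
{ eapply Rle_trans; [|apply (HK 0%nat)]. simpl. lra. }
exists (K * / (1 - 2 / 3)). apply bounded_sums_le with (fun j => K * (2 / 3) ^ j).
- intros j. replace (/ 2) with (3 / 4 * (2 / 3)) by field.
  rewrite Rpow_mult_distr, <- Rmult_assoc.
  apply Rmult_le_compat_r; [apply pow_le; lra | apply HK].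
- apply bounded_sums_geom; lra.
Qed.

(** The factor a + h - p has norm at most |a| + rho + p. *)
Lemma wiener_cbin rho a j :
  0 < rho -> wiener rho (rbin (Cmod a + rho) j) (fun h => cbin (a + h) j).
Proof.
intros Hr. induction j as [|j IH].
- replace (rbin (Cmod a + rho) 0) with (Cmod 1) by apply Cmod_1. apply wiener_const.
- cbn [rbin].
  apply wiener_ext with
    (fun h => / RtoC (INR (S j)) * (cbin (a + h) j * ((a - RtoC (INR j)) + 1 * h)))%C.
  { intros h _. cbn [cbin]. field. apply INR_S_neq. }
  apply wiener_le with (Cmod (/ RtoC (INR (S j))) *
     (rbin (Cmod a + rho) j * (Cmod (a - RtoC (INR j)) + Cmod 1 * rho))).
  + assert (Hp := INR_S_pos j).
    rewrite Cmod_inv, Cmod_R, Rabs_pos_eq by (apply INR_S_neq || lra).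
    unfold Rdiv. rewrite Rmult_comm. apply Rmult_le_compat_r.
    { now apply Rlt_le, Rinv_0_lt_compat. }
    apply Rmult_le_compat_l.
    { apply rbin_pos. generalize (Cmod_ge_0 a); lra. }
    rewrite Cmod_1. unfold Cminus.
    generalize (Cmod_triangle a (- RtoC (INR j))).
    rewrite Cmod_opp, Cmod_R, Rabs_pos_eq by apply pos_INR. lra.
  + apply wiener_scal. apply wiener_mult; [exact Hr | exact IH|].
    apply wiener_affine. lra.
Qed.

Lemma Cmod_cbin a j : Cmod (cbin a j) <= rbin (Cmod a) j.
Proof.
induction j as [|j IH]; cbn [cbin rbin]; [rewrite Cmod_1; lra|].
assert (Hp := INR_S_pos j).
rewrite Cmod_div, Cmod_mult, Cmod_R, (Rabs_pos_eq (INR (S j))) by (apply INR_S_neq || lra).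
apply Rmult_le_compat_r; [now apply Rlt_le, Rinv_0_lt_compat|].
apply Rmult_le_compat; try apply Cmod_ge_0; [exact IH|].
unfold Cminus. generalize (Cmod_triangle a (- RtoC (INR j))).
rewrite Cmod_opp, Cmod_R, (Rabs_pos_eq (INR j)) by apply pos_INR. lra.
Qed.

Lemma cbin_zero m j : (m < j)%nat -> cbin (RtoC (INR m)) j = 0%C.
Proof.
intros Hj. induction Hj as [|j Hj IH]; cbn [cbin].
- field. apply INR_S_neq.
- rewrite IH. field. apply INR_S_neq.
Qed.

Definition log1p_coef (x : C) (j : nat) : C :=
  match j with
  | O => 0
  | S p => (- (- x) ^ (S p) / RtoC (INR (S p)))%C
  end.

(** The power series of log (1 + x), preferred to the principal logarithm because it can be
    differentiated term by term; Clog_succ compares the two. *)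
Definition log1p (x : C) : C := CSeries (log1p_coef x).

Lemma Cmod_log1p_coef x j : Cmod (log1p_coef x (S j)) = Cmod x ^ (S j) / INR (S j).
Proof.
unfold log1p_coef. rewrite Cmod_div, Cmod_opp, Cmod_pow, Cmod_opp, Cmod_R by apply INR_S_neq.
rewrite Rabs_pos_eq; [reflexivity | apply pos_INR].
Qed.

Lemma log1p_coef_le x j : Cmod (log1p_coef x j) <= Cmod x ^ j.
Proof.
destruct j as [|j].
- unfold log1p_coef. rewrite Cmod_0. simpl. lra.
- rewrite Cmod_log1p_coef.
  assert (H1 : 1 <= INR (S j)) by (rewrite S_INR; generalize (pos_INR j); lra).
  apply Rmult_le_reg_r with (INR (S j)); [lra|].
  unfold Rdiv. rewrite Rmult_assoc, Rinv_l, Rmult_1_r by lra.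
  rewrite <- (Rmult_1_r (Cmod x ^ S j)) at 1.
  apply Rmult_le_compat_l; [apply pow_le, Cmod_ge_0 | exact H1].
Qed.

Lemma log1p_series x : Cmod x < 1 -> Cseries (log1p_coef x) (log1p x).
Proof.
intros Hx.
destruct (dominated_series (log1p_coef x) (fun j => 1 * Cmod x ^ j) (1 * / (1 - Cmod x)))
  as [l [Hl _]].
- intros j. rewrite Rmult_1_l. apply log1p_coef_le.
- apply bounded_sums_geom; [lra|]. split; [apply Cmod_ge_0 | exact Hx].
- now apply Cseries_ex with l.
Qed.

Lemma log1p_approx x : Cmod x <= / 2 -> Cmod (log1p x - x) <= Cmod x ^ 2.
Proof.
intros Hx. assert (H0 := Cmod_ge_0 x).
assert (H1 : Cseries (fun n => log1p_coef x (S (S n))) (log1p x - x)%C).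
{ replace (log1p x - x)%C with (log1p x - log1p_coef x 0 - log1p_coef x 1)%C.
  - exact (Cseries_incr _ _ (Cseries_incr _ _ (log1p_series x ltac:(lra)))).
  - unfold log1p_coef. simpl. field. }
destruct (dominated_series (fun n => log1p_coef x (S (S n)))
   (fun n => (Cmod x ^ 2 / 2) * (/ 2) ^ n) (Cmod x ^ 2 / 2 * / (1 - / 2))) as [l [Hl Hb]].
- intros n. rewrite Cmod_log1p_coef.
  apply Rle_trans with (Cmod x ^ 2 * (/ 2) ^ n / 2); [|apply Req_le; field].
  apply Rmult_le_compat.
  + apply pow_le, H0.
  + apply Rlt_le, Rinv_0_lt_compat, INR_S_pos.
  + replace (S (S n)) with (2 + n)%nat by lia. rewrite pow_add.
    apply Rmult_le_compat_l; [apply pow_le, H0 | now apply pow_incr].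
  + apply Rinv_le_contravar; [lra|]. rewrite !S_INR. generalize (pos_INR n); lra.
- apply bounded_sums_geom; [|lra]. generalize (pow_le _ 2 H0); lra.
- rewrite (Cseries_unique _ _ _ H1 Hl). eapply Rle_trans; [exact Hb|].
  apply Req_le. field.
Qed.

Lemma radius_above_1 x : Cmod x < 1 -> exists r, 1 < r /\ Cmod x * r < 1.
Proof.
intros Hx. assert (H0 := Cmod_ge_0 x). exists (2 / (1 + Cmod x)). split.
- apply Rmult_lt_reg_r with (1 + Cmod x); [lra|].
  unfold Rdiv. rewrite Rmult_assoc, Rinv_l by lra. lra.
- apply Rmult_lt_reg_r with (1 + Cmod x); [lra|].
  unfold Rdiv. rewrite !Rmult_assoc, Rinv_l by lra. lra.
Qed.

Lemma one_plus_neq_0 x t : Cmod x < 1 -> 0 <= t <= 1 -> (1 + x * RtoC t)%C <> 0%C.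
Proof.
intros Hx Ht E.
assert (H : Cmod (x * RtoC t) = 1).
{ replace (x * RtoC t)%C with (- (1))%C.
  - now rewrite Cmod_opp, Cmod_1.
  - rewrite <- (Cplus_0_l (- (1))), <- E. ring. }
rewrite Cmod_mult, Cmod_R, Rabs_pos_eq in H by lra.
generalize (Cmod_ge_0 x). nra.
Qed.

(** The derived series D is geometric: D = x - t x D. *)
Lemma log1p_path x :
  Cmod x < 1 -> forall t, 0 <= t <= 1 ->
  path_deriv (fun u => CSeries (fun j => log1p_coef x j * RtoC u ^ j)%C) t
    (x / (1 + x * RtoC t))%C.
Proof.
intros Hx t Ht. destruct (radius_above_1 x Hx) as [r [Hr Hxr]].
assert (H0 := Cmod_ge_0 x).
destruct (power_path_deriv (log1p_coef x) 1 r Hr) with (t := t) as [D [_ [HD Hd]]]; [|exact Ht|].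
{ intros j. apply Rle_trans with (Cmod x ^ j * r ^ j).
  - apply Rmult_le_compat_r; [apply pow_le; lra | apply log1p_coef_le].
  - rewrite <- Rpow_mult_distr. rewrite <- (pow1 j). apply pow_incr. split; [|lra].
    apply Rmult_le_pos; lra. }
replace (x / (1 + x * RtoC t))%C with D; [exact Hd|].
set (d := fun j => (RtoC (INR (S j)) * log1p_coef x (S j) * RtoC t ^ j)%C) in HD.
assert (Ed : forall j, d (S j) = (- (x * RtoC t) * d j)%C).
{ intros j. unfold d, log1p_coef. rewrite !Cpow_S. field. split; apply INR_S_neq. }
assert (H1 : D = (d 0%nat + - (x * RtoC t) * D)%C).
{ apply Cseries_unique with (1 := HD). apply Cseries_decr.
  apply Cseries_ext with (2 := Cseries_scal (- (x * RtoC t))%C _ _ HD).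
  intros j. now rewrite Ed. }
assert (E0 : d 0%nat = x).
{ unfold d, log1p_coef. simpl. field. }
rewrite E0 in H1.
assert (Hn := one_plus_neq_0 x t Hx Ht).
assert (H2 : (D * (1 + x * RtoC t))%C = x).
{ apply Ceq_minus. apply Ceq_minus in H1. rewrite <- H1. ring. }
replace x with (D * (1 + x * RtoC t))%C at 1 by exact H2. field. exact Hn.
Qed.

Lemma log1p_start x : CSeries (fun j => log1p_coef x j * RtoC 0 ^ j)%C = 0%C.
Proof.
apply Cseries_correct. apply Cseries_zero. intros [|j]; simpl; ring.
Qed.

Lemma log1p_end x : CSeries (fun j => log1p_coef x j * RtoC 1 ^ j)%C = log1p x.
Proof.
unfold log1p, CSeries. f_equal; apply Series_ext; intros j; now rewrite Cpow_1_l, Cmult_1_r.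
Qed.

(** With L (t) = log (1 + t x), both exp (a L) and the sum of the binomial series at t x
    solve (1 + t x) f' = a x f. *)
Lemma binomial_series a x :
  Cmod x < 1 -> Cseries (fun j => cbin a j * x ^ j)%C (Cexp (a * log1p x)).
Proof.
intros Hx. destruct (radius_above_1 x Hx) as [r [Hr Hxr]].
assert (H0 := Cmod_ge_0 x).
destruct (rbin_bounded (Cmod a) (Cmod x * r)) as [A HA].
{ apply Cmod_ge_0. }
{ split; [apply Rmult_le_pos; lra | exact Hxr]. }
set (c := fun j => (cbin a j * x ^ j)%C).
assert (HF := power_path_deriv c A r Hr).
specialize (HF ltac:(intros j; unfold c; rewrite Cmod_mult, Cmod_pow, Rmult_assoc,
  <- Rpow_mult_distr; eapply Rle_trans; [|apply (HA j)];
  apply Rmult_le_compat_r; [apply pow_le, Rmult_le_pos; lra | apply Cmod_cbin])).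
set (F := fun u : R => CSeries (fun j => c j * RtoC u ^ j)%C) in *.
set (L := fun u : R => CSeries (fun j => log1p_coef x j * RtoC u ^ j)%C).
assert (H1 : F 1 = (F 0 * Cexp (a * L 1 - a * L 0))%C).
{ apply (path_linear_ode F (fun t => a * L t)%C (fun t => a * (x / (1 + x * RtoC t)))%C).
  - intros t Ht. apply path_deriv_scal. now apply log1p_path.
  - intros t Ht. destruct (HF t Ht) as [D [Hs [HD Hd]]].
    fold (F t) in Hs.
    assert (Hn := one_plus_neq_0 x t Hx Ht).
    replace (a * (x / (1 + x * RtoC t)) * F t)%C with D; [exact Hd|].
    set (d := fun j => (RtoC (INR (S j)) * c (S j) * RtoC t ^ j)%C) in HD.
    assert (Ed : forall j, d j = (x * (a - RtoC (INR j)) * (c j * RtoC t ^ j))%C).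
    { intros j. unfold d, c. rewrite Cpow_S.
      replace (RtoC (INR (S j)) * (cbin a (S j) * (x * x ^ j)) * RtoC t ^ j)%C
        with (RtoC (INR (S j)) * cbin a (S j) * (x * x ^ j * RtoC t ^ j))%C by ring.
      rewrite cbin_S. ring. }
    assert (H2 : (D + x * RtoC t * D)%C = (a * x * F t)%C).
    { apply Cseries_unique with
        (fun j => d j + match j with O => 0 | S i => x * RtoC t * d i end)%C.
      - apply Cseries_plus; [exact HD|].
        replace (x * RtoC t * D)%C with (0 + x * RtoC t * D)%C by ring.
        apply (Cseries_decr (fun j => match j with O => RtoC 0 | S i => (x * RtoC t * d i)%C end)).
        now apply Cseries_scal.
      - apply Cseries_ext with (2 := Cseries_scal (a * x)%C _ _ Hs).
        intros [|j].
        + rewrite Ed. simpl. ring.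
        + rewrite (Ed (S j)). unfold d. simpl Cpow. ring. }
    replace D with ((D + x * RtoC t * D) / (1 + x * RtoC t))%C by (field; exact Hn).
    rewrite H2. field. exact Hn. }
destruct (HF 1 ltac:(lra)) as [_ [Hs _]].
assert (E0 : F 0 = 1%C).
{ apply Cseries_correct.
  replace (RtoC 1) with (c 0%nat * RtoC 0 ^ 0 + 0)%C.
  - apply (Cseries_decr (fun j => c j * RtoC 0 ^ j)%C).
    apply Cseries_zero. intros n. simpl. ring.
  - unfold c. simpl. ring. }
fold (F 1) in Hs. rewrite H1, E0 in Hs. unfold L in Hs.
rewrite log1p_end, log1p_start in Hs.
replace (1 * Cexp (a * log1p x - a * 0))%C with (Cexp (a * log1p x)) in Hs.
- apply Cseries_ext with (2 := Hs). intros j. rewrite Cpow_1_l. unfold c. ring.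
- rewrite Cmult_1_l. f_equal. ring.
Qed.

(** The case a = 1 of the binomial series, which then has only two terms. *)
Lemma Cexp_log1p x : Cmod x < 1 -> Cexp (log1p x) = (1 + x)%C.
Proof.
intros Hx. generalize (binomial_series 1 x Hx). rewrite Cmult_1_l. intros H.
apply Cseries_unique with (1 := H).
replace (1 + x)%C with (Csum (fun j => cbin 1 j * x ^ j)%C 1).
- apply Cseries_finite. intros n Hn.
  rewrite (cbin_zero 1 n Hn : cbin 1 n = 0%C). ring.
- rewrite Csum_S, Csum_0. simpl. field.
Qed.

(** * Binomial coefficients and Bernoulli numbers *)

(** The absorption identity (n + 1 - k) C(n + 1, k) = (n + 1) C(n, k), valid for a complex
    upper index. *)
Lemma cbin_absorb a k :
  ((a + 1 - RtoC (INR k)) * cbin (a + 1) k)%C = ((a + 1) * cbin a k)%C.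
Proof.
induction k as [|k IH]; [simpl; ring|].
cbn [cbin].
replace ((a + 1 - RtoC (INR (S k))) * (cbin (a + 1) k * (a + 1 - RtoC (INR k)) / RtoC (INR (S k))))%C
  with ((a + 1 - RtoC (INR (S k))) * ((a + 1 - RtoC (INR k)) * cbin (a + 1) k) / RtoC (INR (S k)))%C
  by (field; apply INR_S_neq).
rewrite IH. rewrite S_INR at 1. rewrite RtoC_plus. field. apply INR_S_neq.
Qed.

Lemma cbin_pascal a k : cbin (a + 1) (S k) = (cbin a (S k) + cbin a k)%C.
Proof.
cbn [cbin].
replace (cbin (a + 1) k * (a + 1 - RtoC (INR k)) / RtoC (INR (S k)))%C
  with ((a + 1 - RtoC (INR k)) * cbin (a + 1) k / RtoC (INR (S k)))%C
  by (field; apply INR_S_neq).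
rewrite cbin_absorb.
assert (H := INR_S_neq k). rewrite S_INR, RtoC_plus in *. field. exact H.
Qed.

Lemma cbin_diag k : cbin (RtoC (INR k)) k = 1%C.
Proof.
induction k as [|k IH]; [reflexivity|].
rewrite S_INR, RtoC_plus, cbin_pascal, IH, cbin_zero by lia. ring.
Qed.

Lemma cbin_nat_bound i k : Cmod (cbin (RtoC (INR i)) k) <= 2 ^ i.
Proof.
revert k. induction i as [|i IH]; intros k.
- destruct k as [|k]; [simpl; rewrite Cmod_1; lra|].
  rewrite cbin_zero by lia. rewrite Cmod_0. simpl; lra.
- destruct k as [|k].
  + cbn [cbin]. rewrite Cmod_1. apply pow_R1_Rle. lra.
  + rewrite S_INR, RtoC_plus, cbin_pascal.
    eapply Rle_trans; [apply Cmod_triangle|]. generalize (IH k) (IH (S k)). simpl. lra.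
Qed.

Lemma cbin_Binomial m k : (k <= m)%nat -> cbin (RtoC (INR m)) k = RtoC (Binomial.C m k).
Proof.
intros Hk. induction k as [|k IH].
- cbn [cbin]. f_equal. unfold Binomial.C. rewrite Nat.sub_0_r.
  change (INR (fact 0)) with 1. field. apply INR_fact_neq_0.
- cbn [cbin]. rewrite IH by lia.
  rewrite <- RtoC_minus, <- RtoC_mult, <- RtoC_div.
  2:{ apply Rgt_not_eq, INR_S_pos. }
  f_equal. unfold Binomial.C.
  replace (m - k)%nat with (S (m - S k)) by lia.
  rewrite !fact_simpl, !mult_INR.
  replace (INR m - INR k) with (INR (S (m - S k))).
  2:{ rewrite <- minus_INR by lia. f_equal. lia. }
  field. repeat split; try apply INR_fact_neq_0; apply Rgt_not_eq, INR_S_pos.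
Qed.

(** Trinomial revision.  It turns the double sum over k and j of the Euler-Maclaurin
    expansion into a sum over i = k + j in which Bernoulli numbers are weighted by C(i, k). *)
Lemma cbin_mult a k j :
  (cbin (RtoC (INR (k + j))) k * cbin a (k + j))%C = (cbin a k * cbin (a - RtoC (INR k)) j)%C.
Proof.
induction j as [|j IH].
- rewrite <- plus_n_O, cbin_diag. simpl. ring.
- rewrite <- plus_n_Sm.
  assert (H1 := cbin_absorb (RtoC (INR (k + j))) k).
  assert (H2 := cbin_S a (k + j)).
  assert (H3 := cbin_S (a - RtoC (INR k)) j).
  rewrite <- RtoC_plus, <- S_INR in H1.
  replace (RtoC (INR (S (k + j))) - RtoC (INR k))%C with (RtoC (INR (S j))) in H1.
  2:{ rewrite <- RtoC_minus. f_equal. rewrite !S_INR, plus_INR. ring. }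
  replace (a - RtoC (INR (k + j)))%C with (a - RtoC (INR k) - RtoC (INR j))%C in H2.
  2:{ rewrite plus_INR, RtoC_plus. ring. }
  set (u := RtoC (INR (S (k + j)))) in *.
  assert (Hu : u <> 0%C) by apply INR_S_neq.
  assert (Hj := INR_S_neq j). set (v := RtoC (INR (S j))) in *.
  replace (cbin u k) with (u * cbin (RtoC (INR (k + j))) k / v)%C by (rewrite <- H1; now field).
  replace (cbin a (S (k + j))) with ((a - RtoC (INR k) - RtoC (INR j)) * cbin a (k + j) / u)%C
    by (rewrite <- H2; now field).
  replace (cbin (a - RtoC (INR k)) (S j))
    with ((a - RtoC (INR k) - RtoC (INR j)) * cbin (a - RtoC (INR k)) j / v)%C
    by (rewrite <- H3; now field).
  replace (cbin a k * ((a - RtoC (INR k) - RtoC (INR j)) * cbin (a - RtoC (INR k)) j / v))%C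
    with ((a - RtoC (INR k) - RtoC (INR j)) * (cbin a k * cbin (a - RtoC (INR k)) j) / v)%C
    by now field.
  rewrite <- IH. field. now split.
Qed.

Lemma binomial_finite p x N :
  (p <= N)%nat -> Csum (fun j => cbin (RtoC (INR p)) j * x ^ j)%C N = ((1 + x) ^ p)%C.
Proof.
revert N. induction p as [|p IH]; intros N HN.
- destruct N as [|N].
  + rewrite Csum_0. simpl. ring.
  + rewrite Csum_incr. rewrite Csum_zero.
    * simpl. ring.
    * intros n _. rewrite cbin_zero by lia. ring.
- destruct N as [|N]; [lia|].
  rewrite Csum_incr.
  rewrite (Csum_ext _ (fun j => cbin (RtoC (INR p)) (S j) * x ^ (S j)
     + x * (cbin (RtoC (INR p)) j * x ^ j))%C).
  2:{ intros j. rewrite S_INR, RtoC_plus, cbin_pascal, Cpow_S. ring. }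
  rewrite Csum_plus, Csum_scal, IH by lia.
  assert (H := IH (S N) ltac:(lia)). rewrite Csum_incr in H.
  rewrite Cpow_S.
  apply Ceq_minus. apply Ceq_minus in H. rewrite <- H. cbn [cbin]. ring.
Qed.

Lemma bernoulli_upto_stable n k : (k <= n)%nat -> bernoulli_upto n k = bernoulli k.
Proof.
intros H. induction H as [|n H IH]; [reflexivity|].
cbn [bernoulli_upto]. apply Nat.leb_le in H. now rewrite H.
Qed.

Lemma bernoulli_recurrence n :
  sum_n (fun k => Binomial.C (S (S n)) k * bernoulli k) (S n) = 0.
Proof.
rewrite sum_Sn. unfold plus; simpl.
assert (E : bernoulli (S n) = - / INR (S n + 1) *
   sum_n (fun j => Binomial.C (S n + 1) j * bernoulli j) n).
{ unfold bernoulli at 1. cbn [bernoulli_upto].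
  replace (Nat.leb (S n) n) with false by (symmetry; apply Nat.leb_gt; lia).
  f_equal. apply sum_n_ext_loc. intros k Hk. now rewrite bernoulli_upto_stable. }
rewrite E. replace (S n + 1)%nat with (S (S n)) by lia.
rewrite (pascal_step1 (S (S n)) (S n)) by lia.
replace (S (S n) - S n)%nat with 1%nat by lia.
replace (Binomial.C (S (S n)) 1) with (INR (S (S n))).
- field. apply Rgt_not_eq, INR_S_pos.
- unfold Binomial.C. replace (S (S n) - 1)%nat with (S n) by lia.
  rewrite (fact_simpl (S n)), mult_INR. simpl (fact 1). change (INR 1) with 1.
  field. apply INR_fact_neq_0.
Qed.

(** The defect b_K (a, y + 1) - b_K (a, y) - a y^(a-1) is the sum over i of
    em_coef K i * cbin a i * y^(a-i); the three parts correspond to its three terms. *)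
Definition em_coef (K i : nat) : C :=
  (Csum (fun k => RtoC (bernoulli k) * cbin (RtoC (INR i)) k) K
   - (if Nat.leb i K then RtoC (bernoulli i) else 0)
   - (if Nat.eqb i 1 then 1 else 0))%C.

Lemma bernoulli_cbin_sum n :
  Csum (fun k => RtoC (bernoulli k) * cbin (RtoC (INR (S (S n)))) k)%C (S n) = 0%C.
Proof.
rewrite (Csum_ext_loc _ (fun k => RtoC (Binomial.C (S (S n)) k * bernoulli k))).
- rewrite Csum_RtoC. now rewrite bernoulli_recurrence.
- intros k Hk. rewrite cbin_Binomial by lia. rewrite RtoC_mult. apply Cmult_comm.
Qed.

(** For i >= 2 this is the recurrence of the Bernoulli numbers.  For i = 0 the constant terms
    cancel, and for i = 1 the term B_0 cancels a y^(a-1). *)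
Lemma em_coef_zero K i : (i <= S K)%nat -> em_coef K i = 0%C.
Proof.
intros Hi. unfold em_coef.
assert (Hb0 : bernoulli 0 = 1) by reflexivity.
assert (Hlow : (i <= K)%nat ->
  Csum (fun k => RtoC (bernoulli k) * cbin (RtoC (INR i)) k)%C K =
  Csum (fun k => RtoC (bernoulli k) * cbin (RtoC (INR i)) k)%C i).
{ intros H. induction H as [|K H IH]; [reflexivity|].
  rewrite Csum_S, IH, cbin_zero by lia. ring. }
destruct (Nat.leb_spec i K) as [H|H].
- rewrite Hlow by exact H. destruct i as [|[|i]].
  + rewrite Csum_0, Hb0. simpl. ring.
  + rewrite Csum_S, Csum_0, cbin_diag, Hb0. simpl. ring.
  + rewrite Csum_S, bernoulli_cbin_sum, cbin_diag. cbn [Nat.eqb]. ring.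
- replace i with (S K) by lia. destruct K as [|K].
  + rewrite Csum_0, Hb0. simpl. ring.
  + rewrite bernoulli_cbin_sum. cbn [Nat.eqb]. ring.
Qed.

Lemma em_coef_bound K : exists E, 0 <= E /\ forall i, Cmod (em_coef K i) <= E * 2 ^ i.
Proof.
exists (sum_n (fun k => Rabs (bernoulli k)) K).
assert (HE : 0 <= sum_n (fun k => Rabs (bernoulli k)) K).
{ apply (sum_n_nonneg (fun k => Rabs (bernoulli k))). intros; apply Rabs_pos. }
split; [exact HE|]. intros i.
destruct (Nat.le_gt_cases i (S K)) as [H|H].
- rewrite em_coef_zero, Cmod_0 by exact H. apply Rmult_le_pos; [exact HE|].
  apply pow_le; lra.
- unfold em_coef.
  replace (Nat.leb i K) with false by (symmetry; apply Nat.leb_gt; lia).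
  replace (Nat.eqb i 1) with false by (symmetry; apply Nat.eqb_neq; lia).
  match goal with |- Cmod ?z <= _ => replace z with
    (Csum (fun k => RtoC (bernoulli k) * cbin (RtoC (INR i)) k)%C K) by ring end.
  eapply Rle_trans; [apply Cmod_Csum|].
  rewrite <- (sum_n_mult_r (K := R_Ring) (2 ^ i) (fun k => Rabs (bernoulli k))).
  apply sum_n_m_le. intros k. rewrite Cmod_mult, Cmod_R.
  apply Rmult_le_compat_l; [apply Rabs_pos | apply cbin_nat_bound].
Qed.

Lemma Cseries_skip (f : nat -> C) k l :
  (forall i, (i < k)%nat -> f i = 0%C) -> Cseries (fun j => f (k + j)%nat) l -> Cseries f l.
Proof.
revert f. induction k as [|k IH]; intros f H0 H; [exact H|].
replace l with (f 0%nat + l)%C by (rewrite H0 by lia; ring).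
apply Cseries_decr. apply IH; [intros i Hi; apply H0; lia | exact H].
Qed.

(** P k plays the role of (1 + x)^(a-k).  Leaving it abstract covers both the binomial series
    for small x and the binomial formula for natural a and arbitrary x; in the latter case
    (1 + x)^(a-k) has no finite expansion for k > a, but then cbin a k = 0. *)
Lemma em_expansion K a x (P : nat -> C) :
  (forall k, (k <= K)%nat -> cbin a k = 0%C \/
     Cseries (fun j => cbin (a - RtoC (INR k)) j * x ^ j)%C (P k)) ->
  Cseries (fun i => em_coef K i * cbin a i * x ^ i)%C
    (Csum (fun k => RtoC (bernoulli k) * cbin a k * x ^ k * P k) K
     - Csum (fun k => RtoC (bernoulli k) * cbin a k * x ^ k) K - a * x)%C.
Proof.
intros HP.
set (f := fun k i => (RtoC (bernoulli k) * cbin (RtoC (INR i)) k * cbin a i * x ^ i)%C).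
assert (H1 : Cseries (fun i => Csum (fun k => f k i) K)
  (Csum (fun k => RtoC (bernoulli k) * cbin a k * x ^ k * P k)%C K)).
{ assert (Hf : forall k, (k <= K)%nat -> Cseries (f k)
    (RtoC (bernoulli k) * cbin a k * x ^ k * P k)%C).
  { intros k Hk. apply Cseries_skip with k.
    { intros i Hi. unfold f. rewrite cbin_zero by exact Hi. ring. }
    assert (Ef : forall j, f k (k + j)%nat = (RtoC (bernoulli k) * cbin a k * x ^ k *
       (cbin (a - RtoC (INR k)) j * x ^ j))%C).
    { intros j. unfold f. rewrite Cpow_add_r.
      replace (RtoC (bernoulli k) * cbin (RtoC (INR (k + j))) k * cbin a (k + j) * (x ^ k * x ^ j))%C
        with (RtoC (bernoulli k) * (cbin (RtoC (INR (k + j))) k * cbin a (k + j)) * (x ^ k * x ^ j))%C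
        by ring.
      rewrite cbin_mult. ring. }
    destruct (HP k Hk) as [H0|H].
    - rewrite H0 in *.
      replace (RtoC (bernoulli k) * 0 * x ^ k * P k)%C with (RtoC 0) by ring.
      apply Cseries_zero. intros j. rewrite Ef. ring.
    - apply Cseries_ext with (2 := Cseries_scal _ _ _ H). intros j. now rewrite Ef. }
  clearbody f. clear HP.
  assert (HK : (K <= K)%nat) by apply le_n. revert HK. generalize K at 1 3 4 as N.
  induction N as [|N IH]; intros HN.
  - rewrite Csum_0. apply Cseries_ext with (2 := Hf 0%nat ltac:(lia)).
    intros i. now rewrite Csum_0.
  - rewrite Csum_S.
    apply Cseries_ext with (2 := Cseries_plus _ _ _ _ (IH ltac:(lia)) (Hf (S N) HN)).
    intros i. now rewrite Csum_S. }
assert (H2 : Cseries (fun i => if Nat.leb i K then RtoC (bernoulli i) * cbin a i * x ^ i else 0)%C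
   (Csum (fun k => RtoC (bernoulli k) * cbin a k * x ^ k) K)%C).
{ rewrite (Csum_ext_loc _ (fun i => if Nat.leb i K then RtoC (bernoulli i) * cbin a i * x ^ i else 0)%C).
  - apply Cseries_finite. intros i Hi.
    now replace (Nat.leb i K) with false by (symmetry; apply Nat.leb_gt; lia).
  - intros i Hi. now replace (Nat.leb i K) with true by (symmetry; apply Nat.leb_le; lia). }
assert (H3 : Cseries (fun i => if Nat.eqb i 1 then cbin a i * x ^ i else 0)%C (a * x)%C).
{ replace (a * x)%C with (Csum (fun i => if Nat.eqb i 1 then cbin a i * x ^ i else 0)%C 1).
  - apply Cseries_finite. intros i Hi.
    now replace (Nat.eqb i 1) with false by (symmetry; apply Nat.eqb_neq; lia).
  - rewrite Csum_S, Csum_0. simpl. field. }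
unfold Cminus.
generalize (Cseries_plus _ _ _ _ (Cseries_plus _ _ _ _ H1 (Cseries_scal (-1) _ _ H2))
  (Cseries_scal (-1) _ _ H3)).
intros H.
match type of H with Cseries _ ?l => match goal with |- Cseries _ ?l' =>
  replace l' with l by ring end end.
apply Cseries_ext with (2 := H). intros i. unfold em_coef.
rewrite (Csum_ext (fun k => f k i) (fun k => cbin a i * x ^ i *
   (RtoC (bernoulli k) * cbin (RtoC (INR i)) k))%C) by (intros k; unfold f; ring).
rewrite Csum_scal.
destruct (Nat.leb i K), (Nat.eqb i 1); ring.
Qed.

(** * Terms of the Euler-Maclaurin series *)

(** sum_(k <= K) C(a, k) B_k y^(a-k), where y = exp L.  The argument is the logarithm L
    because it selects the branch of the powers. *)
Definition bern_trunc (K : nat) (a L : C) : C :=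
  Csum (fun k => RtoC (bernoulli k) * cbin a k * Cexp ((a - RtoC (INR k)) * L))%C K.

(** The defect of bern_trunc as a solution of b (a, y + 1) - b (a, y) = a y^(a-1), where L
    and L' are logarithms of y and y + 1. *)
Definition em_term (K : nat) (a L L' : C) : C :=
  (bern_trunc K a L' - bern_trunc K a L - a * Cexp ((a - 1) * L))%C.

Lemma Cexp_INR n L : Cexp (RtoC (INR n) * L) = (Cexp L ^ n)%C.
Proof.
induction n as [|n IH].
- simpl. rewrite Cmult_0_l. apply Cexp_0.
- rewrite S_INR, RtoC_plus, Cpow_S, <- IH, <- Cexp_plus. f_equal. ring.
Qed.

Lemma Cexp_shift_pow a k L x :
  (Cexp L * x)%C = 1%C -> Cexp ((a - RtoC (INR k)) * L) = (Cexp (a * L) * x ^ k)%C.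
Proof.
intros Hx.
replace ((a - RtoC (INR k)) * L)%C with (a * L - RtoC (INR k) * L)%C by ring.
rewrite Cexp_minus, Cexp_INR.
assert (HL := Cpow_nz (Cexp L) k (Cexp_neq_0 L)).
replace (x ^ k)%C with (/ Cexp L ^ k)%C; [reflexivity|].
replace x with (/ Cexp L)%C.
- symmetry. apply Cpow_inv, Cexp_neq_0.
- replace x with (/ Cexp L * (Cexp L * x))%C by (field; apply Cexp_neq_0).
  rewrite Hx. ring.
Qed.

Lemma em_term_series K a L L' x (P : nat -> C) :
  (Cexp L * x)%C = 1%C ->
  (forall k, (k <= K)%nat -> cbin a k = 0%C \/
     (Cseries (fun j => cbin (a - RtoC (INR k)) j * x ^ j)%C (P k) /\
      Cexp ((a - RtoC (INR k)) * L') = (Cexp ((a - RtoC (INR k)) * L) * P k)%C)) ->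
  Cseries (fun i => Cexp (a * L) * (em_coef K i * cbin a i * x ^ i))%C (em_term K a L L').
Proof.
intros Hx HP.
replace (em_term K a L L') with (Cexp (a * L) *
  (Csum (fun k => RtoC (bernoulli k) * cbin a k * x ^ k * P k) K
     - Csum (fun k => RtoC (bernoulli k) * cbin a k * x ^ k) K - a * x))%C.
- apply Cseries_scal. apply em_expansion. intros k Hk.
  destruct (HP k Hk) as [H|[H _]]; [now left | now right].
- unfold em_term, bern_trunc.
  assert (H1 := Cexp_shift_pow a 1 L x Hx). change (INR 1) with 1 in H1.
  rewrite H1, Cpow_1_r.
  rewrite (Csum_ext_loc (fun k => RtoC (bernoulli k) * cbin a k * Cexp ((a - RtoC (INR k)) * L'))%C
    (fun k => Cexp (a * L) * (RtoC (bernoulli k) * cbin a k * x ^ k * P k))%C).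
  2:{ intros k Hk. destruct (HP k Hk) as [H|[_ H]].
      - rewrite H. ring.
      - rewrite H, (Cexp_shift_pow a k L x Hx). ring. }
  rewrite (Csum_ext (fun k => RtoC (bernoulli k) * cbin a k * Cexp ((a - RtoC (INR k)) * L))%C
    (fun k => Cexp (a * L) * (RtoC (bernoulli k) * cbin a k * x ^ k))%C).
  2:{ intros k. rewrite (Cexp_shift_pow a k L x Hx). ring. }
  rewrite !Csum_scal. ring.
Qed.

Lemma em_term_series_log1p K a L x :
  (Cexp L * x)%C = 1%C -> Cmod x < 1 ->
  Cseries (fun i => Cexp (a * L) * (em_coef K i * cbin a i * x ^ i))%C
    (em_term K a L (L + log1p x)).
Proof.
intros Hx Hx1.
apply em_term_series with (fun k => Cexp ((a - RtoC (INR k)) * log1p x)); [exact Hx|].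
intros k _. right. split; [now apply binomial_series|].
rewrite <- Cexp_plus. f_equal. ring.
Qed.

(** For natural a = m <= K + 1 every term of the expansion vanishes: em_coef K i for
    i <= K + 1, and cbin m i for larger i. *)
Lemma em_term_nat K m L L' x :
  (Cexp L * x)%C = 1%C -> Cexp L' = (Cexp L * (1 + x))%C -> (m <= S K)%nat ->
  em_term K (RtoC (INR m)) L L' = 0%C.
Proof.
intros Hx HL' HK.
assert (H : Cseries (fun i => Cexp (RtoC (INR m) * L) * (em_coef K i * cbin (RtoC (INR m)) i * x ^ i))%C
  (em_term K (RtoC (INR m)) L L')).
{ apply em_term_series with (fun k => ((1 + x) ^ (m - k))%C); [exact Hx|].
  intros k _. destruct (Nat.le_gt_cases k m) as [Hk|Hk].
  - right. rewrite <- RtoC_minus, <- minus_INR by exact Hk. split.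
    + rewrite <- (binomial_finite (m - k) x (m - k)) by lia.
      apply Cseries_finite. intros j Hj. rewrite cbin_zero by exact Hj. ring.
    + now rewrite !Cexp_INR, HL', Cpow_mult_l.
  - left. now apply cbin_zero. }
apply Cseries_unique with (1 := H). apply Cseries_zero. intros i.
destruct (Nat.le_gt_cases i (S K)) as [Hi|Hi].
- rewrite em_coef_zero by exact Hi. ring.
- rewrite cbin_zero by lia. ring.
Qed.

Lemma exp_le x y : x <= y -> exp x <= exp y.
Proof. intros [H|H]; [now left; apply exp_increasing | right; now rewrite H]. Qed.

Lemma Cmod_Cexp_le_exp z : Cmod (Cexp z) <= exp (Cmod z).
Proof.
rewrite Cmod_Cexp. apply exp_le. eapply Rle_trans; [apply Rle_abs | apply re_le_Cmod].
Qed.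

Lemma wiener_Cexp_mult rho a L :
  0 < rho -> wiener rho (exp ((Cmod a + rho) * Cmod L)) (fun h => Cexp ((a + h) * L)).
Proof.
intros Hr.
apply wiener_ext with (fun h => Cexp (a * L) * Cexp (L * h))%C.
{ intros h _. rewrite <- Cexp_plus. f_equal. ring. }
apply wiener_le with (Cmod (Cexp (a * L)) * exp (Cmod L * rho)).
- rewrite Rmult_plus_distr_r, exp_plus, (Rmult_comm (Cmod L)).
  apply Rmult_le_compat_r; [apply Rlt_le, exp_pos|].
  rewrite <- Cmod_mult. apply Cmod_Cexp_le_exp.
- apply wiener_scal. apply wiener_exp. lra.
Qed.

(** Only the indices i >= K + 2 contribute.  For these, as |x| <= 1 / 4,
    2^i |x|^i <= (4 |x|)^(K+2) 2^(-i), and the sum of rbin A i 2^(-i) is finite. *)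
Lemma wiener_em_term K a0 : exists E, 0 <= E /\ forall L x,
  (Cexp L * x)%C = 1%C -> Cmod x <= / 4 ->
  wiener 1 (E * exp ((Cmod a0 + 1) * Cmod L) * Cmod x ^ (S (S K)))
    (fun h => em_term K (a0 + h) L (L + log1p x)).
Proof.
destruct (em_coef_bound K) as [E [HE0 HE]].
set (A := Cmod a0 + 1).
assert (HA : 0 <= A) by (unfold A; generalize (Cmod_ge_0 a0); lra).
destruct (rbin_half_bounded A HA) as [B HB].
assert (HB0 : 0 <= B).
{ generalize (bounded_sums_0 _ _ HB). simpl. lra. }
exists (E * 4 ^ (S (S K)) * B).
assert (H4 : 0 <= 4 ^ S (S K)) by (apply pow_le; lra).
split; [apply Rmult_le_pos; [now apply Rmult_le_pos | exact HB0]|].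
intros L x Hx Hx4. assert (Hx0 := Cmod_ge_0 x).
assert (Hser : wiener 1 (E * (4 * Cmod x) ^ (S (S K)) * B)
  (fun h => em_term K (a0 + h) L (L + log1p x) / Cexp ((a0 + h) * L))%C).
{ apply wiener_sum with
   (M := fun i => E * (4 * Cmod x) ^ (S (S K)) * (rbin A i * (/ 2) ^ i))
   (f := fun i h => (em_coef K i * x ^ i * cbin (a0 + h) i)%C).
  - lra.
  - intros i. assert (Hrb := rbin_pos A i HA).
    apply wiener_le with (Cmod (em_coef K i * x ^ i) * rbin A i).
    + rewrite Cmod_mult, Cmod_pow.
      destruct (Nat.le_gt_cases i (S K)) as [Hi|Hi].
      * rewrite em_coef_zero, Cmod_0, !Rmult_0_l by exact Hi.
        apply Rmult_le_pos; apply Rmult_le_pos; try assumption; apply pow_le; lra.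
      * apply Rle_trans with (E * 2 ^ i * Cmod x ^ i * rbin A i).
        { apply Rmult_le_compat_r; [exact Hrb|].
          apply Rmult_le_compat_r; [now apply pow_le | apply HE]. }
        replace (E * 2 ^ i * Cmod x ^ i * rbin A i)
          with (E * (4 * Cmod x) ^ i * (rbin A i * (/ 2) ^ i)).
        2:{ rewrite pow_inv, Rpow_mult_distr.
            replace (4 ^ i) with (2 ^ i * 2 ^ i) by (rewrite <- Rpow_mult_distr; f_equal; ring).
            field. apply pow_nonzero; lra. }
        apply Rmult_le_compat_r.
        { apply Rmult_le_pos; [exact Hrb | apply pow_le; lra]. }
        apply Rmult_le_compat_l; [exact HE0|].
        replace i with (S (S K) + (i - S (S K)))%nat by lia.
        rewrite pow_add. rewrite <- (Rmult_1_r ((4 * Cmod x) ^ S (S K))) at 2.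
        apply Rmult_le_compat_l; [apply pow_le; lra|].
        rewrite <- (pow1 (i - S (S K))). apply pow_incr. lra.
    + apply wiener_scal. apply wiener_cbin. lra.
  - apply bounded_sums_scal; [|exact HB].
    apply Rmult_le_pos; [exact HE0 | apply pow_le; lra].
  - intros h _.
    assert (H := em_term_series_log1p K (a0 + h)%C L x Hx ltac:(lra)).
    unfold Cdiv. rewrite Cmult_comm.
    apply Cseries_ext with (2 := Cseries_scal (/ Cexp ((a0 + h) * L))%C _ _ H).
    intros i. field. apply Cexp_neq_0. }
apply wiener_ext with (fun h => Cexp ((a0 + h) * L) *
   (em_term K (a0 + h) L (L + log1p x) / Cexp ((a0 + h) * L)))%C.
{ intros h _. field. apply Cexp_neq_0. }
apply wiener_le with (exp (A * Cmod L) * (E * (4 * Cmod x) ^ (S (S K)) * B)).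
{ rewrite Rpow_mult_distr. apply Req_le. ring. }
apply wiener_mult; [lra| |exact Hser].
apply wiener_Cexp_mult. lra.
Qed.

Lemma wiener_bern_trunc K a0 L : exists M, wiener 1 M (fun h => bern_trunc K (a0 + h) L).
Proof.
unfold bern_trunc. induction K as [|K [M IH]].
- exists (rbin (Cmod a0 + 1) 0 * (Cmod (RtoC (bernoulli 0)) * exp ((Cmod (a0 - 0) + 1) * Cmod L))).
  apply wiener_ext with (fun h => cbin (a0 + h) 0 * (RtoC (bernoulli 0) * Cexp ((a0 - 0 + h) * L)))%C.
  { intros h _. rewrite Csum_0. change (INR 0) with 0.
    replace (a0 - 0 + h)%C with (a0 + h - 0)%C by ring. ring. }
  apply wiener_mult; [lra | apply wiener_cbin; lra|].
  apply wiener_scal. apply wiener_Cexp_mult. lra.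
- eexists. eapply wiener_ext; [intros h _; symmetry; apply Csum_S|].
  apply wiener_plus; [lra | exact IH|].
  apply wiener_ext with (fun h => cbin (a0 + h) (S K) *
     (RtoC (bernoulli (S K)) * Cexp ((a0 - RtoC (INR (S K)) + h) * L)))%C.
  { intros h _. replace (a0 - RtoC (INR (S K)) + h)%C with (a0 + h - RtoC (INR (S K)))%C by ring.
    ring. }
  apply wiener_mult; [lra | apply wiener_cbin; lra|].
  apply wiener_scal. apply wiener_Cexp_mult. lra.
Qed.

Lemma wiener_em_term_ex K a0 L L' : exists M, wiener 1 M (fun h => em_term K (a0 + h) L L').
Proof.
destruct (wiener_bern_trunc K a0 L) as [M HM].
destruct (wiener_bern_trunc K a0 L') as [M' HM'].
eexists. eapply wiener_ext.
2:{ apply wiener_plus; [lra | apply wiener_plus; [lra | exact HM' |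
      apply (wiener_scal 1 M (-1) _ HM)] |].
    apply wiener_scal with (c := RtoC (-1)). apply wiener_mult; [lra | apply (wiener_affine 1 a0 1); lra|].
    apply (wiener_Cexp_mult 1 (a0 - 1) L). lra. }
intros h _. unfold em_term. simpl.
replace (a0 - 1 + h)%C with (a0 + h - 1)%C by ring. ring.
Qed.

(** * The principal logarithm *)

Lemma Re_div_Cmod_bound (w : C) : w <> 0%C -> -1 <= Re w / Cmod w <= 1.
Proof.
intros Hw. assert (Hp := proj1 (Cmod_gt_0 w) Hw).
assert (H := re_le_Cmod w). apply Rabs_le_between in H.
split; apply Rmult_le_reg_r with (Cmod w); try exact Hp;
  unfold Rdiv; rewrite Rmult_assoc, Rinv_l by lra; lra.
Qed.

Lemma Cexp_Clog (w : C) : w <> 0%C -> Cexp (Clog w) = w.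
Proof.
intros Hw. assert (Hp := proj1 (Cmod_gt_0 w) Hw).
assert (Hr := Re_div_Cmod_bound w Hw).
unfold Cexp, Clog. cbn [fst snd Re Im]. rewrite exp_ln by exact Hp.
assert (Hc : Cmod w * cos (Carg w) = Re w).
{ unfold Carg. destruct (Rle_dec 0 (Im w)); rewrite ?cos_neg, cos_acos by exact Hr;
    field; lra. }
assert (Hsq : Cmod w * sqrt (1 - Rsqr (Re w / Cmod w)) = Rabs (Im w)).
{ rewrite <- (sqrt_Rsqr (Cmod w)) at 1 by lra.
  rewrite <- sqrt_mult_alt by apply Rle_0_sqr.
  rewrite <- sqrt_Rsqr_abs. f_equal.
  assert (H2 := Cmod2_alt w). unfold Rsqr.
  replace (Cmod w * Cmod w * (1 - Re w / Cmod w * (Re w / Cmod w)))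
    with (Cmod w ^ 2 - Re w ^ 2) by (field; lra).
  rewrite H2. ring. }
assert (Hs : Cmod w * sin (Carg w) = Im w).
{ unfold Carg. destruct (Rle_dec 0 (Im w)) as [Hi|Hi].
  - rewrite sin_acos, Hsq by exact Hr. now apply Rabs_pos_eq.
  - rewrite sin_neg, sin_acos by exact Hr.
    replace (Cmod w * - sqrt (1 - Rsqr (Re w / Cmod w)))
      with (- (Cmod w * sqrt (1 - Rsqr (Re w / Cmod w)))) by ring.
    rewrite Hsq, Rabs_left1 by lra. ring. }
rewrite Hc, Hs. destruct w; reflexivity.
Qed.

Lemma Carg_bound w : Rabs (Carg w) <= PI.
Proof.
unfold Carg. assert (H := acos_bound (Re w / Cmod w)).
destruct (Rle_dec 0 (Im w)); rewrite ?Rabs_Ropp, Rabs_pos_eq; lra.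
Qed.

Lemma Carg_bound_half w : 0 < Re w -> Rabs (Carg w) < PI / 2.
Proof.
intros Hw.
assert (Hn : w <> 0%C) by (intros E; rewrite E in Hw; simpl in Hw; lra).
assert (Hp := proj1 (Cmod_gt_0 w) Hn).
assert (Hr := Re_div_Cmod_bound w Hn).
assert (Hx : 0 < Re w / Cmod w) by now apply Rdiv_lt_0_compat.
assert (H := acos_bound (Re w / Cmod w)).
assert (Ha : acos (Re w / Cmod w) < PI / 2).
{ apply Rnot_le_lt. intros Hle.
  assert (Hc : cos (acos (Re w / Cmod w)) <= 0) by (apply cos_le_0; lra).
  rewrite cos_acos in Hc by exact Hr. lra. }
unfold Carg. destruct (Rle_dec 0 (Im w)); rewrite ?Rabs_Ropp, Rabs_pos_eq; lra.
Qed.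

(** The exponential of the difference is 1, so its real part is 0 and its imaginary part is
    a multiple of 2 pi. *)
Lemma Cexp_inj_strip a b : Cexp a = Cexp b -> Rabs (Im a - Im b) < 2 * PI -> a = b.
Proof.
intros H Hi.
assert (HE : Cexp (a - b) = 1%C).
{ rewrite Cexp_minus, H. field. apply Cexp_neq_0. }
destruct a as [a1 a2], b as [b1 b2]. simpl in Hi.
assert (Hm : exp (a1 - b1) = 1).
{ rewrite <- Cmod_1, <- HE, Cmod_Cexp. reflexivity. }
assert (H1 : a1 - b1 = 0).
{ apply exp_inv. now rewrite exp_0. }
assert (Hc : cos (a2 - b2) = 1).
{ assert (Hr := f_equal Re HE). unfold Cexp in Hr. simpl in Hr.
  change (exp (a1 - b1) * cos (a2 - b2) = 1) in Hr. rewrite Hm in Hr. lra. }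
assert (H2 : a2 - b2 = 0).
{ set (t := (a2 - b2) / 2).
  assert (Ht : a2 - b2 = 2 * t) by (unfold t; field).
  rewrite Ht in Hc. rewrite cos_2a_sin in Hc.
  assert (Hs : sin t = 0) by nra.
  apply Rabs_def2 in Hi. rewrite Ht in Hi.
  destruct (Rtotal_order t 0) as [Hlt|[->|Hgt]].
  - assert (0 < sin (- t)) by (apply sin_gt_0; lra). rewrite sin_neg in *. lra.
  - lra.
  - assert (0 < sin t) by (apply sin_gt_0; lra). lra. }
f_equal; lra.
Qed.

(** Both sides have exponential w + 1.  In the half-plane Re w > 0 the arguments of w and
    w + 1 are less than pi / 2 and the imaginary part of log1p (/ w) is less than 1, so the
    imaginary parts of the two sides differ by less than 2 pi. *)
Lemma Clog_succ w : 0 < Re w -> Cmod (/ w) <= / 2 ->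
  Clog (w + 1) = (Clog w + log1p (/ w))%C.
Proof.
intros Hw Hx.
assert (Hn : w <> 0%C) by (intros E; rewrite E in Hw; simpl in Hw; lra).
assert (Hr1 : 0 < Re (w + 1)) by (rewrite re_plus; simpl; lra).
assert (Hn1 : (w + 1)%C <> 0%C) by (intros E; rewrite E in Hr1; simpl in Hr1; lra).
apply Cexp_inj_strip.
- rewrite Cexp_plus, !Cexp_Clog, Cexp_log1p by (assumption || lra). now field.
- rewrite im_plus. unfold Clog at 1 2. cbn [Im snd].
  assert (H1 := Carg_bound_half w Hw). assert (H2 := Carg_bound_half (w + 1) Hr1).
  assert (H3 : Rabs (Im (log1p (/ w))) < 1).
  { eapply Rle_lt_trans; [apply im_le_Cmod|].
    replace (log1p (/ w)) with (/ w + (log1p (/ w) - / w))%C by ring.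
    eapply Rle_lt_trans; [apply Cmod_triangle|].
    generalize (log1p_approx (/ w) Hx) (Cmod_ge_0 (/ w)). nra. }
  assert (HPI := PI2_1).
  apply Rabs_def2 in H1, H2, H3. apply Rabs_def1; lra.
Qed.

(** * Summation over the translates of q *)

Definition not_nonpos_int (q : C) : Prop := forall n : nat, q <> RtoC (- INR n).

Definition shift_log (q : C) (n : nat) : C := Clog (RtoC (INR n) + q).

Lemma shift_neq_0 q n : not_nonpos_int q -> (RtoC (INR n) + q)%C <> 0%C.
Proof.
intros hq E. apply (hq n). rewrite RtoC_opp.
replace q with ((RtoC (INR n) + q) - RtoC (INR n))%C by ring. rewrite E. ring.
Qed.

Lemma shift_Re_lower q n : INR n - Cmod q <= Re (RtoC (INR n) + q).
Proof.
rewrite re_plus. simpl. generalize (re_le_Cmod q). intros H.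
apply Rabs_le_between in H. simpl in H. lra.
Qed.

Lemma shift_Cmod_lower q n : INR n - Cmod q <= Cmod (RtoC (INR n) + q).
Proof.
eapply Rle_trans; [apply shift_Re_lower|].
eapply Rle_trans; [apply Rle_abs | apply re_le_Cmod].
Qed.

Lemma nat_above (x : R) : exists N : nat, x <= INR N.
Proof.
exists (Z.to_nat (up (Rmax x 0))).
assert (H := archimed (Rmax x 0)). assert (H1 := Rmax_l x 0). assert (H2 := Rmax_r x 0).
rewrite INR_IZR_INZ, Z2Nat.id; [lra|]. apply le_IZR. lra.
Qed.

(** The partial sums are at most 2 - 1 / (N + 1), by comparison with a telescoping sum. *)
Lemma bounded_sums_inv_sqr : bounded_sums (fun n => / INR (S n) ^ 2) 2.
Proof.
assert (H : forall N, sum_n (fun n => / INR (S n) ^ 2) N <= 2 - / INR (S N)).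
{ induction N as [|N IH].
  - rewrite sum_O. simpl. lra.
  - rewrite sum_Sn. rewrite (S_INR (S N)).
    assert (Hp := INR_S_pos N). set (y := INR (S N)) in *.
    assert (/ (y + 1) ^ 2 <= / y - / (y + 1)); [|unfold plus; simpl in *; lra].
    replace (/ y - / (y + 1)) with (/ (y * (y + 1))) by (field; lra).
    apply Rinv_le_contravar; nra. }
intros N. generalize (H N) (Rinv_0_lt_compat _ (INR_S_pos N)). lra.
Qed.

Lemma Cmod_Clog w : 1 <= Cmod w -> Cmod (Clog w) <= ln (Cmod w) + PI.
Proof.
intros H. eapply Rle_trans; [apply Cmod_le_Re_Im|].
unfold Clog. cbn [Re Im fst snd].
assert (0 <= ln (Cmod w)).
{ rewrite <- ln_1. destruct H as [H|<-]; [left; now apply ln_increasing; lra | lra]. }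
rewrite (Rabs_pos_eq (ln _)) by assumption. generalize (Carg_bound w). lra.
Qed.

(** The first N functions need no uniform bound: they are split off one at a time. *)
Lemma wiener_sum_eventually rho (f : nat -> C -> C) N b B :
  0 < rho -> (forall n, exists M, wiener rho M (f n)) ->
  (forall n, wiener rho (b n) (f (N + n)%nat)) -> bounded_sums b B ->
  (exists M, wiener rho M (fun h => CSeries (fun n => f n h))) /\
  forall h, Cmod h <= rho -> Cseries (fun n => f n h) (CSeries (fun n => f n h)).
Proof.
intros Hr. revert f. induction N as [|N IH]; intros f Hf Hb HB.
- assert (Hs : forall h, Cmod h <= rho -> Cseries (fun n => f n h) (CSeries (fun n => f n h))).
  { intros h Hh. destruct (dominated_series (fun n => f n h) b B) as [l [Hl _]].
    - intros n. now apply wiener_bound with rho.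
    - exact HB.
    - now apply Cseries_ex with l. }
  split; [|exact Hs]. exists B. now apply wiener_sum with b f.
- destruct (IH (fun n => f (S n))) as [[M HM] Hs]; auto.
  assert (Hs0 : forall h, Cmod h <= rho -> Cseries (fun n => f n h)
    (f 0%nat h + CSeries (fun n => f (S n) h))%C).
  { intros h Hh. apply (Cseries_decr (fun n => f n h)). now apply Hs. }
  split.
  + destruct (Hf 0%nat) as [M0 HM0]. exists (M0 + M).
    apply wiener_ext with (fun h => f 0%nat h + CSeries (fun n => f (S n) h))%C.
    * intros h Hh. symmetry. apply Cseries_correct. now apply Hs0.
    * apply wiener_plus; [lra | exact HM0 | exact HM].
  + intros h Hh. eapply Cseries_ex. now apply Hs0.
Qed.

Definition em_sum (K : nat) (q a : C) : C :=
  CSeries (fun n => em_term K a (shift_log q n) (shift_log q (S n))).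

(** With A = |a0| + 1 <= K, the norm of the n-th term is O(|y|^A |y|^(-K-2)) = O(|y|^(-2)) for
    y = q + n. *)
Lemma em_sum_regular K q a0 : not_nonpos_int q -> Cmod a0 + 1 <= INR K ->
  (exists M, wiener 1 M (fun h => em_sum K q (a0 + h))) /\
  forall h, Cmod h <= 1 ->
    Cseries (fun n => em_term K (a0 + h) (shift_log q n) (shift_log q (S n)))
      (em_sum K q (a0 + h)).
Proof.
intros hq HK.
(* From N on, |q + n| and Re (q + n) are at least 4, as the bound for em_term requires, and
   |q + N + n| >= n + 4 makes the series of squares converge. *)
destruct (nat_above (Cmod q + 4)) as [N HN].
destruct (wiener_em_term K a0) as [E [HE0 HE]].
set (A := Cmod a0 + 1) in *.
assert (HA : 0 <= A) by (unfold A; generalize (Cmod_ge_0 a0); lra).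
apply (wiener_sum_eventually 1
  (fun n h => em_term K (a0 + h) (shift_log q n) (shift_log q (S n))) N
  (fun n => E * exp (A * PI) * / INR (S n) ^ 2) (E * exp (A * PI) * 2)).
- lra.
- intros n. apply wiener_em_term_ex.
- intros n. set (w := (RtoC (INR (N + n)) + q)%C).
  assert (Hn0 := pos_INR n).
  assert (Hw1 : INR n + 4 <= Re w).
  { generalize (shift_Re_lower q (N + n)). fold w. rewrite plus_INR. lra. }
  assert (Hw2 : INR n + 4 <= Cmod w).
  { generalize (shift_Cmod_lower q (N + n)). fold w. rewrite plus_INR. lra. }
  assert (Hw0 : w <> 0%C) by now apply shift_neq_0.
  assert (Hx : Cmod (/ w) = / Cmod w) by now apply Cmod_inv.
  assert (Hx4 : Cmod (/ w) <= / 4).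
  { rewrite Hx. apply Rinv_le_contravar; lra. }
  assert (EL : shift_log q (N + n) = Clog w) by reflexivity.
  assert (EL' : shift_log q (S (N + n)) = (Clog w + log1p (/ w))%C).
  { rewrite <- Clog_succ by lra. unfold shift_log. f_equal. unfold w.
    rewrite S_INR, RtoC_plus. ring. }
  rewrite EL, EL'.
  apply wiener_le with (E * exp (A * Cmod (Clog w)) * Cmod (/ w) ^ S (S K)).
  2:{ apply HE; [|exact Hx4]. rewrite Cexp_Clog by exact Hw0. now field. }
  rewrite !Rmult_assoc. apply Rmult_le_compat_l; [exact HE0|].
  rewrite Hx.
  assert (Hln : 0 < ln (Cmod w)).
  { rewrite <- ln_1. apply ln_increasing; lra. }
  assert (H1 : exp (A * Cmod (Clog w)) <= exp (A * PI) * Cmod w ^ K).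
  { rewrite <- Rpower_pow by lra. unfold Rpower. rewrite <- exp_plus. apply exp_le.
    apply Rle_trans with (A * (ln (Cmod w) + PI)).
    - apply Rmult_le_compat_l; [exact HA | apply Cmod_Clog; lra].
    - assert (A * ln (Cmod w) <= INR K * ln (Cmod w)); [|lra].
      apply Rmult_le_compat_r; lra. }
  assert (Hpw : 0 < Cmod w ^ K) by (apply pow_lt; lra).
  apply Rle_trans with (exp (A * PI) * Cmod w ^ K * (/ Cmod w) ^ S (S K)).
  { apply Rmult_le_compat_r; [apply pow_le, Rlt_le, Rinv_0_lt_compat; lra | exact H1]. }
  replace (exp (A * PI) * Cmod w ^ K * (/ Cmod w) ^ S (S K))
    with (exp (A * PI) * / Cmod w ^ 2).
  2:{ rewrite pow_inv. simpl. field. repeat split; lra. }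
  apply Rmult_le_compat_l; [apply Rlt_le, exp_pos|].
  apply Rinv_le_contravar; [apply pow_lt, INR_S_pos|].
  apply pow_incr. rewrite S_INR. lra.
- apply bounded_sums_scal; [|apply bounded_sums_inv_sqr].
  apply Rmult_le_pos; [exact HE0 | apply Rlt_le, exp_pos].
Qed.

Lemma em_sum_series K q a : not_nonpos_int q -> Cmod a + 1 <= INR K ->
  Cseries (fun n => em_term K a (shift_log q n) (shift_log q (S n))) (em_sum K q a).
Proof.
intros hq HK. destruct (em_sum_regular K q a hq HK) as [_ H].
specialize (H 0%C). rewrite Cmod_0, Cplus_0_r in H. apply H. lra.
Qed.

(** |y^b| <= |y|^(Re b) exp (pi |b|) for the principal branch. *)
Lemma Cexp_shift_log_vanish q b : Re b < 0 -> Ccv (fun n => Cexp (b * shift_log q n)) 0%C.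
Proof.
intros Hb.
apply Ccv_squeeze with
  (fun n => exp (Re b * ln (Cmod (RtoC (INR n) + q)) + Cmod b * PI)).
- exists 0%nat. intros n _.
  replace (Cexp (b * shift_log q n) - 0)%C with (Cexp (b * shift_log q n)) by ring.
  rewrite Cmod_Cexp. apply exp_le. rewrite re_mult. unfold shift_log, Clog at 1.
  cbn [Re Im fst snd].
  assert (H1 := im_le_Cmod b). assert (H2 := Carg_bound (RtoC (INR n) + q)).
  assert (H3 : Rabs (Im b * Im (Clog (RtoC (INR n) + q))) <= Cmod b * PI).
  { rewrite Rabs_mult. apply Rmult_le_compat; try apply Rabs_pos; assumption. }
  apply Rabs_le_between in H3. unfold Re, Im in *. lra.
- assert (Hm : is_lim_seq (fun n => Cmod (RtoC (INR n) + q)) p_infty).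
  { apply is_lim_seq_le_p_loc with (fun n => INR n - Cmod q).
    - exists 0%nat. intros n _. apply shift_Cmod_lower.
    - apply is_lim_seq_minus with p_infty (Cmod q).
      + apply is_lim_seq_INR.
      + apply is_lim_seq_const.
      + reflexivity. }
  apply (is_lim_comp_seq exp _ m_infty 0).
  + apply is_lim_exp_m.
  + exists 0%nat. intros n _. discriminate.
  + apply is_lim_seq_plus with m_infty (Cmod b * PI).
    * assert (Hl : is_lim_seq (fun n => ln (Cmod (RtoC (INR n) + q))) p_infty).
      { apply (is_lim_comp_seq ln _ p_infty p_infty); [apply is_lim_ln_p| |exact Hm].
        exists 0%nat. intros n _. discriminate. }
      generalize (is_lim_seq_scal_l _ (Re b) _ Hl).
      replace (Rbar_mult (Re b) p_infty) with m_infty; [easy|].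
      symmetry. apply is_Rbar_mult_unique. apply is_Rbar_mult_sym.
      now apply is_Rbar_mult_p_infty_neg.
    * apply is_lim_seq_const.
    * reflexivity.
Qed.

Lemma bern_trunc_vanish K q a :
  Re a < 0 -> Ccv (fun n => bern_trunc K a (shift_log q n)) 0%C.
Proof.
intros Ha. unfold bern_trunc.
apply (Ccv_Csum (fun k n => RtoC (bernoulli k) * cbin a k *
   Cexp ((a - RtoC (INR k)) * shift_log q n))%C).
intros k _. replace (RtoC 0) with (RtoC (bernoulli k) * cbin a k * 0)%C by ring.
apply Ccv_scal. apply Cexp_shift_log_vanish.
unfold Cminus. rewrite re_plus, re_opp. simpl. generalize (pos_INR k). simpl. lra.
Qed.

Definition em_total (K : nat) (q a : C) : C :=
  (bern_trunc K a (shift_log q 0) + em_sum K q a)%C.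

(** The new term of bern_trunc changes the defects by a telescoping difference, whose sum
    is minus the value of that term at q. *)
Lemma em_total_step K q a : not_nonpos_int q -> Cmod a + 1 <= INR K ->
  em_total (S K) q a = em_total K q a.
Proof.
intros hq HK.
set (u := fun n => (RtoC (bernoulli (S K)) * cbin a (S K) *
   Cexp ((a - RtoC (INR (S K))) * shift_log q n))%C).
assert (Hu : Ccv u 0%C).
{ unfold u. replace (RtoC 0) with (RtoC (bernoulli (S K)) * cbin a (S K) * 0)%C by ring.
  apply Ccv_scal. apply Cexp_shift_log_vanish.
  unfold Cminus. rewrite re_plus, re_opp, S_INR.
  generalize (re_le_Cmod a). intros H. apply Rabs_le_between in H. simpl. simpl in H. lra. }
assert (H1 := em_sum_series K q a hq HK).
assert (H2 := em_sum_series (S K) q a hq ltac:(rewrite S_INR; lra)).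
assert (H3 := Cseries_plus _ _ _ _ H1 (Cseries_scal (-1) _ _ (Cseries_telescope u 0 Hu))).
assert (E : em_sum (S K) q a = (em_sum K q a + -1 * (u 0%nat - 0))%C).
{ apply Cseries_unique with (1 := H2). apply Cseries_ext with (2 := H3).
  intros n. unfold em_term, bern_trunc. rewrite !Csum_S. fold (u n) (u (S n)). ring. }
unfold em_total. rewrite E. unfold bern_trunc. rewrite Csum_S. fold (u 0%nat). ring.
Qed.

Lemma em_total_stable K K' q a : not_nonpos_int q -> Cmod a + 1 <= INR K -> (K <= K')%nat ->
  em_total K' q a = em_total K q a.
Proof.
intros hq HK H. induction H as [|K' H IH]; [reflexivity|].
rewrite em_total_step, IH; auto. apply le_INR in H. lra.
Qed.

Definition em_order (a : C) : nat := S (Z.to_nat (up (Cmod a))).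

Lemma em_order_spec a : Cmod a + 1 <= INR (em_order a).
Proof.
unfold em_order. rewrite S_INR.
assert (H := archimed (Cmod a)). assert (H0 := Cmod_ge_0 a).
rewrite INR_IZR_INZ, Z2Nat.id; [lra|]. apply le_IZR. lra.
Qed.

(** The function a |-> - a zeta (1 - a, q), an entire interpolation of the Bernoulli
    polynomials.  Its value is the same for every admissible order K, so the dependence of the
    order on a does not spoil analyticity. *)
Definition gen_bernoulli (q a : C) : C := em_total (em_order a) q a.

Lemma gen_bernoulli_eq K q a : not_nonpos_int q -> Cmod a + 1 <= INR K ->
  gen_bernoulli q a = em_total K q a.
Proof.
intros hq HK. unfold gen_bernoulli.
assert (H := em_order_spec a).
rewrite <- (em_total_stable K (Nat.max K (em_order a)) q a hq HK) by lia.
symmetry. apply em_total_stable; [exact hq | exact H | lia].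
Qed.

Lemma gen_bernoulli_wiener q a0 : not_nonpos_int q ->
  exists M, wiener 1 M (fun h => gen_bernoulli q (a0 + h)).
Proof.
(* One order K serves the whole disc of radius 1 around a0. *)
intros hq. set (K := S (em_order a0)).
assert (HK : Cmod a0 + 2 <= INR K).
{ unfold K. rewrite S_INR. generalize (em_order_spec a0). lra. }
destruct (em_sum_regular K q a0 hq ltac:(lra)) as [[M HM] _].
destruct (wiener_bern_trunc K a0 (shift_log q 0)) as [M' HM'].
exists (M' + M). apply wiener_ext with
  (fun h => bern_trunc K (a0 + h) (shift_log q 0) + em_sum K q (a0 + h))%C.
- intros h Hh. symmetry. apply (gen_bernoulli_eq K); [exact hq|].
  generalize (Cmod_triangle a0 h). lra.
- apply wiener_plus; [lra | exact HM' | exact HM].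
Qed.

(** All the defects vanish at a = m. *)
Lemma gen_bernoulli_nat q m : not_nonpos_int q ->
  gen_bernoulli q (RtoC (INR m)) = bernoulli_poly m q.
Proof.
intros hq.
rewrite (gen_bernoulli_eq (S m)); [|exact hq|].
2:{ rewrite Cmod_R, Rabs_pos_eq, S_INR by apply pos_INR. lra. }
unfold em_total. replace (em_sum (S m) q (RtoC (INR m))) with (RtoC 0).
2:{ symmetry. apply Cseries_correct. apply Cseries_zero. intros n.
    assert (Hw := shift_neq_0 q n hq). assert (Hw' := shift_neq_0 q (S n) hq).
    apply em_term_nat with (/ (RtoC (INR n) + q))%C; [| |lia];
      unfold shift_log; rewrite !Cexp_Clog by assumption; [now field|].
    rewrite S_INR, RtoC_plus. now field. }
rewrite Cplus_0_r. unfold bern_trunc. rewrite Csum_S, cbin_zero by lia.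
rewrite Cmult_0_r, Cmult_0_l, Cplus_0_r.
unfold bernoulli_poly. apply Csum_ext_loc. intros k Hk.
rewrite cbin_Binomial by exact Hk.
rewrite <- RtoC_minus, <- minus_INR, Cexp_INR by exact Hk.
unfold shift_log. rewrite Cexp_Clog by now apply shift_neq_0.
change (INR 0) with 0. rewrite Cplus_0_l, RtoC_mult. f_equal. apply Cmult_comm.
Qed.

(** The truncated polynomials at q + n tend to 0, so the sum of their differences cancels
    bern_trunc at q and leaves the sum of the terms - a (q + n)^(a-1). *)
Lemma gen_bernoulli_series q a : not_nonpos_int q -> Re a < 0 ->
  Cseries (fun n => - a * Cexp ((a - 1) * shift_log q n))%C (gen_bernoulli q a).
Proof.
intros hq Ha. unfold gen_bernoulli, em_total.
set (K := em_order a).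
assert (H := Cseries_plus _ _ _ _ (Cseries_telescope _ _ (bern_trunc_vanish K q a Ha))
  (em_sum_series K q a hq (em_order_spec a))).
replace (bern_trunc K a (shift_log q 0) + em_sum K q a)%C
  with (bern_trunc K a (shift_log q 0) - 0 + em_sum K q a)%C by ring.
apply Cseries_ext with (2 := H). intros n. unfold em_term. ring.
Qed.

(** * The Hurwitz zeta function *)

Definition zeta_ext (q s : C) : C := (gen_bernoulli q (1 - s) / (s - 1))%C.

Lemma wiener_opp rho M f : wiener rho M f -> wiener rho M (fun h => f (- h)%C).
Proof.
intros [a [Ha Hf]]. exists (fun k => (-1) ^ k * a k)%C. split.
- apply bounded_sums_le with (2 := Ha). intros k.
  rewrite Cmod_mult, Cmod_pow. replace (Cmod (-1)) with 1.
  + rewrite pow1, Rmult_1_l. apply Rle_refl.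
  + rewrite Cmod_R, Rabs_left1; lra.
- intros h Hh. rewrite <- Cmod_opp in Hh.
  apply Cseries_ext with (2 := Hf _ Hh). intros k.
  replace (- h)%C with (-1 * h)%C by ring. rewrite Cpow_mult_l. ring.
Qed.

(** The geometric series; its remainders are the terms u k of the telescoping sum below. *)
Lemma wiener_inv rho c : 0 <= rho -> rho < Cmod c ->
  exists M, wiener rho M (fun h => / (c + h))%C.
Proof.
intros Hr Hc.
assert (Hc0 : c <> 0%C) by (apply Cmod_gt_0; lra).
exists (/ Cmod c * / (1 - rho / Cmod c)). exists (fun k => / c * (- / c) ^ k)%C. split.
- apply bounded_sums_le with (fun k => / Cmod c * (rho / Cmod c) ^ k).
  + intros k. rewrite Cmod_mult, Cmod_pow, Cmod_opp, Cmod_inv by exact Hc0.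
    unfold Rdiv. rewrite Rpow_mult_distr. apply Req_le. ring.
  + apply bounded_sums_geom.
    * apply Rlt_le, Rinv_0_lt_compat; lra.
    * split; [apply Rmult_le_pos; [exact Hr | apply Rlt_le, Rinv_0_lt_compat; lra]|].
      apply Rmult_lt_reg_r with (Cmod c); [lra|].
      unfold Rdiv. rewrite Rmult_assoc, Rinv_l by lra. lra.
- intros h Hh.
  assert (Hn : (c + h)%C <> 0%C).
  { intros E. assert (Cmod c = Cmod h); [|lra].
    replace c with (- h)%C; [apply Cmod_opp|].
    rewrite <- (Cplus_0_l (- h)), <- E. ring. }
  set (u := fun k => (((- / c) * h) ^ k * / (c + h))%C).
  assert (Hu : Ccv u 0%C).
  { apply Ccv_squeeze with (fun k => (Cmod h / Cmod c) ^ k * Cmod (/ (c + h))).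
    - exists 0%nat. intros k _. unfold u.
      rewrite <- (Cmod_opp (_ - _)). apply Req_le.
      rewrite Cmod_opp. replace ((- / c * h) ^ k * / (c + h) - 0)%C
        with ((- / c * h) ^ k * / (c + h))%C by ring.
      rewrite !Cmod_mult, Cmod_pow, Cmod_mult, Cmod_opp, (Cmod_inv c) by exact Hc0.
      unfold Rdiv. now rewrite (Rmult_comm (Cmod h)).
    - replace (Finite 0) with (Rbar_mult 0 (Cmod (/ (c + h)))) by (simpl; f_equal; ring).
      apply (is_lim_seq_scal_r _ (Cmod (/ (c + h))) 0). apply is_lim_seq_geom.
      assert (H0 := Cmod_ge_0 h).
      rewrite Rabs_pos_eq.
      + apply Rmult_lt_reg_r with (Cmod c); [lra|].
        unfold Rdiv. rewrite Rmult_assoc, Rinv_l by lra. lra.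
      + apply Rmult_le_pos; [exact H0 | apply Rlt_le, Rinv_0_lt_compat; lra]. }
  generalize (Cseries_telescope u 0 Hu).
  replace (u 0%nat - 0)%C with (/ (c + h))%C by (unfold u; simpl; ring).
  apply Cseries_ext. intros k. unfold u. rewrite Cpow_S, !Cpow_mult_l.
  field. now split.
Qed.

Lemma zeta_ext_wiener q (s0 : C) : not_nonpos_int q -> s0 <> 1%C ->
  exists rho M, 0 < rho /\ wiener rho M (fun h => zeta_ext q (s0 + h)).
Proof.
intros hq Hs.
assert (Hp : 0 < Cmod (s0 - 1)).
{ apply Cmod_gt_0. now apply Cminus_eq_contra. }
(* The factor 1 / (s - 1) limits the radius to less than the distance to the pole. *)
set (rho := Rmin 1 (Cmod (s0 - 1) / 2)).
assert (Hr : 0 < rho) by (apply Rmin_pos; lra).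
assert (Hr1 : rho <= 1) by apply Rmin_l.
assert (Hr2 : rho < Cmod (s0 - 1)) by (generalize (Rmin_r 1 (Cmod (s0 - 1) / 2)); fold rho; lra).
destruct (gen_bernoulli_wiener q (1 - s0) hq) as [M HM].
destruct (wiener_inv rho (s0 - 1) ltac:(lra) Hr2) as [M' HM'].
exists rho, (M * M'). split; [exact Hr|].
apply wiener_ext with (fun h => gen_bernoulli q ((1 - s0) + - h) * / ((s0 - 1) + h))%C.
- intros h _. unfold zeta_ext, Cdiv. f_equal; f_equal; ring.
- apply wiener_mult; [exact Hr | | exact HM'].
  apply (wiener_opp rho M (fun h => gen_bernoulli q ((1 - s0) + h))).
  apply wiener_shrink with 1; [lra | exact HM].
Qed.

(** At s = 1 the residue is the Bernoulli polynomial of degree 0, and the regular part is the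
    quotient of gen_bernoulli q (1 - s) - 1 by s - 1. *)
Lemma zeta_ext_hurwitz q : not_nonpos_int q -> is_hurwitz_zeta q (zeta_ext q).
Proof.
intros hq. split; [|split].
- intros s Hs.
  assert (Ha : Re (1 - s) < 0) by (unfold Cminus; rewrite re_plus, re_opp; simpl; lra).
  assert (Hs1 : (s - 1)%C <> 0%C).
  { apply Cminus_eq_contra. intros E. rewrite E in Hs. simpl in Hs. lra. }
  assert (H := Cseries_scal (/ (s - 1))%C _ _ (gen_bernoulli_series q _ hq Ha)).
  unfold zeta_ext, Cdiv. rewrite Cmult_comm.
  apply Cseries_ext with (2 := H). intros n. unfold Cpower, shift_log.
  replace (1 - s - 1)%C with (- s)%C by ring. now field.
- intros s Hs. destruct (zeta_ext_wiener q s hq Hs) as [rho [M [Hr HW]]].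
  now apply wiener_analytic with rho M.
- destruct (gen_bernoulli_wiener q 0 hq) as [M HM].
  apply wiener_opp in HM. destruct HM as [a Ha].
  destruct (wiener_coef_shift 1 M a _ Rlt_0_1 Ha) as [g [Hg Hfg]].
  exists (fun s => g (s - 1)%C). split.
  + apply wiener_analytic with 1 (M / 1); [lra|].
    exists (fun k => a (S k)).
    split; [apply Hg|]. intros h Hh. replace (1 + h - 1)%C with h by ring. now apply Hg.
  + apply locally_Cmod. exists 1. split; [lra|]. intros s Hs Hs1.
    assert (Hs1' : (s - 1)%C <> 0%C) by now apply Cminus_eq_contra.
    assert (Ha0 : a 0%nat = 1%C).
    { generalize (Hfg 0%C). rewrite Cmod_0. intros H. specialize (H ltac:(lra)).
      replace (0 + - 0)%C with (RtoC (INR 0)) in H by (simpl; ring).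
      rewrite gen_bernoulli_nat in H by exact hq.
      unfold bernoulli_poly in H.
      assert (E : a 0%nat = Csum (fun k => RtoC (Binomial.C 0 k * bernoulli k) * q ^ (0 - k))%C 0).
      { unfold Csum. rewrite H. ring. }
      rewrite E, Csum_0. unfold Binomial.C. simpl. change (bernoulli 0) with 1.
      replace (1 / (1 * 1) * 1) with 1 by field. ring. }
    unfold zeta_ext. replace (1 - s)%C with (0 + - (s - 1))%C by ring.
    rewrite Hfg, Ha0 by lra. now field.
Qed.

Lemma hurwitz_zeta_spec q : not_nonpos_int q -> is_hurwitz_zeta q (fun s => hurwitz_zeta s q).
Proof.
intros hq. unfold hurwitz_zeta.
apply (epsilon_spec (inhabits (fun _ : C => RtoC 0)) (is_hurwitz_zeta q)).
exists (zeta_ext q). now apply zeta_ext_hurwitz.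
Qed.

(** Z is compared with zeta_ext along the segment from 1 - m to 2 + i.  It meets the real
    axis only at 1 - m, hence avoids the pole, and near its other end both functions are the
    sum of the same series. *)
Lemma is_hurwitz_zeta_nat q Z m : not_nonpos_int q -> (1 <= m)%nat -> is_hurwitz_zeta q Z ->
  Z (1 - RtoC (INR m))%C = (- (bernoulli_poly m q / RtoC (INR m)))%C.
Proof.
intros hq Hm HZ. set (p := (1 - RtoC (INR m))%C).
assert (Hm1 : 1 <= INR m) by (apply (le_INR 1); exact Hm).
assert (Hz : zeta_ext q p = (- (bernoulli_poly m q / RtoC (INR m)))%C).
{ unfold zeta_ext, p. replace (1 - (1 - RtoC (INR m)))%C with (RtoC (INR m)) by ring.
  rewrite gen_bernoulli_nat by exact hq. field.
  assert (RtoC (INR m) <> 0%C) by (intros E; apply RtoC_inj in E; lra).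
  split; [assumption|]. intros E. apply H. replace (RtoC (INR m)) with (- (1 - RtoC (INR m) - 1))%C by ring.
  rewrite E. ring. }
rewrite <- Hz.
(* Re (p + t v) > 1 exactly when t > m / (m + 1). *)
set (v := (RtoC (INR m + 1) + Ci)%C).
assert (HD : (Z p - zeta_ext q p)%C = 0%C).
{ apply (segment_identity (fun s => Z s - zeta_ext q s)%C p v (INR m / (INR m + 1))).
  - intros E. apply (f_equal Im) in E. unfold v in E. rewrite im_plus in E. simpl in E. lra.
  - apply Rmult_lt_reg_r with (INR m + 1); [lra|].
    unfold Rdiv. rewrite Rmult_assoc, Rinv_l by lra. lra.
  - intros t Ht.
    assert (Hs : (p + RtoC t * v)%C <> 1%C).
    { intros E. assert (Ht0 : t = 0).
      { apply (f_equal Im) in E. unfold p, v in E.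
        unfold Cminus in E. rewrite !im_plus, im_opp, im_scal_l, im_plus in E. simpl in E. lra. }
      apply (f_equal Re) in E. unfold p, v in E. rewrite Ht0 in E.
      unfold Cminus in E. rewrite !re_plus, re_opp, re_scal_l in E. simpl in E. lra. }
    destruct HZ as [_ [Han _]].
    destruct (analytic_wiener Z _ (Han _ Hs)) as [r1 [M1 [Hr1 HW1]]].
    destruct (zeta_ext_wiener q _ hq Hs) as [r2 [M2 [Hr2 HW2]]].
    assert (Hr : 0 < Rmin r1 r2) by now apply Rmin_pos.
    exists (Rmin r1 r2), (M1 + Cmod (-1) * M2). split; [exact Hr|].
    apply wiener_ext with
      (fun h => Z (p + RtoC t * v + h) + -1 * zeta_ext q (p + RtoC t * v + h))%C.
    { intros h _. ring. }
    apply wiener_plus; [lra | | apply wiener_scal].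
    + apply wiener_shrink with r1; [|exact HW1]. split; [lra | apply Rmin_l].
    + apply wiener_shrink with r2; [|exact HW2]. split; [lra | apply Rmin_r].
  - intros t Ht.
    assert (Hre : 1 < Re (p + RtoC t * v)%C).
    { unfold p, v, Cminus. rewrite !re_plus, re_opp, re_scal_l, re_plus. simpl.
      assert (H : INR m < t * (INR m + 1)); [|lra].
      apply Rmult_lt_reg_r with (/ (INR m + 1)); [apply Rinv_0_lt_compat; lra|].
      rewrite Rmult_assoc, Rinv_r, Rmult_1_r by lra. apply Ht. }
    assert (H1 := proj1 HZ _ Hre).
    assert (H2 := proj1 (zeta_ext_hurwitz q hq) _ Hre).
    rewrite (Cseries_unique _ _ _ H1 H2). ring. }
apply Ceq_minus. exact HD.
Qed.

(** * Euler constant and the Gamma function near positive integers *)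

Lemma Ccv_Cexp (u : nat -> C) a : Ccv u a -> Ccv (fun n => Cexp (u n)) (Cexp a).
Proof.
intros Hu. assert (H1 := Ccv_Re _ _ Hu). assert (H2 := Ccv_Im _ _ Hu).
assert (He : is_lim_seq (fun n => exp (Re (u n))) (exp (Re a))).
{ apply is_lim_seq_continuous; [|exact H1]. apply derivable_continuous_pt, derivable_pt_exp. }
apply Ccv_pair; unfold Cexp; simpl; apply is_lim_seq_mult'; try exact He.
- apply (is_lim_seq_continuous cos); [|exact H2]. apply continuity_cos.
- apply (is_lim_seq_continuous sin); [|exact H2]. apply continuity_sin.
Qed.

Lemma C_lim_seq_Ccv (u : nat -> C) l : Ccv u l -> C_lim_seq u = l.
Proof.
intros Hu. unfold C_lim_seq.
rewrite (is_lim_seq_unique _ _ (Ccv_Re _ _ Hu)), (is_lim_seq_unique _ _ (Ccv_Im _ _ Hu)).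
now destruct l.
Qed.

Lemma Clog_RtoC r : 0 < r -> Clog (RtoC r) = RtoC (ln r).
Proof.
intros Hr. unfold Clog, Carg. rewrite Cmod_R, Rabs_pos_eq by lra. simpl.
destruct (Rle_dec 0 0) as [_|H]; [|lra].
unfold Rdiv. rewrite Rinv_r, acos_1 by lra. reflexivity.
Qed.

Lemma harmonic_S n : harmonic (S n) = harmonic n + / INR (S n).
Proof. unfold harmonic. rewrite sum_n_Sm by lia. reflexivity. Qed.

Lemma ln_le_pred y : 0 < y -> ln y <= y - 1.
Proof. intros Hy. generalize (exp_ineq1_le (ln y)). rewrite exp_ln by exact Hy. lra. Qed.

Lemma ln_INR_S_upper n : ln (INR (S (S n))) - ln (INR (S n)) <= / INR (S n).
Proof.
assert (Hp := INR_S_pos n). assert (Hp' := INR_S_pos (S n)).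
rewrite <- ln_div by assumption.
eapply Rle_trans; [apply ln_le_pred; now apply Rdiv_lt_0_compat|].
apply Req_le. rewrite (S_INR (S n)). field. lra.
Qed.

Lemma ln_INR_S_lower n : / INR (S (S n)) <= ln (INR (S (S n))) - ln (INR (S n)).
Proof.
assert (Hp := INR_S_pos n). assert (Hp' := INR_S_pos (S n)).
assert (H : ln (INR (S n) / INR (S (S n))) <= INR (S n) / INR (S (S n)) - 1).
{ apply ln_le_pred. now apply Rdiv_lt_0_compat. }
rewrite ln_div in H by assumption.
replace (INR (S n) / INR (S (S n)) - 1) with (- / INR (S (S n))) in H; [lra|].
rewrite (S_INR (S n)) in *. field. lra.
Qed.

(** By 1 / (n + 2) <= ln (n + 2) - ln (n + 1) <= 1 / (n + 1), the sequence decreases and is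
    nonnegative from n = 1 on. *)
Lemma euler_gamma_lim : is_lim_seq (fun n => harmonic n - ln (INR n)) euler_gamma.
Proof.
unfold euler_gamma. apply Lim_seq_correct'.
destruct (ex_finite_lim_seq_decr (fun n => harmonic (S n) - ln (INR (S n))) 0) as [l Hl].
- intros n. rewrite (harmonic_S (S n)). generalize (ln_INR_S_lower n). lra.
- intros n.
  assert (H : forall k, ln (INR (S k)) <= harmonic k).
  { induction k as [|k IH].
    - unfold harmonic. rewrite sum_n_m_zero by lia. simpl. rewrite ln_1. apply Rle_refl.
    - rewrite harmonic_S. generalize (ln_INR_S_upper k). lra. }
  rewrite harmonic_S. generalize (H n) (Rinv_0_lt_compat _ (INR_S_pos n)). lra.
- exists l. now apply is_lim_seq_incr_1.
Qed.

Lemma lim_ratio m : is_lim_seq (fun n => INR n / INR (m + n)) 1.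
Proof.
apply is_lim_seq_ext_loc with (fun n => 1 - INR m * / INR (m + n)).
{ exists 1%nat. intros n Hn. rewrite plus_INR.
  assert (1 <= INR n) by (apply (le_INR 1); exact Hn). generalize (pos_INR m); intros.
  field. lra. }
replace (Finite 1) with (Finite (1 - INR m * 0)) by (f_equal; ring).
apply is_lim_seq_minus'; [apply is_lim_seq_const|].
apply (is_lim_seq_scal_l _ (INR m) 0).
replace (Finite 0) with (Rbar_inv p_infty) by reflexivity.
apply is_lim_seq_inv; [|discriminate].
apply is_lim_seq_le_p_loc with INR; [|apply is_lim_seq_INR].
exists 0%nat. intros n _. apply le_INR. lia.
Qed.

Lemma lim_fact_ratio m :
  is_lim_seq (fun n => INR (fact n) * INR n ^ m / INR (fact (m + n))) 1.
Proof.
induction m as [|m IH].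
- apply is_lim_seq_ext with (fun _ => 1); [|apply is_lim_seq_const].
  intros n. simpl. field. apply INR_fact_neq_0.
- apply is_lim_seq_ext with
    (fun n => INR (fact n) * INR n ^ m / INR (fact (m + n)) * (INR n / INR (S m + n))).
  + intros n. change (S m + n)%nat with (S (m + n)). rewrite (fact_simpl (m + n)), mult_INR.
    simpl pow. field. split; [apply INR_fact_neq_0 | apply Rgt_not_eq, INR_S_pos].
  + replace (Finite 1) with (Finite (1 * 1)) by (f_equal; ring).
    apply is_lim_seq_mult'; [exact IH | apply lim_ratio].
Qed.

Lemma lim_harmonic_shift m :
  is_lim_seq (fun n => harmonic (m + n) - ln (INR n)) euler_gamma.
Proof.
apply is_lim_seq_ext_loc with
  (fun n => (harmonic (m + n) - ln (INR (m + n))) - ln (INR n / INR (m + n))).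
{ exists 1%nat. intros n Hn.
  assert (1 <= INR n) by (apply (le_INR 1); exact Hn).
  assert (1 <= INR (m + n)) by (apply (le_INR 1); lia).
  rewrite ln_div by lra. ring. }
replace (Finite euler_gamma) with (Finite (euler_gamma - ln 1))
  by (f_equal; rewrite ln_1; ring).
apply is_lim_seq_minus'.
- assert (H : forall (u : nat -> R) l k, is_lim_seq u l -> is_lim_seq (fun n => u (k + n)%nat) l).
  { intros u l k H. apply (is_lim_seq_incr_n u k) in H.
    apply is_lim_seq_ext with (2 := H). intros n. f_equal. lia. }
  apply (H (fun n => harmonic n - ln (INR n))). apply euler_gamma_lim.
- apply is_lim_seq_continuous; [|apply lim_ratio].
  apply derivable_continuous_pt. exists (/ 1). apply derivable_pt_lim_ln. lra.
Qed.

Lemma rising_fact m n :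
  rising (RtoC (INR (S m))) n = RtoC (INR (fact (S m + n)) / INR (fact m)).
Proof.
assert (Hf := INR_fact_neq_0 m).
induction n as [|n IH].
- cbn [rising]. f_equal. rewrite Nat.add_0_r, fact_simpl, mult_INR. now field.
- cbn [rising]. rewrite IH. rewrite <- RtoC_plus, <- RtoC_mult. f_equal.
  replace (S m + S n)%nat with (S (S m + n)) by lia.
  rewrite (fact_simpl (S m + n)), mult_INR.
  replace (INR (S (S m + n))) with (INR (S m) + INR (S n)); [now field|].
  rewrite <- plus_INR. f_equal. lia.
Qed.

Lemma Csum_inv_harmonic m n :
  Csum (fun j => RtoC (/ INR (S m + j))) n = RtoC (harmonic (S m + n) - harmonic m).
Proof.
rewrite Csum_RtoC. f_equal. induction n as [|n IH].
- rewrite sum_O, Nat.add_0_r, harmonic_S.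
  change (/ INR (S m) = harmonic m + / INR (S m) - harmonic m). ring.
- rewrite sum_Sn, IH.
  replace (S m + S n)%nat with (S (S m + n)) by lia. rewrite harmonic_S.
  change (harmonic (S m + n) - harmonic m + / INR (S (S m + n)) =
    harmonic (S m + n) + / INR (S (S m + n)) - harmonic m). ring.
Qed.

(** The quantity x for which the j-th factor m + 1 + d + j of the rising product is
    (m + 1 + j) (1 + x). *)
Definition weierstrass_arg (m : nat) (d : C) (j : nat) : C := (d * RtoC (/ INR (S m + j)))%C.

Lemma weierstrass_arg_bound m d j : Cmod (weierstrass_arg m d j) <= Cmod d * / INR (S j).
Proof.
unfold weierstrass_arg. rewrite Cmod_mult, Cmod_R.
rewrite Rabs_pos_eq by (apply Rlt_le, Rinv_0_lt_compat; apply (INR_S_pos (m + j))).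
apply Rmult_le_compat_l; [apply Cmod_ge_0|].
apply Rinv_le_contravar; [apply INR_S_pos | apply le_INR; lia].
Qed.

Lemma weierstrass_arg_half m d j : Cmod d <= / 2 -> Cmod (weierstrass_arg m d j) <= / 2.
Proof.
intros Hd. eapply Rle_trans; [apply weierstrass_arg_bound|].
assert (H : / INR (S j) <= 1).
{ rewrite <- Rinv_1. apply Rinv_le_contravar; [lra|]. rewrite S_INR. generalize (pos_INR j); lra. }
assert (0 < / INR (S j)) by (apply Rinv_0_lt_compat, INR_S_pos).
generalize (Cmod_ge_0 d). nra.
Qed.

Lemma rising_exp m d n : Cmod d <= / 2 ->
  rising (RtoC (INR (S m)) + d) n =
  (rising (RtoC (INR (S m))) n *
   Cexp (Csum (fun j => log1p (weierstrass_arg m d j)) n))%C.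
Proof.
intros Hd.
assert (Hstep : forall j, (RtoC (INR (S m)) + d + RtoC (INR j))%C =
  ((RtoC (INR (S m)) + RtoC (INR j)) * Cexp (log1p (weierstrass_arg m d j)))%C).
{ intros j. assert (H := weierstrass_arg_half m d j Hd).
  rewrite Cexp_log1p by lra. unfold weierstrass_arg.
  assert (Hn : RtoC (INR (S m + j)) <> 0%C) by apply (INR_S_neq (m + j)).
  rewrite RtoC_inv by (apply Rgt_not_eq, (INR_S_pos (m + j))).
  rewrite plus_INR, RtoC_plus in *. now field. }
induction n as [|n IH].
- cbn [rising]. rewrite Csum_0. assert (H := Hstep 0%nat). change (INR 0) with 0 in H.
  rewrite !Cplus_0_r in H. exact H.
- cbn [rising]. rewrite Csum_S, IH, Cexp_plus, Hstep. ring.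
Qed.

(** In the Euler product, log (1 + x) is split into x and a quadratic remainder.  The linear
    parts sum to d times a difference of harmonic numbers, which combines with n^d and tends to
    d (gamma - H_m); the remainders form an absolutely convergent series, of sum O(|d|^2). *)
Lemma Gamma_near m d : Cmod d <= / 2 ->
  exists S, Cmod S <= Cmod d ^ 2 * 2 /\
    Gamma (RtoC (INR (Datatypes.S m)) + d) =
    (RtoC (INR (fact m)) * Cexp (d * RtoC (harmonic m - euler_gamma) - S))%C.
Proof.
intros Hd.
destruct (dominated_series
  (fun j => log1p (weierstrass_arg m d j) - weierstrass_arg m d j)%C
  (fun j => Cmod d ^ 2 * / INR (S j) ^ 2) (Cmod d ^ 2 * 2)) as [T [HT HTb]].
{ intros j. eapply Rle_trans; [apply log1p_approx; now apply weierstrass_arg_half|].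
  rewrite <- pow_inv, <- Rpow_mult_distr. apply pow_incr.
  split; [apply Cmod_ge_0 | apply weierstrass_arg_bound]. }
{ apply bounded_sums_scal; [apply pow_le, Cmod_ge_0 | apply bounded_sums_inv_sqr]. }
exists T. split; [exact HTb|].
unfold Gamma. apply C_lim_seq_Ccv.
apply Ccv_ext_loc with (fun n =>
  RtoC (INR (fact m)) * (RtoC (INR (fact n) * INR n ^ (S m) / INR (fact (S m + n))) *
   Cexp ((d * RtoC (harmonic m - (harmonic (S m + n) - ln (INR n))))
     - Csum (fun j => log1p (weierstrass_arg m d j) - weierstrass_arg m d j)%C n)))%C.
- exists 1%nat. intros n Hn.
  assert (Hn1 : 1 <= INR n) by (apply (le_INR 1); exact Hn).
  rewrite rising_exp, rising_fact by exact Hd.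
  unfold Cpower. rewrite Clog_RtoC by lra.
  assert (E : Csum (fun j => log1p (weierstrass_arg m d j)) n =
    (Csum (fun j => log1p (weierstrass_arg m d j) - weierstrass_arg m d j)%C n
     + d * RtoC (harmonic (S m + n) - harmonic m))%C).
  { rewrite <- Csum_inv_harmonic, <- Csum_scal, <- Csum_plus.
    apply Csum_ext. intros j. unfold weierstrass_arg. ring. }
  rewrite E. set (s := Csum (fun j => log1p (weierstrass_arg m d j) - weierstrass_arg m d j)%C n).
  assert (Hpow : Cexp (RtoC (INR (S m)) * RtoC (ln (INR n))) = RtoC (INR n ^ S m)).
  { rewrite Cexp_INR, RtoC_pow. f_equal.
    rewrite <- Clog_RtoC by lra. apply Cexp_Clog. intros H. apply RtoC_inj in H. lra. }
  assert (Hf1 : INR (fact m) <> 0) by apply INR_fact_neq_0.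
  assert (Hf2 : INR (fact (S m + n)) <> 0) by apply INR_fact_neq_0.
  assert (Hf1' : RtoC (INR (fact m)) <> 0%C) by apply INR_fact_neq.
  assert (Hf2' : RtoC (INR (fact (S m + n))) <> 0%C) by apply INR_fact_neq.
  rewrite !RtoC_div by assumption.
  rewrite RtoC_mult.
  replace ((RtoC (INR (S m)) + d) * RtoC (ln (INR n)))%C
    with (RtoC (INR (S m)) * RtoC (ln (INR n)) + d * RtoC (ln (INR n)))%C by ring.
  rewrite Cexp_plus, Hpow.
  replace (d * RtoC (harmonic m - (harmonic (S m + n) - ln (INR n))) - s)%C
    with (d * RtoC (ln (INR n)) - (s + d * RtoC (harmonic (S m + n) - harmonic m)))%C
    by (rewrite !RtoC_minus; ring).
  rewrite Cexp_minus. field. repeat split; try assumption. apply Cexp_neq_0.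
- apply Ccv_scal.
  replace (Cexp (d * RtoC (harmonic m - euler_gamma) - T))
    with (RtoC 1 * Cexp (d * RtoC (harmonic m - euler_gamma) - T))%C by ring.
  apply Ccv_mult.
  + apply Ccv_RtoC. apply lim_fact_ratio.
  + apply Ccv_Cexp. apply Ccv_minus.
    * apply Ccv_scal. apply Ccv_RtoC. apply is_lim_seq_minus'.
      -- apply is_lim_seq_const.
      -- apply lim_harmonic_shift.
    * now apply Cseries_Ccv.
Qed.

(** Two divisions by the variable in the weighted algebra of radius 1, where exp has norm
    exp 1. *)
Lemma Cexp_second_order z : Cmod z <= 1 -> Cmod (Cexp z - 1 - z) <= exp 1 * Cmod z ^ 2.
Proof.
intros Hz.
destruct (wiener_coef_shift 1 _ _ _ Rlt_0_1 (wiener_coef_exp 1 1 Rle_0_1)) as [g [Hg Hfg]].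
destruct (wiener_coef_shift 1 _ _ g Rlt_0_1 Hg) as [g2 [Hg2 Hgg]].
assert (Hb : Cmod (g2 z) <= exp 1).
{ eapply Rle_trans; [apply (wiener_bound 1 _ g2 z); [eexists; exact Hg2 | exact Hz]|].
  apply Req_le. rewrite Cmod_1. unfold Rdiv. rewrite Rinv_1, !Rmult_1_r. reflexivity. }
assert (H := Hfg z Hz). rewrite Hgg, Cmult_1_l in H by exact Hz. rewrite H.
replace (exp_coef 1 0 + z * (exp_coef 1 1 + z * g2 z) - 1 - z)%C with (g2 z * z ^ 2)%C.
2:{ unfold exp_coef. simpl. field. }
rewrite Cmod_mult, Cmod_pow. apply Rmult_le_compat_r; [apply pow_le, Cmod_ge_0 | exact Hb].
Qed.

Lemma first_order_Cexp_scal c z :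
  first_order (fun w => Cexp (c * w)) z (c * Cexp (c * z))%C.
Proof.
assert (Hc := Cmod_ge_0 c). assert (Hp : 0 < / (Cmod c + 1)) by (apply Rinv_0_lt_compat; lra).
exists (Cmod (Cexp (c * z)) * (exp 1 * Cmod c ^ 2)), (/ (Cmod c + 1)).
split; [exact Hp|]. split.
{ apply Rmult_le_pos; [apply Cmod_ge_0|].
  apply Rmult_le_pos; [apply Rlt_le, exp_pos | apply pow_le, Hc]. }
intros h Hh.
assert (Hch : Cmod (c * h) <= 1).
{ rewrite Cmod_mult. apply Rle_trans with ((Cmod c + 1) * / (Cmod c + 1)).
  - apply Rmult_le_compat; try apply Cmod_ge_0; lra.
  - rewrite Rinv_r by lra. apply Rle_refl. }
replace (c * (z + h))%C with (c * z + c * h)%C by ring. rewrite Cexp_plus.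
replace (Cexp (c * z) * Cexp (c * h) - Cexp (c * z) - c * Cexp (c * z) * h)%C
  with (Cexp (c * z) * (Cexp (c * h) - 1 - c * h))%C by ring.
rewrite Cmod_mult, Rmult_assoc. apply Rmult_le_compat_l; [apply Cmod_ge_0|].
eapply Rle_trans; [now apply Cexp_second_order|].
rewrite Cmod_mult, Rpow_mult_distr. apply Req_le. ring.
Qed.

Lemma first_order_inv_Gamma m :
  first_order (fun w => / Gamma (- w))%C (- RtoC (INR (S m)))
    (RtoC (harmonic m - euler_gamma) / RtoC (INR (fact m)))%C.
Proof.
set (c := RtoC (harmonic m - euler_gamma)).
assert (Hc := Cmod_ge_0 c).
assert (Hf : RtoC (INR (fact m)) <> 0%C) by apply INR_fact_neq.
assert (Hfp := proj1 (Cmod_gt_0 _) Hf).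
set (r := Rmin (/ 2) (/ (Cmod c + 1))).
assert (Hr : 0 < r) by (apply Rmin_pos; [lra | apply Rinv_0_lt_compat; lra]).
assert (Hr1 : r <= / 2) by apply Rmin_l.
assert (Hr2 : r <= / (Cmod c + 1)) by apply Rmin_r.
assert (Hval : forall h, Cmod h < r -> exists S, Cmod S <= Cmod h ^ 2 * 2 /\
  (/ Gamma (- (- RtoC (INR (Datatypes.S m)) + h)))%C =
  (/ RtoC (INR (fact m)) * Cexp (c * h + S))%C).
{ intros h Hh.
  destruct (Gamma_near m (- h)) as [T [HT HG]]; [rewrite Cmod_opp; lra|].
  exists T. rewrite Cmod_opp in HT. split; [exact HT|].
  replace (- (- RtoC (INR (Datatypes.S m)) + h))%C
    with (RtoC (INR (Datatypes.S m)) + - h)%C by ring.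
  rewrite HG. fold c.
  replace (- h * c - T)%C with (- (c * h + T))%C by ring.
  assert (H1 := Cexp_opp_l (c * h + T)%C). assert (H2 := Cexp_neq_0 (- (c * h + T))%C).
  replace (Cexp (c * h + T)) with (/ Cexp (- (c * h + T)))%C.
  - field. now split.
  - replace (Cexp (c * h + T))
      with (/ Cexp (- (c * h + T)) * (Cexp (- (c * h + T)) * Cexp (c * h + T)))%C
      by (field; exact H2).
    rewrite H1. ring. }
exists (/ Cmod (RtoC (INR (fact m))) * (exp 1 * (Cmod c + 1) ^ 2 + 2)), r.
split; [exact Hr|]. split.
{ apply Rmult_le_pos; [apply Rlt_le, Rinv_0_lt_compat, Hfp|].
  assert (0 <= exp 1 * (Cmod c + 1) ^ 2); [|lra].
  apply Rmult_le_pos; [apply Rlt_le, exp_pos | apply pow_le; lra]. }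
intros h Hh. assert (Hh0 := Cmod_ge_0 h).
destruct (Hval h Hh) as [T [HT E]]. rewrite E.
destruct (Hval 0%C) as [T0 [HT0 E0]]; [now rewrite Cmod_0|].
rewrite Cplus_0_r in E0. rewrite E0.
assert (T0 = 0%C).
{ apply Cmod_eq_0. apply Rle_antisym; [|apply Cmod_ge_0]. rewrite Cmod_0 in HT0. lra. }
subst T0. replace (c * 0 + 0)%C with (RtoC 0) by ring. rewrite Cexp_0.
replace (/ RtoC (INR (fact m)) * Cexp (c * h + T) - / RtoC (INR (fact m)) * 1
   - c / RtoC (INR (fact m)) * h)%C
  with (/ RtoC (INR (fact m)) * ((Cexp (c * h + T) - 1 - (c * h + T)) + T))%C by now field.
rewrite Cmod_mult, Cmod_inv, Rmult_assoc by exact Hf.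
apply Rmult_le_compat_l; [apply Rlt_le, Rinv_0_lt_compat, Hfp|].
assert (Hz : Cmod (c * h + T) <= (Cmod c + 1) * Cmod h).
{ eapply Rle_trans; [apply Cmod_triangle|]. rewrite Cmod_mult. nra. }
assert (Hz1 : Cmod (c * h + T) <= 1).
{ eapply Rle_trans; [exact Hz|].
  apply Rle_trans with ((Cmod c + 1) * / (Cmod c + 1)).
  - apply Rmult_le_compat_l; lra.
  - rewrite Rinv_r by lra. apply Rle_refl. }
eapply Rle_trans; [apply Cmod_triangle|].
rewrite Rmult_plus_distr_r. apply Rplus_le_compat; [|lra].
eapply Rle_trans; [now apply Cexp_second_order|].
rewrite Rmult_assoc. apply Rmult_le_compat_l; [apply Rlt_le, exp_pos|].
rewrite <- Rpow_mult_distr. apply pow_incr. split; [apply Cmod_ge_0 | exact Hz].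
Qed.

(** * The generalized polygamma function at negative integers *)

Lemma polygamma_off_nat z q : (forall n : nat, z <> RtoC (INR n)) ->
  polygamma z q = polygamma_formula z q.
Proof.
intros Hz. unfold polygamma.
destruct (excluded_middle_informative _) as [[n Hn]|_]; [|reflexivity].
now contradiction (Hz n).
Qed.

Lemma hurwitz_zeta_first_order q s : not_nonpos_int q -> s <> RtoC 1 ->
  first_order (fun t => hurwitz_zeta t q) s (hurwitz_zeta' s q).
Proof.
intros hq Hs.
destruct (analytic_wiener _ _ (proj1 (proj2 (hurwitz_zeta_spec q hq)) s Hs)) as [rho [M [Hr HW]]].
destruct (wiener_first_order _ s rho M Hr HW) as [l Hl].
replace (hurwitz_zeta' s q) with l; [exact Hl|].
symmetry. exact (first_order_C_derive _ _ _ Hl).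
Qed.

Theorem theorem2p2 (m : nat) (q : C)
  (hm : (1 <= m)%nat)
  (hq : forall n : nat, q <> RtoC (- INR n)) :
  polygamma (RtoC (- INR m)) q = negapolygamma m q.
Proof.
destruct m as [|m]; [lia|]. clear hm.
set (z := RtoC (- INR (S m))).
assert (Hz : z = (- RtoC (INR (S m)))%C) by apply RtoC_opp.
assert (Hp := INR_S_pos m).
rewrite polygamma_off_nat.
2:{ intros n E. apply RtoC_inj in E. generalize (pos_INR n). lra. }
assert (Hs : (z + 1)%C <> RtoC 1).
{ intros E. apply (INR_S_neq m).
  replace (RtoC (INR (S m))) with (1 - (z + 1))%C by (rewrite Hz; ring). rewrite E. ring. }
assert (Hzeta : first_order (fun w => hurwitz_zeta (w + 1) q) z (hurwitz_zeta' (z + 1) q)).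
{ destruct (hurwitz_zeta_first_order q (z + 1) hq Hs) as [M [r [Hr [HM H]]]].
  exists M, r. split; [exact Hr|]. split; [exact HM|]. intros h Hh.
  replace (z + h + 1)%C with (z + 1 + h)%C by ring. now apply H. }
assert (HG : first_order (fun w => / Gamma (- w))%C z
   (RtoC (harmonic m - euler_gamma) / RtoC (INR (fact m)))%C).
{ rewrite Hz. apply first_order_inv_Gamma. }
assert (HD := first_order_C_derive _ _ _ (first_order_mult _ _ _ _ _
  (first_order_Cexp_scal euler_gamma z) (first_order_mult _ _ _ _ _ Hzeta HG))).
cbv beta in HD.
(* HD contains the two terms in euler_gamma with opposite signs; only the values of zeta
   and Gamma at the point are still missing. *)
unfold polygamma_formula. unfold Cdiv at 1. rewrite HD.
assert (Hval : hurwitz_zeta (z + 1) q = (- (bernoulli_poly (S m) q / RtoC (INR (S m))))%C).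
{ replace (z + 1)%C with (1 - RtoC (INR (S m)))%C by (rewrite Hz; ring).
  apply (is_hurwitz_zeta_nat q (fun s => hurwitz_zeta s q)); [exact hq | lia |].
  now apply hurwitz_zeta_spec. }
assert (HGamma : Gamma (- z) = RtoC (INR (fact m))).
{ destruct (Gamma_near m 0) as [T [HT E]]; [rewrite Cmod_0; lra|].
  rewrite Cmod_0 in HT.
  assert (T = 0%C).
  { apply Cmod_eq_0. apply Rle_antisym; [|apply Cmod_ge_0]. lra. }
  subst T. rewrite Cplus_0_r in E.
  replace (- z)%C with (RtoC (INR (S m))) by (rewrite Hz; ring).
  rewrite E. replace (0 * RtoC (harmonic m - euler_gamma) - 0)%C with (RtoC 0) by ring.
  rewrite Cexp_0. ring. }
rewrite Hval, HGamma.
unfold negapolygamma, negapolygamma_A.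
replace (1 - RtoC (INR (S m)))%C with (z + 1)%C by (rewrite Hz; ring).
replace (S m - 1)%nat with m by lia.
rewrite fact_simpl, mult_INR.
assert (Hf := INR_fact_neq m). assert (Hm := INR_S_neq m).
rewrite RtoC_minus.
rewrite RtoC_mult.
set (e := Cexp (RtoC euler_gamma * z)).
replace (Cexp (- (RtoC euler_gamma * z))) with (/ e)%C.
2:{ assert (H := Cexp_opp_l (RtoC euler_gamma * z)%C). fold e in H.
    assert (He : e <> 0%C) by apply Cexp_neq_0.
    replace (Cexp (- (RtoC euler_gamma * z))) with (Cexp (- (RtoC euler_gamma * z)) * e / e)%C
      by now field.
    rewrite H. now field. }
assert (He : e <> 0%C) by apply Cexp_neq_0.
field. now repeat split.
Qed.
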